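(* Let $Q\in\mathcal{A}_k$, and let $Y_1,Y_2,\dots$ be i.i.d. with distribution $P=Q$ (the alternative hypothesis $H_1$). Then, as $n\to\infty$, $$\sqrt{n}\,(\widehat{\Delta}^2-\Delta^2)\ \xrightarrow{\mathcal{D}}\ N(0,v^2),$$ where $$v^2=4\left\langle V[f(Y_1)]\bigl(\mu(P)-\mu(N(m_0,\Sigma_0))\bigr),\ \mu(P)-\mu(N(m_0,\Sigma_0))\right\rangle_{H(k)}$$ and $\xrightarrow{\mathcal{D}}$ denotes convergence in distribution.
   Context: $\mathcal{H}$ is a separable Hilbert space, $HS(\mathcal{H})$ is the Hilbert space of Hilbert--Schmidt operators on $\mathcal{H}$, and $\mathcal{H}\oplus HS(\mathcal{H})$ is the direct sum Hilbert space. For $h\in\mathcal{H}$, $h^{\otimes 2}$ is the operator $\langle h,\cdot\rangle_{\mathcal{H}}h$. $k:\mathcal{H}\times\mathcal{H}\to\mathbb{R}$ is a characteristic positive definite kernel with reproducing kernel Hilbert space $H(k)$. For a probability distribution $P$ on $\mathcal{H}$ with $\mathbb{E}_{Y\sim P}[\sqrt{k(Y,Y)}]<\infty$, its kernel mean embedding is $\mu(P)=\mathbb{E}_{Y\sim P}[k(\cdot,Y)]\in H(k)$; ''characteristic'' means $P\mapsto\mu(P)$ is injective. $N(m,\Sigma)$ is the Gaussian distribution on $\mathcal{H}$ with mean $m$ and covariance operator $\Sigma$. It is assumed that $\mathbb{E}[\sqrt{k(Y,Y)}]<\infty$ under all distributions $P$, $N(m_0,\Sigma_0)$ considered. $m_0$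 and $\Sigma_0$ are the mean and covariance operator of $P$. Put $$\Delta^2=\|\mu(P)-\mu(N(m_0,\Sigma_0))\|_{H(k)}^2,\qquad \widehat{\Delta}^2=\Bigl\|\frac1n\sum_{i=1}^n k(\cdot,Y_i)-\mu(N(\widehat m,\widehat\Sigma))\Bigr\|_{H(k)}^2,$$ with $\widehat m=\frac1n\sum_{i=1}^nY_i$ and $\widehat\Sigma=\frac1n\sum_{i=1}^n(Y_i-\widehat m)^{\otimes2}$. Standing assumption: for some $\varepsilon>0$, the map $(m,\Sigma)\mapsto\mu(N(m,\Sigma))$ is twice continuously Fréchet differentiable, with values in $H(k)$, on the ball $B((m_0,\Sigma_0),\varepsilon)=\{x\in\mathcal{H}\oplus HS(\mathcal{H}):\|(m_0,\Sigma_0)-x\|_{\mathcal{H}\oplus HS(\mathcal{H})}<\varepsilon\}$. Let $D_{(m_0,\Sigma_0)}$ denote its Fréchet derivative at $(m_0,\Sigma_0)$, a bounded linear map $\mathcal{H}\oplus HS(\mathcal{H})\to H(k)$. Define $f:\mathcal{H}\to H(k)$ by $$f(x)=k(\cdot,x)-D_{(m_0,\Sigma_0)}\bigl(x-m_0,(x-m_0)^{\otimes2}-\Sigma_0\bigr)-\mu(N(m_0,\Sigma_0)).$$ $V[f(Y_1)]$ denotes the covariance operator of the $H(k)$-valued random variable $f(Y_1)$, i.e. $\langle V[f(Y_1)]h,h'\rangle_{H(k)}=\mathbb{E}[\langle f(Y_1)-\mathbb{E}f(Y_1),h\rangle_{H(k)}\langle f(Y_1)-\mathbb{E}f(Y_1),h'\rangle_{H(k)}]$.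 $S_k$ is the self-adjoint Hilbert--Schmidt operator on $L^2(\mathcal{H},N(m_0,\Sigma_0))$ given by $(S_kg)(x)=\int_{\mathcal{H}}\langle f(x),f(y)\rangle_{H(k)}\,g(y)\,dN(m_0,\Sigma_0)(y)$, with (nonzero) eigenvalues $\lambda_\ell$, repeated according to multiplicity, and corresponding eigenfunctions $\Psi_\ell$ orthonormal in $L^2(\mathcal{H},N(m_0,\Sigma_0))$. For a distribution $Q$ on $\mathcal{H}$, put $\eta(Q)=\mu(Q)-\mu(N(m_0,\Sigma_0))$ and $\eta_\ell(Q)=\int_{\mathcal{H}}\langle\eta(Q),f(y)\rangle_{H(k)}\Psi_\ell(y)\,dN(m_0,\Sigma_0)(y)$. $\mathcal{A}_k$ is the set of non-Gaussian distributions $Q$ on $\mathcal{H}$ with mean $m_0$ and covariance operator $\Sigma_0$ such that (i) $\mathbb{E}_{X\sim Q}[k(X,X)]<\infty$; (ii) $\mathbb{E}_{X\sim Q}[\|(X-m_0,(X-m_0)^{\otimes2}-\Sigma_0)\|^2_{\mathcal{H}\oplus HS(\mathcal{H})}]<\infty$; (iii) $\sum_{\ell=1}^\infty\eta_\ell(Q)^2/\lambda_\ell<\infty$.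
   Formalization: N(m,Σ) does not exist for those Σ in the ball that are not covariance operators, so the smoothness assumption is read as: some C² map on the ball agrees with μ(N(m,Σ)) wherever Σ is one, and D is its derivative; k is taken jointly Borel measurable. *)

(* Defs.v *)
From HB Require Import structures.
From mathcomp Require Import all_boot all_order all_algebra.
From mathcomp Require Import all_classical all_reals all_analysis.
From mathcomp Require Import ring lra.

Set Implicit Arguments.
Unset Strict Implicit.
Unset Printing Implicit Defensive.

Import Order.TTheory GRing.Theory Num.Theory.
Import numFieldNormedType.Exports.

Local Open Scope classical_set_scope.
Local Open Scope ring_scope.

HB.mixin Record CompleteNormedModule_isHilbert (R : realType) H
    & CompleteNormedModule R H := {
  dot : H -> H -> R;
  dotC_subdef : forall x y : H, dot x y = dot y x;
  dotDl_subdef : forall x y z : H, dot (x + y) z = dot x z + dot y z;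
  dotZl_subdef : forall (a : R) (x y : H), dot (a *: x) y = a * dot x y;
  dot_norm_subdef : forall x : H, dot x x = `|x| ^+ 2 }.

#[short(type="hilbertType")]
HB.structure Definition Hilbert (R : realType) :=
  {H of CompleteNormedModule_isHilbert R H & CompleteNormedModule R H}.

HB.mixin Record Hilbert_isSeparable (R : realType) H & Hilbert R H := {
  hilbert_separable : exists u : nat -> H, dense (range u) }.

#[short(type="sepHilbertType")]
HB.structure Definition SepHilbert (R : realType) :=
  {H of Hilbert_isSeparable R H & Hilbert R H}.

Section dot_theory.
Context {R : realType} {H : hilbertType R}.
Implicit Types x y z : H.

Lemma dotC x y : dot x y = dot y x.
Proof. exact: dotC_subdef. Qed.

Lemma dotDl x y z : dot (x + y) z = dot x z + dot y z.
Proof. exact: dotDl_subdef. Qed.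

Lemma dotZl a x y : dot (a *: x) y = a * dot x y.
Proof. exact: dotZl_subdef. Qed.

Lemma dot_norm x : dot x x = `|x| ^+ 2.
Proof. exact: dot_norm_subdef. Qed.

Lemma dotDr x y z : dot x (y + z) = dot x y + dot x z.
Proof. by rewrite dotC dotDl !(dotC x). Qed.

Lemma dotZr a x y : dot x (a *: y) = a * dot x y.
Proof. by rewrite dotC dotZl dotC. Qed.

Lemma dot0l x : dot 0 x = 0.
Proof. by have := dotZl 0 0 x; rewrite scale0r mul0r. Qed.

Lemma dot0r x : dot x 0 = 0.
Proof. by rewrite dotC dot0l. Qed.

Lemma dotNl x y : dot (- x) y = - dot x y.
Proof. by rewrite -scaleN1r dotZl mulN1r. Qed.

Lemma dotNr x y : dot x (- y) = - dot x y.
Proof. by rewrite dotC dotNl dotC. Qed.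

Lemma dot_suml I (r : seq I) (F : I -> H) y :
  dot (\sum_(i <- r) F i) y = \sum_(i <- r) dot (F i) y.
Proof.
elim: r => [|i r IH]; first by rewrite !big_nil dot0l.
by rewrite !big_cons dotDl IH.
Qed.

Lemma normD_sqr x y : `|x + y| ^+ 2 = `|x| ^+ 2 + dot x y *+ 2 + `|y| ^+ 2.
Proof. by rewrite -!dot_norm dotDl !dotDr (dotC y x); ring. Qed.

Lemma dot_sqr_le x y : (dot x y) ^+ 2 <= `|x| ^+ 2 * `|y| ^+ 2.
Proof.
have [->|y0] := eqVneq y 0; first by rewrite dot0r normr0 expr0n/= mulr0.
have ny : 0 < `|y| ^+ 2 by rewrite exprn_gt0// normr_gt0.
pose t := dot x y / `|y| ^+ 2.
have := sqr_ge0 `|x + (- t) *: y|.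
rewrite normD_sqr dotZr normrZ exprMn normrN real_normK ?num_real// => h.
have {h} : 0 <= `|x| ^+ 2 - (dot x y) ^+ 2 / `|y| ^+ 2.
  apply: (le_trans h); rewrite le_eqVlt; apply/orP; left; apply/eqP.
  by rewrite /t; field; rewrite normr_eq0.
by rewrite subr_ge0 ler_pdivrMr.
Qed.

Lemma dot_le x y : `|dot x y| <= `|x| * `|y|.
Proof.
rewrite -(@ler_pXn2r _ 2)// ?nnegrE ?mulr_ge0//.
by rewrite exprMn real_normK ?num_real// dot_sqr_le.
Qed.

End dot_theory.

(* Zero vectors are allowed among the [e i], so that finite-dimensional spaces
   are covered as well; the nonzero [e i] form an orthonormal basis. *)
Definition is_onb {R : realType} {H : hilbertType R} (e : nat -> H) :=
  [/\ forall i j, i != j -> dot (e i) (e j) = 0,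
      forall i, e i = 0 \/ `|e i| = 1 &
      dense [set x | exists n (c : nat -> R), x = \sum_(i < n) c i *: e i]].

Section gram_schmidt.
Context {R : realType} {H : sepHilbertType R} (u : nat -> H).

Definition normalize (x : H) : H := `|x|^-1 *: x.

Definition gs_res (e : nat -> H) n := u n - \sum_(i < n) dot (u n) (e i) *: e i.

Fixpoint gs n : nat -> H := if n is m.+1 then
  fun i => if i == m then normalize (gs_res (gs m) m) else gs m i else fun=> 0.

Definition gs_vec i := gs i.+1 i.

Lemma gsE n i : (i < n)%N -> gs n i = gs_vec i.
Proof.
elim: n => // n IH; rewrite ltnS leq_eqVlt => /predU1P[->//|i_n] /=.
by rewrite ltn_eqF// IH.
Qed.

Lemma gs_vecE n : gs_vec n = normalize (gs_res gs_vec n).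
Proof.
rewrite {1}/gs_vec /= eqxx; congr normalize; rewrite /gs_res; congr (_ - _).
by apply: eq_bigr => i _; rewrite gsE.
Qed.

Lemma gs_vec_unit i : gs_vec i = 0 \/ `|gs_vec i| = 1.
Proof.
rewrite gs_vecE /normalize; have [->|r0] := eqVneq (gs_res gs_vec i) 0.
  by left; rewrite scaler0.
by right; rewrite normrZ ger0_norm ?invr_ge0// mulVf// normr_eq0.
Qed.

Lemma gs_vec_ortho n : forall i j, (i < n)%N -> (j < n)%N -> i != j ->
  dot (gs_vec i) (gs_vec j) = 0.
Proof.
elim: n => // n IH.
have key i : (i < n)%N -> dot (gs_vec n) (gs_vec i) = 0.
  move=> i_n; rewrite (gs_vecE n) /normalize dotZl.
  suff -> : dot (gs_res gs_vec n) (gs_vec i) = 0 by rewrite mulr0.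
  rewrite /gs_res dotDl dotNl dot_suml.
  rewrite (bigD1 (Ordinal i_n))//= big1 ?addr0; last first.
    move=> j ji; by rewrite dotZl IH ?mulr0.
  rewrite dotZl dot_norm; case: (gs_vec_unit i) => [->|->].
    by rewrite dot0r mul0r subr0.
  by rewrite expr1n mulr1 subrr.
move=> i j; rewrite !ltnS leq_eqVlt (leq_eqVlt j) => /predU1P[->|i_n] /predU1P[->|j_n].
- by rewrite eqxx.
- by rewrite key.
- by rewrite dotC key.
- exact: IH.
Qed.

Lemma gram_schmidt_onb : dense (range u) -> exists e : nat -> H, is_onb e.
Proof.
move=> du; exists gs_vec; split; [|exact: gs_vec_unit|].
  move=> i j ij; apply: (@gs_vec_ortho (maxn i j).+1) => //.
    by rewrite ltnS leq_maxl.
  by rewrite ltnS leq_maxr.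
move=> O O0 oO; have [x [Ox [n _ unx]]] := du O O0 oO.
exists x; split => //; rewrite -unx.
exists n.+1, (fun i => if i == n then `|gs_res gs_vec n| else dot (u n) (gs_vec i)).
rewrite big_ord_recr/= eqxx gs_vecE /normalize scalerA.
rewrite (eq_bigr (fun i : 'I_n => dot (u n) (gs_vec i) *: gs_vec i)); last first.
  by move=> i _; rewrite ltn_eqF.
have -> : (`|gs_res gs_vec n| * `|gs_res gs_vec n|^-1) *: gs_res gs_vec n =
    gs_res gs_vec n.
  have [->|r0] := eqVneq (gs_res gs_vec n) 0; first by rewrite scaler0.
  by rewrite divff ?scale1r// normr_eq0.
by rewrite /gs_res addrCA subrr addr0.
Qed.

End gram_schmidt.

Lemma ex_onb {R : realType} (H : sepHilbertType R) : exists e : nat -> H, is_onb e.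
Proof. by have [u /gram_schmidt_onb] := @hilbert_separable R H. Qed.

Definition onb {R : realType} (H : sepHilbertType R) : nat -> H := projT1 (cid (ex_onb H)).

Lemma onbP {R : realType} (H : sepHilbertType R) : is_onb (onb H).
Proof. exact: projT2 (cid (ex_onb H)). Qed.

Lemma bessel {R : realType} (H : sepHilbertType R) (x : H) n :
  \sum_(i < n) (dot x (onb H i)) ^+ 2 <= `|x| ^+ 2.
Proof.
have [oe ue _] := onbP H; set e := onb H in oe ue *.
suff -> : `|x| ^+ 2 = \sum_(i < n) (dot x (e i)) ^+ 2 +
    `|x - \sum_(i < n) dot x (e i) *: e i| ^+ 2 by rewrite lerDl sqr_ge0.
rewrite normD_sqr normrN dotNr -(dot_norm (\sum_(i < n) _)) dot_suml.
have H1 : dot x (\sum_(i < n) dot x (e i) *: e i) = \sum_(i < n) (dot x (e i)) ^+ 2.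
  by rewrite dotC dot_suml; apply: eq_bigr => i _; rewrite dotZl dotC expr2.
have H2 (i : 'I_n) : dot (dot x (e i) *: e i) (\sum_(j < n) dot x (e j) *: e j) =
    (dot x (e i)) ^+ 2.
  rewrite dotC dot_suml (bigD1 i)//= big1 ?addr0; last first.
    by move=> j ji; rewrite dotZl dotZr oe// !mulr0.
  rewrite dotZl dotZr dot_norm; case: (ue i) => ->; last by ring.
  by rewrite dot0r; ring.
by rewrite H1 (eq_bigr _ (fun i _ => H2 i)); ring.
Qed.

(* The squared Hilbert-Schmidt norm; it does not depend on the choice of the basis. *)
Definition hs_sqnorm {R : realType} {H : sepHilbertType R} (T : H -> H) : \bar R :=
  (\sum_(0 <= i <oo) (`|T (onb H i)| ^+ 2)%:E)%E.

Definition hilbert_schmidt {R : realType} {H : sepHilbertType R} : {pred H -> H} :=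
  fun T => `[< [/\ linear T, continuous T & (hs_sqnorm T < +oo)%E] >].

Section hs_sqnorm_theory.
Context {R : realType} {H : sepHilbertType R}.
Implicit Types S T : H -> H.
Local Notation e := (onb H).

Lemma hs_sqnorm_ge0 T : (0 <= hs_sqnorm T)%E.
Proof. by apply: nneseries_ge0 => i _ _; rewrite lee_fin sqr_ge0. Qed.

Lemma hs_sqnormZ a T : hs_sqnorm (a *: T) = ((a ^+ 2)%:E * hs_sqnorm T)%E.
Proof.
rewrite /hs_sqnorm -nneseriesZl; last by move=> i _; rewrite lee_fin sqr_ge0.
apply: eq_eseriesr => i _.
by rewrite /= normrZ exprMn real_normK ?num_real// EFinM.
Qed.

Lemma hs_sqnormD (c d : R) S T : 0 < c -> 0 < d ->
  (hs_sqnorm S <= (c ^+ 2)%:E)%E -> (hs_sqnorm T <= (d ^+ 2)%:E)%E ->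
  (hs_sqnorm (S + T)%R <= ((c + d) ^+ 2)%:E)%E.
Proof.
move=> c0 d0 hS hT.
apply: (@le_trans _ _
    ((1 + d / c)%:E * hs_sqnorm S + (1 + c / d)%:E * hs_sqnorm T)%E).
  have ca : 0 <= 1 + d / c by rewrite addr_ge0// divr_ge0// ltW.
  have da : 0 <= 1 + c / d by rewrite addr_ge0// divr_ge0// ltW.
  rewrite /hs_sqnorm -!nneseriesZl; try by move=> i _; rewrite lee_fin sqr_ge0.
  rewrite -nneseriesD; try by move=> i _ _; rewrite -EFinM lee_fin mulr_ge0 ?sqr_ge0.
  apply: lee_nneseries => i _; rewrite ?lee_fin ?sqr_ge0//.
  apply: (@le_trans _ _ ((`|S (e i)| + `|T (e i)|) ^+ 2)).
    by rewrite lerXn2r ?nnegrE ?addr_ge0// ler_normD.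
  set a := `|S _|; set b := `|T _|; rewrite -subr_ge0.
  suff -> : (1 + d / c) * a ^+ 2 + (1 + c / d) * b ^+ 2 - (a + b) ^+ 2 =
      (d * a - c * b) ^+ 2 / (c * d) by rewrite divr_ge0 ?sqr_ge0// mulr_ge0// ltW.
  by field; rewrite !gt_eqF.
have -> : ((c + d) ^+ 2)%:E =
    ((1 + d / c)%:E * (c ^+ 2)%:E + (1 + c / d)%:E * (d ^+ 2)%:E)%E.
  by rewrite -!EFinM -EFinD; congr EFin; field; rewrite !gt_eqF.
by apply: leeD; apply: lee_wpmul2l => //;
  rewrite lee_fin addr_ge0// divr_ge0// ltW.
Qed.

End hs_sqnorm_theory.

Record hs_op (R : realType) (H : sepHilbertType R) := HSOp {
  hs_fun :> H -> H;
  hs_funP : hs_fun \in @hilbert_schmidt R H }.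
Arguments hs_fun {R H}.

HB.instance Definition _ (R : realType) (H : sepHilbertType R) :=
  [isSub for @hs_fun R H].
HB.instance Definition _ (R : realType) (H : sepHilbertType R) :=
  [Choice of hs_op H by <:].

Section hs_space.
Context {R : realType} {H : sepHilbertType R}.
Local Notation e := (onb H).

Lemma hs_opP (T : hs_op H) : [/\ linear T, continuous T & (hs_sqnorm T < +oo)%E].
Proof. by move/asboolP: (hs_funP T) => h; exact: h. Qed.

Lemma hs_sqnorm_fin (T : hs_op H) : hs_sqnorm T = (fine (hs_sqnorm T))%:E.
Proof.
by have [_ _ ?] := hs_opP T; rewrite fineK// ge0_fin_numE// hs_sqnorm_ge0.
Qed.

Lemma hilbert_schmidt_submod_closed : submod_closed (@hilbert_schmidt R H).
Proof.
split.
  apply/asboolP; split.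
  - by move=> a x y /=; rewrite scaler0 addr0.
  - by move=> x; exact: cst_continuous.
  - rewrite /hs_sqnorm eseries0 ?ltry// => i _ _ /=.
    by rewrite normr0 expr0n.
move=> a S T /asboolP[lS cS fS] /asboolP[lT cT fT].
apply/asboolP; split.
- move=> b x y; rewrite !fctE lS lT !scalerDr !scalerA (mulrC a b).
  by rewrite addrACA.
- move=> x; apply: cvgD; last exact: cT.
  by apply: cvgZr; exact: cS.
- have bnd (U : H -> H) : (hs_sqnorm U < +oo)%E ->
      exists2 c : R, 0 < c & (hs_sqnorm U <= (c ^+ 2)%:E)%E.
    move=> fU; exists (1 + fine (hs_sqnorm U)).
      by rewrite ltr_pwDl// fine_ge0// hs_sqnorm_ge0.
    rewrite -[leLHS]fineK ?ge0_fin_numE ?hs_sqnorm_ge0// lee_fin.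
    have : 0 <= fine (hs_sqnorm U) by rewrite fine_ge0// hs_sqnorm_ge0.
    by nra.
  have [|c c0 hc] := bnd (a *: S).
    by rewrite hs_sqnormZ lte_mul_pinfty// ?lee_fin ?sqr_ge0.
  have [d d0 hd] := bnd _ fT.
  exact: le_lt_trans (hs_sqnormD c0 d0 hc hd) (ltry _).
Qed.

HB.instance Definition _ :=
  GRing.isSubmodClosed.Build _ _ (@hilbert_schmidt R H) hilbert_schmidt_submod_closed.
HB.instance Definition _ := [SubChoice_isSubLmodule of hs_op H by <:].

Definition hs_norm (T : hs_op H) : R := Num.sqrt (fine (hs_sqnorm T)).

Let hs_norm_sqr T : (hs_norm T ^+ 2)%:E = hs_sqnorm T.
Proof. by rewrite sqr_sqrtr -?hs_sqnorm_fin// fine_ge0// hs_sqnorm_ge0. Qed.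

Lemma hs_normD S T : hs_norm (S + T) <= hs_norm S + hs_norm T.
Proof.
apply/ler_addgt0Pr => eps eps0.
have n0 U : 0 <= hs_norm U by exact: sqrtr_ge0.
pose c := hs_norm S + eps / 2; pose d := hs_norm T + eps / 2.
have c0 : 0 < c by rewrite ltr_wpDl// divr_gt0.
have d0 : 0 < d by rewrite ltr_wpDl// divr_gt0.
have hc : (hs_sqnorm S <= (c ^+ 2)%:E)%E.
  by rewrite -hs_norm_sqr lee_fin lerXn2r ?nnegrE ?(ltW c0)// lerDl divr_ge0// ltW.
have hd : (hs_sqnorm T <= (d ^+ 2)%:E)%E.
  by rewrite -hs_norm_sqr lee_fin lerXn2r ?nnegrE ?(ltW d0)// lerDl divr_ge0// ltW.
have -> : hs_norm S + hs_norm T + eps = c + d by rewrite /c /d; field.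
have := hs_sqnormD c0 d0 hc hd; rewrite -[X in (X <= _)%E]/(hs_sqnorm (S + T : hs_op H)).
by rewrite -hs_norm_sqr lee_fin ler_pXn2r// nnegrE ?n0// addr_ge0// ltW.
Qed.

Lemma hs_normZ (a : R) T : hs_norm (a *: T) = `|a| * hs_norm T.
Proof.
rewrite /hs_norm -[hs_sqnorm _]/(hs_sqnorm (a *: (T : H -> H))) hs_sqnormZ.
by rewrite hs_sqnorm_fin -EFinM/= sqrtrM ?sqr_ge0// sqrtr_sqr.
Qed.

Lemma hs_norm0_eq0 T : hs_norm T = 0 -> T = 0.
Proof.
move=> T0; have [lT cT _] := hs_opP T; have [_ _ de] := onbP H.
have {}T0 : hs_sqnorm T = 0%E by rewrite -hs_norm_sqr T0 expr0n.
have Te i : T (e i) = 0.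
  apply/eqP; rewrite -normr_eq0 -sqrf_eq0; apply/eqP.
  pose f j := (`|T (e j)| ^+ 2)%:E.
  have f0 k : xpredT k -> (0 <= f k)%E by rewrite lee_fin sqr_ge0.
  have := nneseriesD1 f0 (isT : xpredT i).
  rewrite -/(hs_sqnorm T) T0 => /esym/eqP.
  rewrite padde_eq0 ?lee_fin ?sqr_ge0//.
    by move=> /andP[/eqP[]].
  by apply: nneseries_ge0 => k _ _; rewrite lee_fin sqr_ge0.
apply/val_inj/funext => x /=; apply/eqP; rewrite -normr_eq0.
apply: contrapT => /negP Tx.
have oT : open [set y | 0 < `|T y|].
  apply: (@open_comp _ _ (fun y => `|T y|) [set r : R | 0 < r]); last exact: open_gt.
  by move=> y _; apply: cvg_norm; exact: cT.
have [|z [Tz [n [c zE]]]] := de _ _ oT.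
  by exists x; rewrite /= lt_neqAle eq_sym Tx normr_ge0.
move: Tz; rewrite /= zE.
pose T' : {linear H -> H} := HB.pack (T : H -> H) (GRing.isLinear.Build _ _ _ _ (T : H -> H) lT).
rewrite -[T _]/(T' _) linear_sum big1 ?normr0 ?ltxx// => i _.
by rewrite linearZ/= -/(T (e i)) Te scaler0.
Qed.

HB.instance Definition _ :=
  Lmodule_isNormed.Build R (hs_op H) hs_normD hs_normZ hs_norm0_eq0.

Lemma tensor_sq_hs (h : H) : (fun x => dot h x *: h) \in @hilbert_schmidt R H.
Proof.
have lT : linear (fun x => dot h x *: h).
  by move=> a x y; rewrite dotDr dotZr scalerDl scalerA.
apply/asboolP; split => //.
- pose T : {linear H -> H} := HB.pack (fun x => dot h x *: h) (GRing.isLinear.Build _ _ _ _ _ lT).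
  rewrite -[X in continuous X]/(T : H -> H).
  apply: bounded_linear_continuous; apply/linear_boundedP.
  exists (`|h| ^+ 2); split; first exact: num_real.
  move=> M hM x /=; rewrite normrZ mulrC.
  apply: (@le_trans _ _ (`|h| * (`|h| * `|x|))); first by rewrite ler_wpM2l// dot_le.
  by rewrite mulrA -expr2 ler_wpM2r// ltW.
- apply: (@le_lt_trans _ _ (`|h| ^+ 4)%:E); last exact: ltry.
  apply: lime_le.
    by apply: is_cvg_nneseries => i _ _; rewrite lee_fin sqr_ge0.
  apply: nearW => n; rewrite sumEFin lee_fin big_mkord.
  have -> : \sum_(i < n) `|dot h (e i) *: h| ^+ 2 =
      (\sum_(i < n) dot h (e i) ^+ 2) * `|h| ^+ 2.
    rewrite mulr_suml; apply: eq_bigr => i _.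
    by rewrite normrZ exprMn real_normK ?num_real.
  by rewrite (exprD _ 2 2) ler_wpM2r ?sqr_ge0// bessel.
Qed.

Definition tensor_sq (h : H) : hs_op H := HSOp (tensor_sq_hs h).

End hs_space.

(* The library norm on [U * V] is the maximum norm; [hsum U V] carries the
   direct sum (Euclidean) norm. *)
Definition hsum (R : realType) (U V : normedModType R) : Type := (U * V)%type.

HB.instance Definition _ (R : realType) (U V : normedModType R) :=
  GRing.Lmodule.on (hsum U V).

Section hsum_norm.
Context {R : realType} {U V : normedModType R}.
Implicit Types x y : hsum U V.

Definition hsum_norm x : R := Num.sqrt (`|x.1| ^+ 2 + `|x.2| ^+ 2).

Lemma hsum_normD x y : hsum_norm (x + y) <= hsum_norm x + hsum_norm y.
Proof.
have s0 (a b : R) : 0 <= a ^+ 2 + b ^+ 2 by rewrite addr_ge0 ?sqr_ge0.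
rewrite -(@ler_pXn2r _ 2)// ?nnegrE ?addr_ge0 ?sqrtr_ge0//.
rewrite sqrrD !sqr_sqrtr//.
set a := `|x.1|; set b := `|x.2|; set c := `|y.1|; set d := `|y.2|.
have [a0 b0 c0 d0] : [/\ 0 <= a, 0 <= b, 0 <= c & 0 <= d].
  by split; exact: normr_ge0.
have sq (p q : R) : 0 <= p -> p <= q -> p ^+ 2 <= q ^+ 2.
  by move=> p0 pq; rewrite lerXn2r ?nnegrE// (le_trans p0).
have h1 : `|(x + y).1| ^+ 2 <= (a + c) ^+ 2 := sq _ _ (normr_ge0 _) (ler_normD x.1 y.1).
have h2 : `|(x + y).2| ^+ 2 <= (b + d) ^+ 2 := sq _ _ (normr_ge0 _) (ler_normD x.2 y.2).
have h3 : a * c + b * d <= hsum_norm x * hsum_norm y.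
  rewrite /hsum_norm -sqrtrM// -[leLHS]ger0_norm ?addr_ge0 ?mulr_ge0//.
  rewrite -sqrtr_sqr ler_sqrt ?mulr_ge0//.
  by rewrite -subr_ge0; have := sqr_ge0 (a * d - b * c); rewrite /a /b /c /d; nra.
by lra.
Qed.

Lemma hsum_normZ (a : R) x : hsum_norm (a *: x) = `|a| * hsum_norm x.
Proof.
rewrite /hsum_norm -[(a *: x).1]/(a *: x.1) -[(a *: x).2]/(a *: x.2).
rewrite !normrZ !exprMn -mulrDr sqrtrM ?sqr_ge0//.
by rewrite sqrtr_sqr normr_id.
Qed.

Lemma hsum_norm0_eq0 x : hsum_norm x = 0 -> x = 0.
Proof.
move=> /eqP; rewrite sqrtr_eq0 => h.
have [h1 h2] : `|x.1| ^+ 2 = 0 /\ `|x.2| ^+ 2 = 0.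
  by have := sqr_ge0 `|x.1|; have := sqr_ge0 `|x.2|; split; lra.
move/eqP: h1; rewrite sqrf_eq0 normr_eq0 => /eqP h1.
move/eqP: h2; rewrite sqrf_eq0 normr_eq0 => /eqP h2.
by case: x {h} h1 h2 => x1 x2 /= -> ->.
Qed.

HB.instance Definition _ :=
  Lmodule_isNormed.Build R (hsum U V) hsum_normD hsum_normZ hsum_norm0_eq0.

End hsum_norm.

Section smoothness.
Context {R : realType} {U V : normedModType R}.

Definition bounded_bilinear (b : U -> U -> V) :=
  [/\ forall h, linear (b h), forall u, linear (b^~ u) &
      exists M : R, forall h u, `|b h u| <= M * `|h| * `|u|].

(* [D2 x] is the second derivative at [x], identified with a bounded bilinear
   map; the last two items are Frechet differentiability of [x |-> 'd F x] and
   continuity of [D2] for the operator norms, written out. *)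
Definition twice_continuously_differentiable_on (B : set U) (F : U -> V) :=
  exists D2 : U -> U -> U -> V, forall x, B x ->
    [/\ differentiable F x,
        bounded_bilinear (D2 x),
        forall eps : R, 0 < eps -> \forall h \near (0 : U), forall u,
          `|'d F (x + h) u - 'd F x u - D2 x h u| <= eps * `|h| * `|u| &
        forall eps : R, 0 < eps -> \forall y \near x, forall h u,
          `|D2 y h u - D2 x h u| <= eps * `|h| * `|u|].

End smoothness.

Definition borel {R : realType} (H : normedModType R) := g_sigma_algebraType (@open H).

Section hilbert_moments.
Context {R : realType} {d : measure_display} {T : measurableType d}.
Variable P : probability T R.
Context {K : hilbertType R}.

(* Expectations of Hilbert space valued variables are taken in the weak sense,
   which agrees with the Bochner integral whenever the latter exists. *)
Definition is_hilbert_mean (X : T -> K) (m : K) := forall h : K,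
  P.-integrable setT (fun w => (dot (X w) h)%:E) /\
  dot m h = \int[P]_w dot (X w) h.

Definition hilbert_mean (X : T -> K) : K := get (is_hilbert_mean X).

Definition is_hilbert_cov (X : T -> K) (V : K -> K) := forall h h' : K,
  let Z w := X w - hilbert_mean X in
  P.-integrable setT (fun w => (dot (Z w) h * dot (Z w) h')%:E) /\
  dot (V h) h' = \int[P]_w (dot (Z w) h * dot (Z w) h').

Definition hilbert_cov (X : T -> K) : K -> K := get (is_hilbert_cov X).

End hilbert_moments.

Section gaussian.
Context {R : realType}.

(* The library's [normal_prob m 0] is not the Dirac mass at [m]. *)
Definition real_gaussian (m v : R) : probability (measurableTypeR R) R :=
  if v == 0 as _ return probability (measurableTypeR R) R
  then dirac (m : measurableTypeR R) else normal_prob m (Num.sqrt v).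

Context {H : sepHilbertType R}.

(* Self-adjoint, nonnegative and trace class: exactly the operators [S] for
   which the Gaussian measures [gaussian m S] below exist. *)
Definition covariance_operator (S : H -> H) :=
  [/\ forall h h', dot (S h) h' = dot h (S h'),
      forall h, 0 <= dot (S h) h &
      (\sum_(0 <= i <oo) (dot (S (onb H i)) (onb H i))%:E < +oo)%E].

Definition is_gaussian (m : H) (S : H -> H) (P : probability (borel H) R) :=
  covariance_operator S /\
  forall h (A : set (measurableTypeR R)), measurable A ->
    P [set x : borel H | A (dot (x : H) h)] =
    real_gaussian (dot m h) (dot (S h) h) A.

Definition gaussian (m : H) (S : H -> H) : probability (borel H) R :=
  get (is_gaussian m S).

End gaussian.

Section kernels.
Context {R : realType} {H : sepHilbertType R} {Hk : hilbertType R}.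
Variable k : H -> H -> R.

Definition positive_definite_kernel :=
  (forall x y, k x y = k y x) /\
  forall n (x : 'I_n -> H) (c : 'I_n -> R),
    0 <= \sum_i \sum_j c i * c j * k (x i) (x j).

(* [Hk] is the reproducing kernel Hilbert space of [k]: its elements are
   identified with functions through [ev], and [Phi x] is [k (., x)]. *)
Definition is_rkhs (ev : Hk -> H -> R) (Phi : H -> Hk) :=
  [/\ forall (a : R) g h x, ev (a *: g + h) x = a * ev g x + ev h x,
      injective ev,
      forall x y, ev (Phi x) y = k y x &
      forall h x, dot h (Phi x) = ev h x].

Definition kme_integrable (P : probability (borel H) R) :=
  (\int[P]_x (Num.sqrt (k x x))%:E < +oo)%E.

Variable Phi : H -> Hk.

Definition kme (P : probability (borel H) R) : Hk := hilbert_mean P (Phi : borel H -> Hk).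

Definition characteristic := forall P Q : probability (borel H) R,
  kme_integrable P -> kme_integrable Q -> kme P = kme Q ->
  forall A, measurable A -> P A = Q A.

End kernels.

(* [J] indexes the nonzero eigenvalues, of which there may be finitely many;
   the last item says that they are all listed, with their multiplicities. *)
Record is_eigensystem {R : realType} {H : sepHilbertType R} {Hk : hilbertType R}
    (N : probability (borel H) R) (f : H -> Hk)
    (J : set nat) (lam : nat -> R) (Psi : nat -> borel H -> R) : Prop :=
  IsEigensystem {
  eigen_hs : (\int[N]_x \int[N]_y ((dot (f x) (f y)) ^+ 2)%:E < +oo)%E;
  eigen_L2 : forall l, J l -> measurable_fun setT (Psi l) /\
    (\int[N]_x ((Psi l x) ^+ 2)%:E < +oo)%E;
  eigen_orthonormal : forall l l', J l -> J l' ->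
    \int[N]_x (Psi l x * Psi l' x) = (l == l')%:R;
  eigen_neq0 : forall l, J l -> lam l != 0;
  eigen_eq : forall l, J l -> {ae N, forall x,
    \int[N]_y (dot (f x) (f y) * Psi l y) = lam l * Psi l x};
  eigen_complete : forall (c : R) (g : borel H -> R), c != 0 ->
    measurable_fun setT g -> (\int[N]_x ((g x) ^+ 2)%:E < +oo)%E ->
    {ae N, forall x, \int[N]_y (dot (f x) (f y) * g y) = c * g x} ->
    (forall l, J l -> \int[N]_x (g x * Psi l x) = 0) ->
    {ae N, forall x, g x = 0} }.

Section testing.
Context {R : realType} {H : sepHilbertType R} {Hk : hilbertType R}.
Variables (k : H -> H -> R) (Phi : H -> Hk).

Definition centered_feature (G : hsum H (hs_op H) -> Hk) (m0 : H) (S0 : hs_op H)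
    (x : H) : Hk :=
  Phi x - 'd G ((m0, S0) : hsum H (hs_op H)) (x - m0, tensor_sq (x - m0) - S0)
  - kme Phi (gaussian m0 S0).

Definition eta (m0 : H) (S0 : hs_op H) (Q : probability (borel H) R) : Hk :=
  kme Phi Q - kme Phi (gaussian m0 S0).

Definition eta_coef (f : H -> Hk) (m0 : H) (S0 : hs_op H) (Psi : nat -> borel H -> R)
    (Q : probability (borel H) R) (l : nat) : R :=
  \int[gaussian m0 S0]_y (dot (eta m0 S0 Q) (f y) * Psi l y).

Record alternative (f : H -> Hk) (m0 : H) (S0 : hs_op H)
    (J : set nat) (lam : nat -> R) (Psi : nat -> borel H -> R)
    (Q : probability (borel H) R) : Prop := Alternative {
  alt_nongaussian : ~ exists (m : H) (S : hs_op H), is_gaussian m S Q;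
  alt_mean : is_hilbert_mean Q (id : borel H -> H) m0;
  alt_cov : is_hilbert_cov Q (id : borel H -> H) S0;
  alt_kernel : (\int[Q]_x (k x x)%:E < +oo)%E;
  alt_moment : (\int[Q]_x
    (`|((x : H) - m0, tensor_sq ((x : H) - m0) - S0) : hsum H (hs_op H)| ^+ 2)%:E
    < +oo)%E;
  alt_eigen :
    (\esum_(l in J) ((eta_coef f m0 S0 Psi Q l) ^+ 2 / lam l)%:E < +oo)%E }.

Definition sample_mean (n : nat) (y : nat -> H) : H := n%:R^-1 *: \sum_(i < n) y i.

Definition sample_cov (n : nat) (y : nat -> H) : hs_op H :=
  n%:R^-1 *: \sum_(i < n) tensor_sq (y i - sample_mean n y).

Definition mmd_sq (m0 : H) (S0 : hs_op H) (Q : probability (borel H) R) : R :=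
  `|kme Phi Q - kme Phi (gaussian m0 S0)| ^+ 2.

Definition sample_mmd_sq (n : nat) (y : nat -> H) : R :=
  `|n%:R^-1 *: \sum_(i < n) Phi (y i)
    - kme Phi (gaussian (sample_mean n y) (sample_cov n y))| ^+ 2.

End testing.

Section sequences_of_variables.
Context {R : realType} {d : measure_display} {T : measurableType d}.
Variable P : probability T R.

Definition iid_with_law {d' : measure_display} {E : measurableType d'}
    (Y : nat -> T -> E) (Q : probability E R) :=
  [/\ forall i, measurable_fun setT (Y i),
      forall i A, measurable A -> P (Y i @^-1` A) = Q A &
      forall (s : seq nat) (A : nat -> set E), uniq s ->
        (forall i, measurable (A i)) ->
        P (\bigcap_(i in [set` s]) (Y i @^-1` A i)) =
        (\prod_(i <- s) P (Y i @^-1` A i))%E].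

(* The functions [X n] need not be assumed measurable: for bounded [g], the
   integrals on the left are total, and are expectations when [X n] is. *)
Definition cvg_in_distribution (X : nat -> T -> R) (mu : probability (measurableTypeR R) R) :=
  forall g : R -> R, continuous g -> (exists M, forall x, `|g x| <= M) ->
    (fun n => \int[P]_w g (X n w)) @ \oo --> \int[mu]_x g x.

End sequences_of_variables.

(* Main.v *)
Require Import Defs.
From HB Require Import structures.
From mathcomp Require Import all_boot all_order all_algebra.
From mathcomp Require Import all_classical all_reals all_analysis.
From mathcomp Require Import measurable_realfun.
From mathcomp Require Import ring lra.

Set Implicit Arguments.
Unset Strict Implicit.
Unset Printing Implicit Defensive.

Import Order.TTheory GRing.Theory Num.Theory.
Import numFieldNormedType.Exports.

Local Open Scope classical_set_scope.
Local Open Scope ring_scope.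

(** Why the theorem holds: this is the delta method, carried out in the Hilbert
    space [Hk]. Let [D] be the derivative of [G] at [(m0, S0)] and
    [Z x = (x - m0, tensor_sq (x - m0) - S0)] ([moment_vector]). The sample mean
    and covariance differ from [(m0, S0)] by the mean of the [Z (Y i)], up to
    the quadratic correction [(0, tensor_sq (mean - m0))] ([sample_moments]). A
    sample covariance is always a covariance operator, so that [G] does compute
    the mean embedding of the fitted Gaussian, and the Frechet expansion of [G]
    shows ([embedding_linearization]) that the difference of mean embeddings in
    the statistic is [h + A + r]. Here [A] is the mean of the centered vectors
    [f (Y i) - h] ([influence]) and [r] is of smaller order. Expanding the
    squared norm, [sqrt n * (hatDelta2 - Delta2)] is the normalized sum of the
    real variables [2 * dot (f (Y i) - h) h], plus an error.

    The error is handled by second moments alone. On the event where the sums of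
    the [Z (Y i)] and of the centered features have norm at most [K * sqrt n],
    the error is bounded by a quantity that tends to zero ([remainder_rate]), and
    by Markov's inequality this event has probability close to one for large [K].
    That the second moments of the two sums grow linearly with [n] is shown with
    the kernel for the features, which take values in a space that may fail to
    be separable ([feature_sum_second_moment]), and coordinate by coordinate for
    the moment vectors ([moment_vector_second_moment]). Slutsky's lemma
    ([cvg_in_distribution_perturb]) then reduces the theorem to the central limit
    theorem for real variables.

    Means of Hilbert space valued variables are weak ones, so the measurability
    of [dot (Phi x) u] for every [u] ([rkhs_measurable]), the existence of means
    and covariances ([weak_mean_exists], [hilbert_cov_diag]) and the fact that
    [D (Z (Y i))] is centered ([additive_second_moment_mean0]) each require an
    argument. The first two rest on the Riesz representation theorem, the last
    one on the linear growth of second moments.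

    The central limit theorem ([central_limit_theorem]) is proved by Trotter's
    operator method. Adding an independent variable to the argument of a test
    function composes averaging operators ([iid_sum_shift_mean]). For the
    Gaussian the composition is known exactly ([gaussian_shift_mean_iter]); the
    operators commute and contract the supremum norm, so a second order Taylor
    expansion, which compares one step up to [o(1 / n)], suffices ([clt_iter]).
    Bounded continuous test functions are first replaced by functions with a
    uniform Taylor expansion ([smooth_test_function]). *)

(** * Integrable real functions *)

Section real_integrable.
Context {d : measure_display} {T : measurableType d} {R : realType}.
Variable mu : {measure set T -> \bar R}.
Implicit Types f g : T -> R.

Lemma rintegrable_meas f : mu.-integrable setT (fun x => (f x)%:E) ->
  measurable_fun setT f.
Proof. by move=> /measurable_int/measurable_EFinP. Qed.

Lemma rintegrableD f g : mu.-integrable setT (fun x => (f x)%:E) ->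
  mu.-integrable setT (fun x => (g x)%:E) ->
  mu.-integrable setT (fun x => (f x + g x)%:E).
Proof. by move=> fi gi; exact: (integrableD measurableT fi gi). Qed.

Lemma rintegrableB f g : mu.-integrable setT (fun x => (f x)%:E) ->
  mu.-integrable setT (fun x => (g x)%:E) ->
  mu.-integrable setT (fun x => (f x - g x)%:E).
Proof. by move=> fi gi; exact: (integrableB measurableT fi gi). Qed.

Lemma rintegrableZ (c : R) f : mu.-integrable setT (fun x => (f x)%:E) ->
  mu.-integrable setT (fun x => (c * f x)%:E).
Proof. by move=> fi; exact: (integrableZl measurableT c fi). Qed.

Lemma rintegrable_sum I (s : seq I) (F : I -> T -> R) :
  (forall i, mu.-integrable setT (fun x => (F i x)%:E)) ->
  mu.-integrable setT (fun x => (\sum_(i <- s) F i x)%:E).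
Proof.
move=> Fi; rewrite (_ : (fun _ => _) = (fun x => (\sum_(i <- s) (F i x)%:E)%E)).
  by apply: (integrable_sum measurableT) => i _; exact: Fi.
by apply/funext => x; rewrite sumEFin.
Qed.

Lemma rintegrable_le f g : measurable_fun setT f -> (forall x, `|f x| <= g x) ->
  mu.-integrable setT (fun x => (g x)%:E) -> mu.-integrable setT (fun x => (f x)%:E).
Proof.
move=> mf fg; apply: le_integrable => //; first exact/measurable_EFinP.
by move=> x _; rewrite /= lee_fin (le_trans (fg x))// ler_norm.
Qed.

Lemma rintegrable_ge0 f : measurable_fun setT f -> (forall x, 0 <= f x) ->
  (\int[mu]_x (f x)%:E < +oo)%E -> mu.-integrable setT (fun x => (f x)%:E).
Proof.
move=> mf f0 fi; apply/integrableP; split; first exact/measurable_EFinP.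
by under eq_integral do rewrite gee0_abs ?lee_fin//.
Qed.

Lemma EFin_Rintegral f : mu.-integrable setT (fun x => (f x)%:E) ->
  (\int[mu]_x f x)%:E = (\int[mu]_x (f x)%:E)%E.
Proof. by move=> fi; rewrite fineK// integrable_fin_num. Qed.

Lemma Rintegral_sum I (s : seq I) (F : I -> T -> R) :
  (forall i, mu.-integrable setT (fun x => (F i x)%:E)) ->
  \int[mu]_x (\sum_(i <- s) F i x) = \sum_(i <- s) \int[mu]_x F i x.
Proof.
move=> Fi; elim: s => [|i s IH].
  under eq_Rintegral do rewrite big_nil.
  by rewrite big_nil /Rintegral integral0.
under eq_Rintegral do rewrite big_cons.
by rewrite big_cons RintegralD ?IH//; [exact: Fi|exact: rintegrable_sum].
Qed.

End real_integrable.

Section probability_integrable.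
Context {d : measure_display} {T : measurableType d} {R : realType}.
Variable P : probability T R.
Implicit Types f g : T -> R.

Lemma rintegrable_cst (c : R) : P.-integrable setT (fun=> c%:E).
Proof. exact: (finite_measure_integrable_cst P c measurableT). Qed.

Lemma rintegrable_bounded f (M : R) : measurable_fun setT f ->
  (forall x, `|f x| <= M) -> P.-integrable setT (fun x => (f x)%:E).
Proof. by move=> mf fM; apply: (rintegrable_le mf fM); exact: rintegrable_cst. Qed.

Lemma Rintegral_probability_cst (c : R) : \int[P]_x c = c.
Proof. by rewrite (@Rintegral_cst _ _ _ P)// [X in fine X](_ : _ = 1%E) ?mulr1//; exact: probability_setT. Qed.

Lemma integral_addr_cst f (c : R) : P.-integrable setT (fun x => (f x)%:E) ->
  (\int[P]_x (f x + c)%:E)%E = (\int[P]_x f x + c)%:E.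
Proof.
move=> fi; rewrite -EFin_Rintegral; last by apply: rintegrableD => //; exact: rintegrable_cst.
by rewrite RintegralD//; [rewrite Rintegral_probability_cst|exact: rintegrable_cst].
Qed.

Lemma Rintegral_le_cst f (M : R) : P.-integrable setT (fun x => (f x)%:E) ->
  (forall x, `|f x| <= M) -> `|\int[P]_x f x| <= M.
Proof.
move=> fi fM; apply: (le_trans (le_normr_Rintegral measurableT fi)).
rewrite -[leRHS]Rintegral_probability_cst; apply: le_Rintegral => //.
  exact: integrable_norm fi.
exact: rintegrable_cst.
Qed.

Lemma rintegrable_sqr_id f : measurable_fun setT f ->
  P.-integrable setT (fun x => (f x ^+ 2)%:E) -> P.-integrable setT (fun x => (f x)%:E).
Proof.
move=> mf f2; apply: (rintegrable_le (g := fun x => 1 + f x ^+ 2)) => //.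
  by move=> x; rewrite -(@real_normK _ (f x)) ?num_real//; have := normr_ge0 (f x); nra.
by apply: rintegrableD => //; exact: rintegrable_cst.
Qed.

Lemma measurable_tail f (K : R) : measurable_fun setT f ->
  measurable [set x | (K < `|f x|)%R].
Proof.
move=> mf; rewrite [X in measurable X](_ : _ = (fun x => `|f x|) @^-1` `]K, +oo[%classic).
  by rewrite -[X in measurable X]setTI; apply: (measurableT_comp _ mf).
by apply/seteqP; split => x /=; rewrite in_itv/= andbT.
Qed.

(** Markov's inequality for the square. *)
Lemma second_moment_tail f (K c : R) : measurable_fun setT f -> 0 < K ->
  (\int[P]_x (f x ^+ 2)%:E <= c%:E)%E ->
  (P [set x | (K < `|f x|)%R] <= (c / K ^+ 2)%:E)%E.
Proof.
move=> mf K0 fc.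
have m2 : measurable_fun setT (fun x => f x ^+ 2).
  by apply: (measurableT_comp (exprn_measurable _)).
have := @le_integral_abse _ _ _ P setT measurableT (fun x => (f x ^+ 2)%:E) (K ^+ 2).
have e : (\int[P]_x `|(f x ^+ 2)%:E| = \int[P]_x (f x ^+ 2)%:E)%E.
  by apply: eq_integral => x _; rewrite gee0_abs// lee_fin sqr_ge0.
rewrite e setTI => /(_ _ _)/le_trans/(_ fc) h.
have K20 : 0 < K ^+ 2 by rewrite exprn_gt0.
rewrite EFinM lee_pdivlMr// muleC (le_trans _ (h _ _))//; last exact/measurable_EFinP.
rewrite lee_pmul2l// le_measure ?inE//.
- exact: measurable_tail.
- rewrite [X in measurable X](_ : _ = (fun x => f x ^+ 2) @^-1` `[K ^+ 2, +oo[%classic).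
    by rewrite -[X in measurable X]setTI; exact: m2.
  apply/seteqP; split => x /=; rewrite in_itv/= andbT lee_fin ger0_norm ?sqr_ge0//.
- move=> x /= Kf; rewrite lee_fin ger0_norm ?sqr_ge0// -(@real_normK _ (f x)) ?num_real//.
  by rewrite lerXn2r ?nnegrE ?(ltW K0)// ltW.
Qed.

End probability_integrable.

(** Reduces an equality of bounded integrals to one of nonnegative integrals. *)
Lemma Rintegral_eq_shift {d1 d2} {T1 : measurableType d1} {T2 : measurableType d2}
    {R : realType} (P1 : probability T1 R) (P2 : probability T2 R)
    (f1 : T1 -> R) (f2 : T2 -> R) (M : R) :
  measurable_fun setT f1 -> measurable_fun setT f2 ->
  (forall x, `|f1 x| <= M) -> (forall x, `|f2 x| <= M) ->
  (\int[P1]_x (f1 x + M)%:E = \int[P2]_x (f2 x + M)%:E)%E ->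
  \int[P1]_x f1 x = \int[P2]_x f2 x.
Proof.
move=> m1 m2 M1 M2; rewrite !integral_addr_cst; last 2 first.
- exact: rintegrable_bounded M2.
- exact: rintegrable_bounded M1.
by move=> [/addIr].
Qed.

(** * The standard Gaussian density *)

Import HBSimple HBNNSimple.

Section gaussian_density.
Context {R : realType}.
Local Notation mu := (@lebesgue_measure R).

(** The law [normal_prob] is only given by its values on sets; the change of
    density passes through simple functions and monotone limits. *)
Lemma ge0_integral_normal_prob (m s : R) (f : R -> \bar R) :
  measurable_fun [set: R] f -> (forall x, 0 <= f x)%E ->
  (\int[normal_prob m s]_x f x = \int[mu]_x (f x * (normal_pdf m s x)%:E))%E.
Proof.
move=> mf f0.
have mp : measurable_fun setT (normal_pdf m s) by exact: measurable_normal_pdf.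
have p0 := normal_pdf_ge0 m s.
have Ef0 x : [set: R] x -> (0 <= f x)%E by [].
pose f_ := @nnsfun_approx _ (measurableTypeR R) R setT measurableT f mf.
have mf_ n : measurable_fun setT (f_ n) by exact: measurable_funPT.
have f_cvg x : (f_ n x)%:E @[n --> \oo] --> f x.
  exact: (cvg_nnsfun_approx (T := measurableTypeR R) measurableT mf Ef0).
have f_nd x a b : (a <= b)%N -> f_ a x <= f_ b x.
  by move=> ab; have /lefP := nd_nnsfun_approx (T := measurableTypeR R) measurableT mf ab; exact.
have step (h : {nnsfun (measurableTypeR R) >-> R}) :
    (\int[normal_prob m s]_x (h x)%:E = \int[mu]_x (h x * normal_pdf m s x)%:E)%E.
  rewrite (integralT_nnsfun (normal_prob m s) h) sintegralE.
  under [RHS]eq_integral => x _.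
    rewrite {1}(fimfunE h x) EFinM -fsumEFin// ge0_mule_fsuml; last first.
      move=> y; exact: nnfun_muleindic_ge0.
    over.
  rewrite ge0_integral_fsum//; last 2 first.
  - move=> y; apply/emeasurable_funM; last exact/measurable_EFinP.
    by apply/measurable_EFinP; apply: measurable_funM.
  - move=> y x _; apply: mule_ge0; last by rewrite lee_fin.
    exact: nnfun_muleindic_ge0.
  apply: eq_fsbigr => y _.
  have [y0|y0] := ltP y 0.
    rewrite preimage_nnfun0// measure0 mule0.
    by rewrite integral0_eq// => x _; rewrite indic0/= mulr0 mul0e.
  under [RHS]eq_integral do rewrite EFinM -muleA.
  rewrite ge0_integralZl_EFin//; last 2 first.
  - by move=> x _; rewrite mule_ge0// lee_fin.
  - by apply/emeasurable_funM; apply/measurable_EFinP.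
  congr (_ * _)%E; rewrite /normal_prob/= [LHS]integral_mkcond/=.
  apply: eq_integral => x _; rewrite patchE indicE.
  by case: ifPn => _; rewrite ?mul1e ?mul0e.
transitivity (limn (fun n => \int[normal_prob m s]_x (f_ n x)%:E)%E).
  rewrite -monotone_convergence//.
  - by apply: eq_integral => x _; apply/esym/cvg_lim.
  - by move=> n; apply/measurable_EFinP; exact: mf_.
  - by move=> n x _; rewrite lee_fin.
  - by move=> x _ a b ab; rewrite lee_fin f_nd.
rewrite [in LHS](_ : (fun n => _) =
    (fun n => \int[mu]_x (f_ n x * normal_pdf m s x)%:E)%E); last first.
  by apply/funext => n; exact: (step (f_ n)).
rewrite -monotone_convergence//.
- apply: eq_integral => x _; apply/cvg_lim => //.
  under eq_fun do rewrite EFinM.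
  by apply: cvgeZr.
- by move=> n; apply/measurable_EFinP/measurable_funM => //; exact: mf_.
- by move=> n x _; rewrite lee_fin mulr_ge0.
- by move=> x _ a b ab; rewrite lee_fin ler_wpM2r// f_nd.
Qed.

Lemma integral_affine (a b : R) (g : R -> R) : 0 < a -> continuous g ->
  (forall x, 0 <= g x) ->
  (\int[mu]_x (g x)%:E = \int[mu]_x (g (a * x + b) * a)%:E)%E.
Proof.
move=> a0 cg g0; pose F (x : R^o) : R^o := a * x + b.
have dF (x : R^o) : is_derive x 1 F a.
  by rewrite /F; apply: is_derive_eq; rewrite addr0; exact: mulr1.
have F'E : F^`()%classic = cst a.
  by apply/funext => x; rewrite derive1E; exact: (@derive_val _ _ _ _ _ _ _ (dF x)).
rewrite (@increasing_ge0_integration_by_substitutionT _ F g)//.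
- by rewrite F'E.
- by move=> x y xy; rewrite /F ltrD2r ltr_pM2l.
- by rewrite F'E => x; exact: cvg_cst.
- by rewrite F'E; exact: is_cvg_cst.
- by rewrite F'E; exact: is_cvg_cst.
- apply/cvgrNyPle => A; exists ((A - b) / a); split; first exact: num_real.
  by move=> x; rewrite /F ltr_pdivlMr// => /ltW; rewrite mulrC lerBrDr.
- apply/cvgryPge => A; exists ((A - b) / a); split; first exact: num_real.
  by move=> x; rewrite /F ltr_pdivrMr// => /ltW; rewrite mulrC lerBlDr.
Qed.

Lemma normal_pdfNx (x : R) : normal_pdf 0 1 (- x) = normal_pdf 0 1 x.
Proof. by rewrite !normal_pdfE ?oner_neq0//= /normal_fun !subr0 sqrrN. Qed.

(** The rotation with cosine [a / r] and sine [b / r] preserves the planar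
    Gaussian density; it is written here after the change of variable
    [z' = (r * t - a * z) / b]. *)
Lemma normal_pdf_rotation (a b z t : R) : 0 < a -> 0 < b ->
  let r := Num.sqrt (a ^+ 2 + b ^+ 2) in
  normal_pdf 0 1 ((r * t - a * z) / b) * normal_pdf 0 1 z =
  normal_pdf 0 1 t * normal_pdf 0 1 ((r * z - a * t) / b).
Proof.
move=> a0 b0 r; have r2 : r ^+ 2 = a ^+ 2 + b ^+ 2.
  by rewrite sqr_sqrtr// addr_ge0// sqr_ge0.
rewrite !normal_pdfE ?oner_neq0//= /normal_fun !subr0.
rewrite mulrACA [RHS]mulrACA; congr (_ * _); rewrite -!expRD; congr expR.
have b20 : b != 0 by rewrite gt_eqF.
apply/eqP; rewrite -subr_eq0; apply/eqP.
(* the exponents differ by a multiple of [r ^+ 2 - a ^+ 2 - b ^+ 2] *)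
transitivity ((r ^+ 2 - a ^+ 2 - b ^+ 2) * (z ^+ 2 - t ^+ 2) / b ^+ 2 / 2).
  by field.
by rewrite r2; field.
Qed.

(** In the plane, [a * z + b * z'] is [r] times one coordinate of the rotated
    vector, and the other coordinate integrates to one. *)
Lemma gaussian_semigroup (a b y : R) (u : R -> R) : 0 < a -> 0 < b ->
  continuous u -> (forall x, 0 <= u x) ->
  (\int[normal_prob 0 1]_z \int[normal_prob 0 1]_z' (u (y + a * z + b * z'))%:E =
   \int[normal_prob 0 1]_z (u (y + Num.sqrt (a ^+ 2 + b ^+ 2) * z))%:E)%E.
Proof.
move=> a0 b0 cu u0; set r := Num.sqrt _.
have r0 : 0 < r by rewrite sqrtr_gt0 addr_gt0// exprn_gt0.
have mu_ : measurable_fun [set: R] u by exact: continuous_measurable_fun.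
pose phi : R -> R := normal_pdf 0 1.
have mphi : measurable_fun [set: R] phi by exact: measurable_normal_pdf.
have cphi : continuous phi by apply: continuous_normal_pdf; exact: oner_neq0.
have phi0 x : 0 <= phi x by exact: normal_pdf_ge0.
have rb0 : 0 < r / b by rewrite divr_gt0.
have caff c e : continuous (fun x : R => e + c * x).
  move=> x; apply: cvgD; first exact: cvg_cst.
  by apply: cvgM; [exact: cvg_cst|exact: cvg_id].
pose G (z t : R) := u (y + r * t) * phi ((r * t - a * z) / b) * (r / b).
have G0 z t : 0 <= G z t.
  by rewrite /G mulr_ge0 ?(ltW rb0)// mulr_ge0 ?u0 ?phi0.
have m1 : measurable_fun [set: R * R] (fun w : R * R => w.1) by exact: measurable_fst.
have m2 : measurable_fun [set: R * R] (fun w : R * R => w.2) by exact: measurable_snd.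
have mG : measurable_fun [set: R * R] (fun w : R * R => G w.1 w.2).
  apply: measurable_funM => //; apply: measurable_funM.
    apply: (measurableT_comp mu_); apply: measurable_funD => //.
    exact: measurable_funM.
  apply: (measurableT_comp mphi); apply: measurable_funM => //.
  by apply: measurable_funB; exact: measurable_funM.
have inner z : (\int[normal_prob 0 1]_z' (u (y + a * z + b * z'))%:E =
    \int[mu]_t (G z t)%:E)%E.
  rewrite (ge0_integral_normal_prob 0 1 (f := fun z' => (u (y + a * z + b * z'))%:E)).
  - under eq_integral do rewrite -EFinM.
    rewrite (integral_affine (- (a * z / b)) rb0).
    + apply: eq_integral => t _; congr EFin; rewrite /G; congr (u _ * phi _ * _).
        by field; rewrite gt_eqF.
      by field; rewrite gt_eqF.
    + move=> x; apply: cvgM; last exact: cphi.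
      apply: (@continuous_comp _ _ _ (fun x => y + a * z + b * x) u); last exact: cu.
      exact: caff.
    + by move=> x; rewrite mulr_ge0.
  - by apply/measurable_EFinP; apply: (measurableT_comp mu_);
      apply: measurable_funD => //; exact: measurable_funM.
  - by move=> x; rewrite lee_fin.
under eq_integral do rewrite inner.
have mGE : measurable_fun [set: R * R] (fun w : R * R => (G w.1 w.2)%:E).
  exact/measurable_EFinP.
rewrite (ge0_integral_normal_prob 0 1 (f := fun z => (u (y + r * z))%:E)); first last.
- by move=> x; rewrite lee_fin.
- by apply/measurable_EFinP; apply: (measurableT_comp mu_);
    apply: measurable_funD => //; exact: measurable_funM.
rewrite (ge0_integral_normal_prob 0 1 (f := fun z => \int[mu]_t (G z t)%:E)%E); first last.
- by move=> z; apply: integral_ge0 => t _; rewrite lee_fin.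
- by apply: (@measurable_fun_fubini_tonelli_F _ _ _ _ R mu
    (fun w : R * R => (G w.1 w.2)%:E)) => // w; rewrite lee_fin.
transitivity (\int[mu]_z \int[mu]_t (G z t * phi z)%:E)%E.
  apply: eq_integral => z _; under [RHS]eq_integral do rewrite EFinM.
  rewrite ge0_integralZr ?lee_fin//.
    by apply/measurable_EFinP; exact: (measurableT_comp mG (pair1_measurable z)).
  by move=> t _; rewrite lee_fin.
rewrite (@fubini_tonelli _ _ _ _ R mu mu (fun w => (G w.1 w.2 * phi w.1)%:E))/=;
  first last.
- by move=> w; rewrite lee_fin mulr_ge0.
- apply/measurable_EFinP; apply: measurable_funM => //.
  exact: (measurableT_comp mphi).
apply: eq_integral => t _.
transitivity (\int[mu]_z ((u (y + r * t) * phi t)%:E *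
    (phi (r / b * z + (- (a * t / b))) * (r / b))%:E))%E.
  apply: eq_integral => z _; rewrite -EFinM; congr EFin; rewrite /G.
  have /= := normal_pdf_rotation z t a0 b0; rewrite -/phi -/r => e.
  have -> : r / b * z - a * t / b = (r * z - a * t) / b.
    by field; rewrite gt_eqF.
  transitivity (u (y + r * t) * (r / b) * (phi ((r * t - a * z) / b) * phi z)).
    by ring.
  by rewrite e; ring.
rewrite ge0_integralZl//.
- rewrite -integral_affine// integral_normal_pdf mule1 EFinM//.
- by apply/measurable_EFinP; apply: measurable_funM => //;
    apply: (measurableT_comp mphi); apply: measurable_funD => //; exact: measurable_funM.
- by move=> x _; rewrite lee_fin mulr_ge0// ltW.
- by rewrite lee_fin mulr_ge0.
Qed.

End gaussian_density.

(** * Moments of the standard Gaussian *)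

Section gaussian_moments.
Context {R : realType}.
Local Notation mu := (@lebesgue_measure R).
Local Notation phi := (@normal_pdf R 0 1).

Let is_derive_phi (x : R^o) : is_derive x 1 (phi : R^o -> R^o) (- (x * phi x)).
Proof.
have -> : phi = (fun x : R^o => normal_peak 1 * expR (- (2^-1) * x ^+ 2) : R^o).
  apply/funext => z; rewrite normal_pdfE ?oner_neq0//= /normal_fun subr0.
  by congr (_ * expR _); field.
apply: is_derive_eq.
by rewrite /GRing.scale/=; field.
Qed.

(** Integration by parts: [x * phi x] has derivative [phi x - x ^+ 2 * phi x],
    so on the segment from [- n] to [n] the second moment is the mass minus a
    boundary term. *)
Lemma gaussian_second_moment : (\int[normal_prob 0 1]_x (x ^+ 2)%:E = 1 :> \bar R)%E.
Proof.
have phi0 x : 0 <= phi x by exact: normal_pdf_ge0.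
have mphi : measurable_fun [set: R] phi by exact: measurable_normal_pdf.
have cphi : continuous phi by apply: continuous_normal_pdf; exact: oner_neq0.
rewrite ge0_integral_normal_prob; first last.
- by move=> x; rewrite lee_fin sqr_ge0.
- by apply/measurable_EFinP; exact: exprn_measurable.
pose F (n : nat) := `[- n.+1%:R, n.+1%:R]%classic : set R.
have nF : {homo F : n m / (n <= m)%N >-> (n <= m)%O}.
  move=> n m nm; apply/subsetPset => x; rewrite /F/= !in_itv/= => /andP[x1 x2].
  have : n.+1%:R <= m.+1%:R :> R by rewrite ler_nat.
  by move=> h; apply/andP; split; lra.
have FT : \bigcup_i F i = setT.
  apply/seteqP; split => // x _; exists (Num.bound `|x|) => //.
  rewrite /F/= in_itv/= -ler_norml ltW//.
  by rewrite (lt_trans (archi_boundP (normr_ge0 x)))// ltr_nat.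
have mF i : measurable (F i) by exact: measurable_itv.
have cvgF (g : R -> R) : measurable_fun [set: R] g -> (forall x, 0 <= g x) ->
    (\int[mu]_(x in F i) (g x)%:E)%E @[i --> \oo] --> (\int[mu]_x (g x)%:E)%E.
  move=> mg g0; rewrite -FT; apply: ge0_nondecreasing_set_cvg_integral => //.
  - by move=> i; apply/measurable_EFinP; exact: measurable_funTS.
  - by move=> i x _; rewrite lee_fin.
have mx2 : measurable_fun [set: R] (fun x : R => x ^+ 2 * phi x).
  by apply: measurable_funM => //; exact: exprn_measurable.
have x20 (x : R) : 0 <= x ^+ 2 * phi x by rewrite mulr_ge0// sqr_ge0.
have c1 := cvgF _ mx2 x20.
have c2 := cvgF _ mphi phi0.
rewrite integral_normal_pdf in c2.
under eq_integral do rewrite -EFinM.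
have cx2 : continuous (fun x : R => x ^+ 2 * phi x).
  by move=> x; apply: cvgM; [exact: exprn_continuous|exact: cphi].
have step n : (\int[mu]_(x in F n) (x ^+ 2 * phi x)%:E =
    \int[mu]_(x in F n) (phi x)%:E - (2 * (n.+1%:R * phi n.+1%:R))%:E)%E.
  have nn : - n.+1%:R < n.+1%:R :> R by have := ltr0Sn R n; lra.
  have dG (x : R^o) : is_derive x 1 (fun x : R^o => x * phi x : R^o) (phi x - x ^+ 2 * phi x).
    have := is_derive_phi x => dphi.
    apply: is_derive_eq.
    by rewrite /GRing.scale/= mulr1 mulrN mulrA -expr2 addrC.
  have dG1 (x : R^o) : derivable (fun x : R^o => x * phi x : R^o) x 1.
    exact: (@ex_derive _ _ _ _ _ _ _ (dG x)).
  have ftc := @continuous_FTC2 R (fun x => phi x - x ^+ 2 * phi x)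
    (fun x => x * phi x) _ _ nn.
  have e : (\int[mu]_(x in F n) (phi x - x ^+ 2 * phi x)%:E =
      (2 * (n.+1%:R * phi n.+1%:R))%:E)%E.
    rewrite /F ftc.
    - rewrite normal_pdfNx -EFinB; congr EFin; ring.
    - by apply: continuous_subspaceT => x; apply: cvgB; [exact: cphi|exact: cx2].
    - split.
      + by move=> x _; exact: dG1.
      + by apply: cvg_at_right_filter; apply: cvgM; [exact: cvg_id|exact: cphi].
      + by apply: cvg_at_left_filter; apply: cvgM; [exact: cvg_id|exact: cphi].
    - by move=> x _; rewrite derive1E; exact: (@derive_val _ _ _ _ _ _ _ (dG x)).
  have ig (g : R -> R) : continuous g -> mu.-integrable (F n) (EFin \o g).
    move=> cg; apply: continuous_compact_integrable; first exact: segment_compact.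
    exact: continuous_subspaceT.
  rewrite -e; under [X in (_ - X)%E]eq_integral do rewrite EFinB.
  rewrite (@integralB_EFin _ _ _ mu (F n) phi (fun x => x ^+ 2 * phi x)); [|exact: mF|exact: ig..].
  have fi (g : R -> R) : continuous g -> (\int[mu]_(x in F n) (g x)%:E)%E \is a fin_num.
    by move=> cg; apply: integrable_fin_num; [exact: mF|exact: ig].
  have := fi _ cx2; have := fi _ cphi; move: (integral _ _ _) (integral _ _ _).
  by move=> [x| |] [y| |]//= _ _; rewrite -!EFinB; congr EFin; ring.
(* the boundary term is [O(1 / n)] because [expR (- y) <= (1 + y)^-1] *)
have tail : (2 * (n.+1%:R * phi n.+1%:R)) @[n --> \oo] --> (0 : R).
  pose c : R := 4 * normal_peak 1.
  have c0 : c * n.+1%:R^-1 @[n --> \oo] --> (0 : R).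
    by rewrite -(mulr0 c); apply: cvgM; [exact: cvg_cst|exact: cvg_harmonic].
  apply: (@squeeze_cvgr _ _ _ _ (cst 0) (fun n => c * n.+1%:R^-1)) => //; last exact: cvg_cst.
  near=> n; rewrite mulr_ge0 ?mulr_ge0//=.
  rewrite normal_pdfE ?oner_neq0//= /normal_fun subr0 /c.
  have N0 : 0 < n.+1%:R :> R by rewrite ltr0Sn.
  set N := n.+1%:R in N0 *.
  have h : expR (- N ^+ 2 / (1 ^+ 2 *+ 2)) <= 2 / N ^+ 2.
    rewrite expr1n mulNr expRN -[leRHS]invrK lef_pV2 ?posrE ?expR_gt0 ?invr_gt0//; last first.
      by rewrite divr_gt0// exprn_gt0.
    rewrite invf_div; apply: le_trans (expR_ge1Dx _); lra.
  rewrite [leLHS](_ : _ = 2 * N * normal_peak 1 * expR (- N ^+ 2 / (1 ^+ 2 *+ 2))); last by ring.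
  apply: (le_trans (ler_wpM2l _ h)); first by rewrite !mulr_ge0// ?normal_peak_ge0// ltW.
  rewrite le_eqVlt; apply/orP; left; apply/eqP; field; by rewrite gt_eqF.
have c3 : (\int[mu]_(x in F i) (x ^+ 2 * phi x)%:E)%E @[i --> \oo] --> (1 - 0%:E)%E.
  under eq_fun do rewrite step.
  apply: cvgeB => //; by apply: cvg_EFin; [exact: nearW|exact: tail].
by rewrite sube0 in c3; exact: (cvg_unique _ c1 c3).
Unshelve. all: by end_near. Qed.

Lemma integrable_gaussian_sqr :
  (normal_prob 0 1).-integrable setT (fun x : R => (x ^+ 2)%:E).
Proof.
apply/integrableP; split; first by apply/measurable_EFinP; exact: exprn_measurable.
under eq_integral do rewrite /= ger0_norm ?sqr_ge0//.
by rewrite gaussian_second_moment ltry.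
Qed.

Lemma integrable_gaussian_id : (normal_prob 0 1).-integrable setT (@EFin R).
Proof.
have h : (normal_prob 0 1).-integrable setT (EFin \o (fun x : R => 1 + x ^+ 2)).
  exact: (rintegrableD (rintegrable_cst _ 1) integrable_gaussian_sqr).
apply: le_integrable h => //.
move=> x _; rewrite /= lee_fin [leRHS]ger0_norm ?addr_ge0 ?sqr_ge0//.
rewrite -(@real_normK _ x) ?num_real//; have := normr_ge0 x; nra.
Qed.

(** The positive and negative parts have the same integral, by reflection. *)
Lemma gaussian_first_moment : \int[normal_prob 0 1]_x x = 0 :> R.
Proof.
have refl (f : R -> \bar R) : measurable_fun [set: R] f -> (forall x, 0 <= f x)%E ->
    (\int[mu]_x f x = \int[mu]_x f (- (x : R))%R)%E.
  move=> mf f0; transitivity (\int[pushforward mu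
      (-%R : measurableTypeR R -> measurableTypeR R)]_x f x)%E.
    by apply: eq_measure_integral => A mA _; exact/esym/lebesgue_measureN.
  by rewrite ge0_integral_pushforward.
have mphi : measurable_fun [set: R] (EFin \o phi).
  by apply/measurable_EFinP; exact: measurable_normal_pdf.
have phi0 x : (0 <= (phi x)%:E)%E by rewrite lee_fin normal_pdf_ge0.
rewrite /Rintegral integralE.
have mp : measurable_fun [set: R] ((@EFin R)^\+)%E by exact: measurable_funepos.
have mn : measurable_fun [set: R] ((@EFin R)^\-)%E by exact: measurable_funeneg.
have -> : (\int[normal_prob 0 1]_x (@EFin R)^\+ x = \int[normal_prob 0 1]_x (@EFin R)^\- x)%E.
  have fp0 x : (0 <= ((@EFin R)^\+)%E x)%E by exact: funepos_ge0.
  have fn0 x : (0 <= ((@EFin R)^\-)%E x)%E by exact: funeneg_ge0.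
  rewrite (ge0_integral_normal_prob 0 1 mp fp0) (ge0_integral_normal_prob 0 1 mn fn0).
  rewrite refl.
  - by apply: eq_integral => x _; rewrite normal_pdfNx funeposE funenegE EFinN.
  - exact: emeasurable_funM.
  - by move=> x; rewrite mule_ge0.
rewrite subee// integrable_neg_fin_num//; exact: integrable_gaussian_id.
Qed.

End gaussian_moments.

(** * Test functions with a uniform second order expansion *)

Section smoothing.
Context {R : realType}.
Local Notation mu := (@lebesgue_measure R).

Lemma antiderivative (g : R -> R) (a : R) : continuous g ->
  (forall x, x <= a -> g x = 0) ->
  exists2 G : R -> R, forall x : R^o, is_derive x 1 (G : R^o -> R^o) (g x) &
    forall x, x <= a -> G x = 0.
Proof.
move=> cg g0; pose G x := \int[mu]_(t in `[a - 1, x]) g t.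
have G0 x : x <= a -> G x = 0.
  move=> xa; rewrite /G (@eq_Rintegral _ _ _ _ _ (cst 0)); last first.
    by move=> t; rewrite inE/= in_itv/= => /andP[_ tx]; rewrite g0// (le_trans tx).
  by rewrite /Rintegral integral0.
exists G => // x; have [xa|ax] := ltP x a.
  rewrite g0 ?(ltW xa)//.
  apply: (@near_eq_is_derive _ _ _ (cst 0)).
  near=> y; rewrite G0//; near: y.
  by apply: filterS (lt_nbhsl xa) => y /ltW.
have ig : mu.-integrable `[a - 1, x + 1] (EFin \o g).
  apply: continuous_compact_integrable; first exact: segment_compact.
  exact: continuous_subspaceT.
have [] := @continuous_FTC1_closed R g (a - 1) x (x + 1) _ ig _ (cg x).
- by rewrite ltrDl.
- by rewrite ltrBlDr ltr_pwDr.
move=> dG G'; rewrite -G' derive1E; exact: derivableP.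
Unshelve. all: by end_near. Qed.

Lemma mean_value_bound (f df : R -> R) (y x c : R) :
  (forall t : R^o, is_derive t 1 (f : R^o -> R^o) (df t)) ->
  (forall t, `|t| <= `|x| -> `|df (y + t)| <= c) ->
  `|f (y + x) - f y| <= c * `|x|.
Proof.
move=> dff dfc.
have cf (s t : R) : {within `[s, t], continuous f}.
  apply: continuous_subspaceT => z.
  apply: differentiable_continuous; apply/derivable1_diffP.
  exact: (@ex_derive _ _ _ _ _ _ _ (dff z)).
have [x0|x0] := leP 0 x.
  have yx : y <= y + x by rewrite lerDl.
  have [z + ->] := MVT_segment yx (fun t _ => dff t) (cf _ _).
  rewrite in_itv/= => /andP[z1 z2]; rewrite addrAC subrr add0r normrM ler_wpM2r//.
  rewrite (_ : z = y + (z - y)) ?dfc//; last by rewrite addrC subrK.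
  rewrite (ger0_norm x0) ger0_norm; lra.
have yx : y + x <= y by rewrite gerDl ltW.
have [z + e] := MVT_segment yx (fun t _ => dff t) (cf _ _).
rewrite distrC e in_itv/= => /andP[z1 z2].
rewrite (_ : y - (y + x) = - x); last by ring.
rewrite normrM normrN ler_wpM2r//.
rewrite (_ : z = y + (z - y)) ?dfc//; last by rewrite addrC subrK.
rewrite (ltr0_norm x0) ler0_norm; lra.
Qed.

(** Only the oscillation of [g] near [y] enters, so uniform continuity of the
    second derivative gives a uniform remainder. *)
Lemma taylor2_bound (F G g : R -> R) (y x e : R) :
  (forall t : R^o, is_derive t 1 (F : R^o -> R^o) (G t)) ->
  (forall t : R^o, is_derive t 1 (G : R^o -> R^o) (g t)) ->
  (forall t, `|t| <= `|x| -> `|g (y + t) - g y| <= e) ->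
  `|F (y + x) - F y - x * G y - x ^+ 2 / 2 * g y| <= e * x ^+ 2.
Proof.
move=> dF dG ge.
have first t : `|t| <= `|x| -> `|G (y + t) - G y - t * g y| <= e * `|t|.
  move=> tx; pose f z := G z - z * g y.
  have df (z : R^o) : is_derive z 1 (f : R^o -> R^o) (g z - g y).
    have := dG z => dGz; rewrite /f; apply: is_derive_eq.
    by rewrite /GRing.scale/= mulr1 mulr0 add0r.
  rewrite (_ : G (y + t) - _ - _ = f (y + t) - f y); last by rewrite /f; ring.
  by apply: mean_value_bound df _ => s st; rewrite ge// (le_trans st).
pose f z := F z - z * G y - (z - y) ^+ 2 / 2 * g y.
have df (z : R^o) : is_derive z 1 (f : R^o -> R^o) (G z - G y - (z - y) * g y).
  have := dF z => dFz; rewrite /f; apply: is_derive_eq.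
  by rewrite /GRing.scale/=; field.
rewrite (_ : F (y + x) - _ - _ - _ = f (y + x) - f y); last by rewrite /f; field.
have h : forall t, `|t| <= `|x| -> `|G (y + t) - G y - (y + t - y) * g y| <= e * `|x|.
  move=> t tx; rewrite (addrAC y) subrr add0r (le_trans (first t tx))//.
  rewrite ler_wpM2l//; apply: le_trans (ge 0 _) => //.
  by rewrite normr0.
by rewrite -[x ^+ 2]real_normK ?num_real// expr2 mulrA; apply: mean_value_bound df h.
Qed.

(** A second order Taylor expansion with a remainder that is [o(x ^+ 2)]
    uniformly in the base point. *)
Definition taylor2 (u u1 u2 : R -> R) :=
  (exists2 C : R, 0 <= C & forall y x : R,
     `|u (y + x) - u y - x * u1 y - x ^+ 2 / 2 * u2 y| <= C * x ^+ 2) /\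
  forall e : R, 0 < e -> exists2 del : R, 0 < del & forall y x : R, `|x| <= del ->
     `|u (y + x) - u y - x * u1 y - x ^+ 2 / 2 * u2 y| <= e * x ^+ 2.

(** The approximation is the second difference quotient of the second
    antiderivative of [g], at a step [h] within the modulus of continuity. Its
    first two derivatives are the second differences of the antiderivative of
    [g] and of [g] itself, which is where the assumption that [g] vanishes to
    the left is used: it provides global antiderivatives. *)
Lemma smoothing (g : R -> R) (a M : R) : (forall x, `|g x| <= M) ->
  (forall e : R, 0 < e -> exists2 del : R, 0 < del & forall x t : R, `|t| <= del ->
     `|g (x + t) - g x| <= e) ->
  (forall x, x <= a -> g x = 0) ->
  forall e : R, 0 < e -> exists2 u : R -> R,
    continuous u /\ (forall x, `|u x - g x| <= e) &
    exists u1 u2, taylor2 u u1 u2.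
Proof.
move=> gM ug g0 e e0.
have cg : continuous g.
  move=> x; apply/cvgrPdist_le => /= eps eps0; have [del del0 gd] := ug _ eps0.
  near=> t; rewrite distrC (_ : t = x + (t - x)); last by rewrite addrC subrK.
  by apply: gd; rewrite distrC; near: t; exact: (@cvgr_dist_le _ _ _ _ _ id x).
have [G dG G0] := antiderivative cg g0.
have cG : continuous G.
  move=> z; apply: differentiable_continuous; apply/derivable1_diffP.
  exact: (@ex_derive _ _ _ _ _ _ _ (dG z)).
have [F dF _] := antiderivative cG G0.
have cF : continuous F.
  move=> z; apply: differentiable_continuous; apply/derivable1_diffP.
  exact: (@ex_derive _ _ _ _ _ _ _ (dF z)).
have [del del0 gd] := ug (e / 6) (divr_gt0 e0 (ltr0Sn _ _)).
have [h h0 hE] : exists2 h : R, 0 < h & 2 * h = del.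
  by exists (del / 2); [rewrite divr_gt0|field].
pose D2 (f : R -> R) y := (f (y + 2 * h) - 2 * f (y + h) + f y) / h ^+ 2.
pose r y x := F (y + x) - F y - x * G y - x ^+ 2 / 2 * g y.
have rb (y x w : R) : (forall t, `|t| <= `|x| -> `|g (y + t) - g y| <= w) ->
    `|r y x| <= w * x ^+ 2 by exact: taylor2_bound.
have h20 : h ^+ 2 != 0 by rewrite gt_eqF// exprn_gt0.
have h2p : 0 < h ^+ 2 by rewrite exprn_gt0.
exists (D2 F).
  split.
    move=> y; apply: cvgM; last exact: cvg_cst.
    apply: cvgD; last exact: cF.
    apply: cvgB.
      apply: (@continuous_comp _ _ _ (fun y => y + 2 * h) F); last exact: cF.
      by apply: cvgD; [exact: cvg_id|exact: cvg_cst].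
    apply: cvgM; first exact: cvg_cst.
    apply: (@continuous_comp _ _ _ (fun y => y + h) F); last exact: cF.
    by apply: cvgD; [exact: cvg_id|exact: cvg_cst].
  move=> y; have -> : D2 F y - g y = (r y (2 * h) - 2 * r y h) / h ^+ 2.
    by rewrite /D2 /r; field; rewrite gt_eqF.
  rewrite normrM (ger0_norm (x := (h ^+ 2)^-1)) ?invr_ge0 ?(ltW h2p)//.
  rewrite ler_pdivrMr//.
  have r1 : `|r y (2 * h)| <= e / 6 * (2 * h) ^+ 2.
    apply: rb => t th; apply: gd; apply: (le_trans th); rewrite ger0_norm ?mulr_ge0 ?(ltW h0)//.
    by rewrite hE.
  have r2 : `|r y h| <= e / 6 * h ^+ 2.
    apply: rb => t th; apply: gd; apply: (le_trans th); rewrite ger0_norm ?(ltW h0)//.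
    by rewrite -hE; have := h0; lra.
  apply: (le_trans (ler_normB _ _)); rewrite normrM (ger0_norm (x := 2))//.
  rewrite exprMn in r1; lra.
exists (D2 G), (D2 g).
have rE y x : D2 F (y + x) - D2 F y - x * D2 G y - x ^+ 2 / 2 * D2 g y =
    (r (y + 2 * h) x - 2 * r (y + h) x + r y x) / h ^+ 2.
  by rewrite /D2 /r !(addrAC y x); field; rewrite gt_eqF.
have key (w y x : R) : (forall z t, `|t| <= `|x| -> `|g (z + t) - g z| <= w) ->
    `|D2 F (y + x) - D2 F y - x * D2 G y - x ^+ 2 / 2 * D2 g y| <=
    4 * w / h ^+ 2 * x ^+ 2.
  move=> gw; rewrite rE normrM (ger0_norm (x := (h ^+ 2)^-1)) ?invr_ge0 ?(ltW h2p)//.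
  rewrite (mulrAC _ _ (x ^+ 2)) ler_wpM2r// ?invr_ge0 ?(ltW h2p)//.
  have := rb _ x _ (gw (y + 2 * h)); have := rb _ x _ (gw (y + h)).
  have := rb _ x _ (gw y) => b1 b2 b3.
  apply: (le_trans (ler_normD _ _)); apply: (le_trans (lerD (ler_normB _ _) (lexx _))).
  rewrite normrM (ger0_norm (x := 2))//; lra.
have M0 : 0 <= M by exact: le_trans (gM 0).
split.
  exists (4 * (M + M) / h ^+ 2).
    by rewrite divr_ge0 ?(ltW h2p)// mulr_ge0 ?addr_ge0.
  move=> y x; apply: key => z t _; apply: (le_trans (ler_normB _ _)).
  exact: lerD.
move=> eps eps0; have ep : 0 < eps * h ^+ 2 / 4 by rewrite divr_gt0// mulr_gt0.
have [del' del'0 gd'] := ug _ ep; exists del' => // y x xd.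
rewrite (_ : eps = 4 * (eps * h ^+ 2 / 4) / h ^+ 2); last by field; rewrite gt_eqF.
by apply: key => z t tx; apply: gd'; exact: le_trans xd.
Unshelve. all: by end_near. Qed.

End smoothing.

(** * Averaging operators *)

Section shift_mean.
Context {R : realType}.

Definition bounded_meas (u : R -> R) :=
  measurable_fun [set: R] u /\ exists M : R, forall x, `|u x| <= M.

(** The averaging operator [u |-> E u(. + X)] of Trotter's proof of the central
    limit theorem: adding an independent variable composes the operators. *)
Definition shift_mean {d} {T : measurableType d} (P : probability T R)
  (X : T -> R) (u : R -> R) (y : R) : R := \int[P]_w u (y + X w).

Lemma bounded_Fubini {d1 d2} {T1 : measurableType d1} {T2 : measurableType d2}
    (P1 : probability T1 R) (P2 : probability T2 R) (F : T1 * T2 -> R) (M : R) :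
  measurable_fun setT F -> (forall w, `|F w| <= M) ->
  \int[P1]_x \int[P2]_y F (x, y) = \int[P2]_y \int[P1]_x F (x, y).
Proof.
move=> mF FM.
have iF : (P1 \x P2)%E.-integrable setT (EFin \o F).
  exact: (rintegrable_bounded (P1 \x P2)%E mF FM).
have i2 x : P2.-integrable setT (fun y => (F (x, y))%:E).
  by apply: (rintegrable_bounded _ (M := M)) => //; exact: measurable_fun_pair2.
have i1 y : P1.-integrable setT (fun x => (F (x, y))%:E).
  by apply: (rintegrable_bounded _ (M := M)) => //; exact: measurable_fun_pair1.
rewrite /Rintegral; congr fine.
under eq_integral do rewrite EFin_Rintegral//.
under [RHS]eq_integral do rewrite EFin_Rintegral//.
exact: (Fubini iF).
Qed.

Section one_variable.
Context {d : measure_display} {T : measurableType d} (P : probability T R) (X : T -> R).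
Hypothesis mX : measurable_fun setT X.

Lemma bounded_meas_shift u y : bounded_meas u ->
  bounded_meas (fun x => u (y + x)).
Proof.
move=> [mu [M uM]]; split; last by exists M.
by apply: (measurableT_comp mu); apply: measurable_funD.
Qed.

Lemma rintegrable_shift u y : bounded_meas u ->
  P.-integrable setT (fun w => (u (y + X w))%:E).
Proof.
move=> [mu [M uM]]; apply: (rintegrable_bounded _ (M := M)) => //.
by apply: (measurableT_comp mu); apply: measurable_funD.
Qed.

Lemma bounded_meas_shift_mean u : bounded_meas u -> bounded_meas (shift_mean P X u).
Proof.
move=> bu; have [mu [M uM]] := bu; split; last first.
  by exists M => y; apply: Rintegral_le_cst => //; exact: rintegrable_shift.
pose F (w : measurableTypeR R * T) := (u (w.1 + X w.2) + M)%:E.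
have mF : measurable_fun setT F.
  apply/measurable_EFinP; apply: measurable_funD => //.
  apply: (measurableT_comp mu); apply: measurable_funD => //.
  exact: (measurableT_comp mX).
have F0 w : (0 <= F w)%E.
  by rewrite lee_fin -lerBlDr sub0r; have := uM (w.1 + X w.2); rewrite ler_norml => /andP[].
have mFF := @measurable_fun_fubini_tonelli_F _ _ _ _ R P _ mF F0.
have -> : shift_mean P X u = (fun y => fine (fubini_F P F y) - M).
  apply/funext => y; rewrite /fubini_F /F/= integral_addr_cst/= ?addrK//.
  exact: rintegrable_shift.
apply: measurable_funB => //; exact: (measurableT_comp (fine_measurable _) mFF).
Qed.

Lemma shift_mean_near u1 u2 (e y : R) : bounded_meas u1 -> bounded_meas u2 ->
  (forall x, `|u1 x - u2 x| <= e) ->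
  `|shift_mean P X u1 y - shift_mean P X u2 y| <= e.
Proof.
move=> b1 b2 ue; rewrite /shift_mean -RintegralB//; try exact: rintegrable_shift.
apply: Rintegral_le_cst => //.
by apply: rintegrableB; exact: rintegrable_shift.
Qed.

End one_variable.

Lemma shift_meanC {d1 d2} {T1 : measurableType d1} {T2 : measurableType d2}
    (P1 : probability T1 R) (P2 : probability T2 R) X1 X2 u :
  measurable_fun setT X1 -> measurable_fun setT X2 -> bounded_meas u ->
  shift_mean P1 X1 (shift_mean P2 X2 u) = shift_mean P2 X2 (shift_mean P1 X1 u).
Proof.
move=> m1 m2 [mu [M uM]]; apply/funext => y; rewrite /shift_mean.
pose F (w : T1 * T2) := u (y + X1 w.1 + X2 w.2).
suff mF : measurable_fun setT F.
  apply: etrans (bounded_Fubini P1 P2 mF (fun w => uM _)) _.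
  by apply: eq_Rintegral => w _; apply: eq_Rintegral => w' _; rewrite /F addrAC.
apply: (measurableT_comp mu); apply: measurable_funD.
  by apply: measurable_funD => //; exact: (measurableT_comp m1).
exact: (measurableT_comp m2).
Qed.

(** Since the operators commute and contract the supremum norm, replacing one
    by the other [n] times costs at most [n] times the one-step error. *)
Lemma iter_shift_mean_near {d1 d2} {T1 : measurableType d1} {T2 : measurableType d2}
    (P1 : probability T1 R) (P2 : probability T2 R) X1 X2 u (e : R) n :
  measurable_fun setT X1 -> measurable_fun setT X2 -> bounded_meas u ->
  (forall y, `|shift_mean P1 X1 u y - shift_mean P2 X2 u y| <= e) ->
  forall y, `|iter n (shift_mean P1 X1) u y - iter n (shift_mean P2 X2) u y| <= n%:R * e.
Proof.
move=> m1 m2.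
have b1 := bounded_meas_shift_mean P1 m1; have b2 := bounded_meas_shift_mean P2 m2.
have near_iter k u1 u2 : bounded_meas u1 -> bounded_meas u2 ->
    (forall y, `|u1 y - u2 y| <= e) ->
    forall y, `|iter k (shift_mean P2 X2) u1 y - iter k (shift_mean P2 X2) u2 y| <= e.
  elim: k u1 u2 => [//|k IH] u1 u2 bu1 bu2 h y; rewrite !iterSr.
  by apply: IH => //; [exact: b2|exact: b2|move=> z; exact: shift_mean_near].
elim: n u => [u _ _ y|n IH u bu h y]; first by rewrite subrr normr0 mul0r.
rewrite !iterSr.
rewrite -(subrKA (iter n (shift_mean P2 X2) (shift_mean P1 X1 u) y)).
apply: (le_trans (ler_normD _ _)); rewrite -natr1 mulrDl mul1r; apply: lerD.
  apply: IH; first exact: b1.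
  move=> z; rewrite -(@shift_meanC _ _ _ _ P1 P2)//.
  by apply: shift_mean_near => //; [exact: b1|exact: b2].
by apply: near_iter => //; [exact: b1|exact: b2].
Qed.

End shift_mean.

Section gaussian_shift_mean.
Context {R : realType}.

(** Independent Gaussians add up to a Gaussian, in operator form. *)
Lemma gaussian_shift_mean_iter (c : R) (u : R -> R) n y : 0 <= c -> continuous u ->
  bounded_meas u ->
  iter n.+1 (shift_mean (normal_prob 0 1) (fun z => c * z)) u y =
  \int[normal_prob 0 1]_z u (y + Num.sqrt n.+1%:R * c * z).
Proof.
rewrite le_eqVlt => /predU1P[<- _ _|c0 cu bu].
  elim: n y => [|n IH] y.
    by rewrite /= /shift_mean; apply: eq_Rintegral => z _; rewrite mul0r mulr0 mul0r.
  rewrite iterS /shift_mean.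
  under eq_Rintegral do rewrite mul0r addr0.
  rewrite Rintegral_probability_cst -[LHS]/(iter n.+1 _ u y) IH.
  by apply: eq_Rintegral => z _; rewrite !mulr0.
have [mu [M uM]] := bu.
have mlin (b : R) : measurable_fun [set: R] (fun z : R => b * z).
  exact: mulrl_measurable.
have semi a b x : 0 < a -> 0 < b ->
    \int[normal_prob 0 1]_z \int[normal_prob 0 1]_z' u (x + a * z + b * z') =
    \int[normal_prob 0 1]_z u (x + Num.sqrt (a ^+ 2 + b ^+ 2) * z).
  move=> a0 b0.
  have := @gaussian_semigroup R a b x (fun z => u z + M) a0 b0 _ _.
  have cuM : continuous (fun z => u z + M).
    by move=> z; apply: cvgD; [exact: cu|exact: cvg_cst].
  have u0 z : 0 <= u z + M.
    by rewrite -lerBlDr sub0r; have := uM z; rewrite ler_norml => /andP[].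
  move=> /(_ cuM u0) semi.
  have iu b' x' : (normal_prob 0 1).-integrable setT (fun z => (u (x' + b' * z))%:E).
    by apply: rintegrable_shift => //; exact: mlin.
  have bi : bounded_meas (fun z => \int[normal_prob 0 1]_z' u (x + a * z + b * z')).
    have b1 := bounded_meas_shift_mean (normal_prob 0 1) (mlin b) bu.
    have [m1 [M1 h1]] := bounded_meas_shift x b1.
    split; last by exists M1 => z; exact: h1.
    exact: (measurableT_comp m1 (mlin a)).
  apply: (addIr M); apply: EFin_inj.
  rewrite -integral_addr_cst; last first.
    by have [m1 [M1 h1]] := bi; apply: (rintegrable_bounded _ (M := M1)) => //.
  rewrite -integral_addr_cst//= -semi.
  by apply: eq_integral => z _; rewrite integral_addr_cst.
elim: n y => [|n IH] y.
  by rewrite /= /shift_mean; apply: eq_Rintegral => z _; rewrite sqrtr1 mul1r.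
rewrite iterS /shift_mean; under eq_Rintegral do rewrite -/(shift_mean _ _) IH.
rewrite semi//; last by rewrite mulr_gt0// sqrtr_gt0 ltr0Sn.
apply: eq_Rintegral => z _; congr (u (_ + _ * _)).
rewrite exprMn sqr_sqrtr ?ler0n// -{1}[c ^+ 2]mul1r -mulrDl nat1r.
by rewrite sqrtrM ?ler0n// sqrtr_sqr ger0_norm// ltW.
Qed.

End gaussian_shift_mean.

(** * Comparison with the Gaussian *)

Section central_limit.
Context {R : realType}.

Lemma measurable_truncation {d} {T : measurableType d} (X : T -> R) (L : R) :
  measurable_fun setT X ->
  measurable_fun setT (fun w => X w ^+ 2 * (L < `|X w|)%R%:R).
Proof.
move=> mX; apply: measurable_funM; first exact: (measurableT_comp (exprn_measurable _)).
rewrite (_ : (fun w => _) = \1_[set w | L < `|X w|]); last first.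
  by apply/funext => w; rewrite indicE mem_setE.
by apply: measurable_indic; exact: measurable_tail.
Qed.

Lemma truncation_le {T : Type} (X : T -> R) (L : R) w :
  `|X w ^+ 2 * (L < `|X w|)%R%:R| <= X w ^+ 2.
Proof.
rewrite normrM ger0_norm ?sqr_ge0// -[leRHS]mulr1 ler_wpM2l ?sqr_ge0//.
by case: (L < _)%R; rewrite ?normr1 ?normr0.
Qed.

Lemma second_moment_truncation {d} {T : measurableType d} (P : probability T R)
    (X : T -> R) (e : R) : measurable_fun setT X ->
  P.-integrable setT (fun w => (X w ^+ 2)%:E) -> 0 < e ->
  exists2 K : R, 0 < K & forall L, K <= L ->
    \int[P]_w (X w ^+ 2 * (L < `|X w|)%R%:R) <= e.
Proof.
move=> mX iX e0; pose g (L : R) w := X w ^+ 2 * (L < `|X w|)%R%:R.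
have mg L : measurable_fun setT (g L) by exact: measurable_truncation.
have gb L w : `|g L w| <= X w ^+ 2 by exact: truncation_le.
have ig L : P.-integrable setT (fun w => (g L w)%:E) by exact: rintegrable_le (gb L) iX.
have g0 : {ae P, forall w, setT w -> (g n%:R w)%:E @[n --> \oo] --> cst 0%E w}.
  apply: aeW => w _; apply: cvg_near_cst.
  exists (Num.bound `|X w|) => // n /= Xn.
  rewrite /g (_ : _ < _ = false) ?mulr0//; apply/negbTE; rewrite -leNgt.
  by rewrite (le_trans (ltW (archi_boundP (normr_ge0 _))))// ler_nat.
have gX : {ae P, forall w n, setT w -> (`|(g n%:R w)%:E| <= (X w ^+ 2)%:E)%E}.
  by apply: aeW => w n _; rewrite lee_fin gb.
have [_ _] := @dominated_convergence _ _ _ P setT measurableT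
  (fun n w => (g n%:R w)%:E) (cst 0%E) (fun w => (X w ^+ 2)%:E)
  (fun n => (measurable_EFinP _ _).2 (mg n%:R)) (measurable_cst _) g0 iX gX.
rewrite integral_cst// mul0e => h.
have {}h : (\int[P]_w g n%:R w) @[n --> \oo] --> (0 : R) by exact: (fine_cvg h).
have [N _ Ne] := (cvgrPdist_le _ _).1 h _ e0.
exists N.+1%:R; first by rewrite ltr0Sn.
move=> L NL; apply: (@le_trans _ _ (\int[P]_w g N%:R w)).
  apply: le_Rintegral => //; [exact: ig|exact: ig|move=> w _].
  rewrite ler_wpM2l ?sqr_ge0//; have [LX|//] := ltP L `|X w|.
  by rewrite (_ : _ < _ = true)//; apply: le_lt_trans LX; rewrite (le_trans _ NL)// ler_nat.
have := Ne N (leqnn N); rewrite sub0r normrN; apply: le_trans; exact: ler_norm.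
Qed.

Section one_step.
Context {d : measure_display} {T : measurableType d} (P : probability T R) (X : T -> R).
Hypothesis mX : measurable_fun setT X.
Hypothesis iX : P.-integrable setT (fun w => (X w ^+ 2)%:E).
Hypothesis X0 : \int[P]_w X w = 0.

(** Where [|X| <= del * sqrt n] the Taylor remainder is [o(X ^+ 2 / n)]; elsewhere
    it is [O(X ^+ 2 / n)], and the truncated second moment is small. *)
Lemma shift_mean_taylor (u u1 u2 : R -> R) (e : R) : bounded_meas u ->
  taylor2 u u1 u2 -> 0 < e ->
  exists N : nat, forall n, (N <= n)%N -> forall y,
    `|shift_mean P (fun w => (Num.sqrt n.+1%:R)^-1 * X w) u y -
      (u y + (\int[P]_w (X w ^+ 2)) / 2 * u2 y / n.+1%:R)| <= e / n.+1%:R.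
Proof.
move=> bu [[C C0 uC] ue] e0; set v := \int[P]_w (X w ^+ 2).
have v0 : 0 <= v by apply: Rintegral_ge0 => w _; exact: sqr_ge0.
have e1 : 0 < e / 2 / (v + 1) by rewrite !divr_gt0// ltr_wpDl.
have [del del0 udel] := ue _ e1.
have e2 : 0 < e / 2 / (C + 1) by rewrite !divr_gt0// ltr_wpDl.
have [K K0 XK] := second_moment_truncation mX iX e2.
exists (Num.bound ((K / del) ^+ 2)) => n Nn y.
set s := Num.sqrt _; have s0 : 0 < s by rewrite sqrtr_gt0 ltr0Sn.
have s2 : s ^+ 2 = n.+1%:R by rewrite sqr_sqrtr// ler0n.
have Ks : K <= del * s.
  rewrite -ler_pdivrMl// mulrC -(@ler_pXn2r _ 2)// ?nnegrE ?divr_ge0 ?ltW// s2.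
  apply: (lt_le_trans (archi_boundP _)); first by rewrite sqr_ge0.
  by rewrite ler_nat (leq_trans Nn).
have mXs : measurable_fun setT (fun w => s^-1 * X w) by exact: measurable_funM.
have iX1 : P.-integrable setT (fun w => (X w)%:E) by exact: rintegrable_sqr_id.
pose r w := u (y + s^-1 * X w) - u y - (s^-1 * X w) * u1 y - (s^-1 * X w) ^+ 2 / 2 * u2 y.
have iu : P.-integrable setT (fun w => (u (y + s^-1 * X w))%:E).
  exact: (rintegrable_shift P mXs).
have q_int : P.-integrable setT
    (fun w => (u y + (s^-1 * u1 y * X w + s^-1 ^+ 2 / 2 * u2 y * X w ^+ 2))%:E).
  apply: rintegrableD; first exact: rintegrable_cst.
  by apply: rintegrableD; exact: rintegrableZ.
have rE : shift_mean P (fun w => s^-1 * X w) u y -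
    (u y + v / 2 * u2 y / n.+1%:R) = \int[P]_w r w.
  have -> : u y + v / 2 * u2 y / n.+1%:R =
      \int[P]_w (u y + (s^-1 * u1 y * X w + s^-1 ^+ 2 / 2 * u2 y * X w ^+ 2)).
    rewrite RintegralD//; first last.
    - by apply: rintegrableD; exact: rintegrableZ.
    - exact: rintegrable_cst.
    rewrite RintegralD//; try exact: rintegrableZ.
    rewrite Rintegral_probability_cst !RintegralZl// X0 mulr0 add0r -/v -s2.
    by field; rewrite gt_eqF.
  rewrite /shift_mean -RintegralB//; apply: eq_Rintegral => w _.
  by rewrite /r; ring.
rewrite rE.
have ir : P.-integrable setT (fun w => (r w)%:E).
  apply: eq_integrable (rintegrableB iu q_int) => // w _.
  by rewrite /r; congr EFin; ring.
apply: (le_trans (le_normr_Rintegral measurableT ir)).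
pose L := del * s.
pose bnd w := e / 2 / (v + 1) / n.+1%:R * X w ^+ 2 +
   C / n.+1%:R * (X w ^+ 2 * (L < `|X w|)%R%:R).
have mtr : measurable_fun setT (fun w => X w ^+ 2 * (L < `|X w|)%R%:R).
  exact: measurable_truncation.
have itr : P.-integrable setT (fun w => (X w ^+ 2 * (L < `|X w|)%R%:R)%:E).
  by apply: rintegrable_le mtr _ iX => w; exact: truncation_le.
have rb w : `|r w| <= bnd w.
  have Xs2 : (s^-1 * X w) ^+ 2 = X w ^+ 2 / n.+1%:R by rewrite exprMn exprVn s2 mulrC.
  rewrite /bnd; have [LX|XL] := ltP L `|X w|.
    apply: (le_trans (uC y (s^-1 * X w))); rewrite Xs2 mulr1.
    rewrite [leLHS](_ : _ = C / n.+1%:R * X w ^+ 2); last by field; rewrite nat1r.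
    by rewrite lerDr mulr_ge0 ?sqr_ge0// divr_ge0// ltW.
  rewrite !mulr0 addr0; apply: (le_trans (udel y (s^-1 * X w) _)).
    by rewrite normrM ger0_norm ?invr_ge0 ?(ltW s0)// mulrC ler_pdivrMr.
  rewrite Xs2.
  by rewrite le_eqVlt; apply/orP; left; apply/eqP; field; rewrite nat1r !gt_eqF// ltr_wpDl.
apply: (@le_trans _ _ (\int[P]_w bnd w)).
  apply: le_Rintegral => //; first exact: integrable_norm.
  by apply: rintegrableD; exact: rintegrableZ.
rewrite RintegralD//; try exact: rintegrableZ.
rewrite !RintegralZl// -/v.
have -> : e / n.+1%:R = e / 2 / n.+1%:R + e / 2 / n.+1%:R by field; rewrite nat1r.
have n0 : 0 < n.+1%:R^-1 :> R by rewrite invr_gt0 ltr0Sn.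
apply: lerD.
  rewrite mulrAC ler_wpM2r ?(ltW n0)// mulrAC ler_pdivrMr ?ltr_wpDl//.
  by rewrite ler_wpM2l ?lerDl ?divr_ge0 ?(ltW e0).
rewrite mulrAC ler_wpM2r ?(ltW n0)//.
apply: (le_trans (ler_wpM2l C0 (XK L Ks))).
rewrite mulrC mulrAC ler_pdivrMr ?ltr_wpDl//.
by rewrite ler_wpM2l ?lerDl ?divr_ge0 ?(ltW e0).
Qed.

End one_step.

(** The Gaussian and the variable [X] have the same first two moments, so one
    step of either averaging operator agrees up to [o(1 / n)]. *)
Lemma clt_iter {d} {T : measurableType d} (P : probability T R) (X : T -> R)
    (u u1 u2 : R -> R) :
  measurable_fun setT X -> P.-integrable setT (fun w => (X w ^+ 2)%:E) ->
  \int[P]_w X w = 0 -> continuous u -> bounded_meas u -> taylor2 u u1 u2 ->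
  iter n.+1 (shift_mean P (fun w => (Num.sqrt n.+1%:R)^-1 * X w)) u 0 @[n --> \oo] -->
  \int[normal_prob 0 1]_z u (Num.sqrt (\int[P]_w (X w ^+ 2)) * z).
Proof.
move=> mX iX X0 cu bu tu; set v := \int[P]_w _; set sg := Num.sqrt v.
have v0 : 0 <= v by apply: Rintegral_ge0 => w _; exact: sqr_ge0.
pose Z (z : R) := sg * z.
have mZ : measurable_fun [set: R] Z by exact: mulrl_measurable.
have iZ : (normal_prob 0 1).-integrable setT (fun z => (Z z ^+ 2)%:E).
  have := rintegrableZ (sg ^+ 2) (@integrable_gaussian_sqr R).
  by apply: eq_integrable => // z _; rewrite /Z exprMn.
have Z1 : \int[normal_prob 0 1]_z Z z = 0.
  by rewrite RintegralZl// ?gaussian_first_moment ?mulr0//; exact: integrable_gaussian_id.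
have Z2 : \int[normal_prob 0 1]_z (Z z ^+ 2) = v.
  rewrite /Z; under eq_Rintegral do rewrite exprMn.
  rewrite RintegralZl//; last exact: integrable_gaussian_sqr.
  by rewrite {1}/Rintegral gaussian_second_moment mulr1 sqr_sqrtr.
apply/cvgrPdist_le => e e0; have e2 : 0 < e / 2 by rewrite divr_gt0.
have [N1 N1P] := shift_mean_taylor mX iX X0 bu tu e2.
have [N2 N2P] := @shift_mean_taylor _ (measurableTypeR R) (normal_prob 0 1) Z
  mZ iZ Z1 u u1 u2 _ bu tu e2.
exists (maxn N1 N2) => // n; rewrite [X in X -> _]/= geq_max => /andP[n1 n2].
set s := Num.sqrt n.+1%:R; have s0 : 0 < s by rewrite sqrtr_gt0 ltr0Sn.
rewrite distrC.
have -> : \int[normal_prob 0 1]_z u (sg * z) =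
    iter n.+1 (shift_mean (normal_prob 0 1) (fun z => s^-1 * Z z)) u 0.
  rewrite (_ : (fun z => s^-1 * Z z) = (fun z => (s^-1 * sg) * z)); last first.
    by apply/funext => z; rewrite /Z mulrA.
  rewrite gaussian_shift_mean_iter//; last by rewrite mulr_ge0 ?sqrtr_ge0// invr_ge0 ltW.
  by apply: eq_Rintegral => z _; rewrite add0r mulrA divff ?mul1r// gt_eqF.
have -> : e = n.+1%:R * (e / n.+1%:R) by field; rewrite nat1r.
apply: (@iter_shift_mean_near _ _ _ _ (measurableTypeR R) P (normal_prob 0 1)) => //;
  try exact: measurable_funM.
move=> y; have := N1P n n1 y; have := N2P n n2 y; rewrite Z2 -/v -/s => h2 h1.
rewrite -(subrKA (u y + v / 2 * u2 y / n.+1%:R)).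
apply: (le_trans (ler_normD _ _)); rewrite (distrC (_ + _)).
by have -> : e / n.+1%:R = e / 2 / n.+1%:R + e / 2 / n.+1%:R; [field; rewrite nat1r|exact: lerD].
Qed.

End central_limit.

(** * Convergence in distribution *)

Section convergence_in_distribution.
Context {R : realType}.

Lemma segment_unif_continuous (g : R -> R) (K e : R) : continuous g -> 0 < e ->
  exists2 del : R, 0 < del & forall x y, `|x| <= K -> `|x - y| <= del ->
    `|g x - g y| <= e.
Proof.
move=> cg e0; have := @segment_compact R (- K) K.
rewrite compact_near_coveringP => cov.
have covd : \forall del \near 0^'+, `[- K, K]%classic `<=`
    (fun x => forall y, `|x - y| <= del -> `|g x - g y| <= e).
  apply: cov.
  move=> x _; have e2 : 0 < e / 2 by rewrite divr_gt0.
  have /cvgrPdist_le/(_ _ e2)/nbhs_ballP[r /= r0 xr] := cg x.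
  have r2 : 0 < r / 2 by rewrite divr_gt0.
  exists (ball x (r / 2), [set t | 0 < t < r / 2]).
    split; first exact: nbhsx_ballx.
    by near=> t; apply/andP; split; near: t; [exact: nbhs_right_gt|exact: nbhs_right_lt].
  move=> [x' t] [/= xx' /andP[t0 tr]] y x'y.
  have gx' := xr x' (le_ball _ xx'); have gy := xr y.
  rewrite -(subrKA (g x)) (le_trans (ler_normD _ _))// (splitr e) lerD//.
    by rewrite distrC; apply: gx'; rewrite ler_pdivrMr// ler_pMr// ler1n.
  apply: gy; rewrite /ball/= -(subrKA x') (le_lt_trans (ler_normD _ _))//.
  by rewrite (splitr r) ltrD// (le_lt_trans x'y).
have [del [/= del0 h]] := filter_ex (filterI (@nbhs_right_gt R 0) covd).
exists del => // x y xK; apply: h => /=.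
by rewrite in_itv/= -ler_norml.
Unshelve. all: by end_near. Qed.

(** The integrals of the positive and negative parts are suprema over simple
    functions lying below them, which is a monotone operation on all
    functions. Integrals of the statistic can thus be compared as well. *)
Lemma le_integral_total {d} {T : measurableType d} (mu : {measure set T -> \bar R})
    (f g : T -> \bar R) :
  (forall x, f x <= g x)%E -> (\int[mu]_x f x <= \int[mu]_x g x)%E.
Proof.
have le_nn (u v : T -> \bar R) : (forall x, 0 <= u x)%E -> (forall x, u x <= v x)%E ->
    (\int[mu]_x u x <= \int[mu]_x v x)%E.
  move=> u0 uv; have v0 x : (0 <= v x)%E by exact: le_trans (uv x).
  rewrite !ge0_integralTE//; apply: le_ereal_sup => _ /= [h hu <-].
  by exists h => // x; exact: le_trans (uv x).
move=> fg; rewrite integralE [leRHS]integralE; apply: leeB; apply: le_nn => x.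
- exact: funepos_ge0.
- by rewrite !funeposE; apply: le_max2; [exact: fg|exact: lexx].
- exact: funeneg_ge0.
- by rewrite !funenegE; apply: le_max2; [rewrite leeN2; exact: fg|exact: lexx].
Qed.

(** Both integrals lie between those of [g - b] and [g + b], where [b] is [e]
    plus [2 * M] on [A]. *)
Lemma Rintegral_near {d} {T : measurableType d} (P : probability T R)
    (f g : T -> R) (M e : R) (A : set T) :
  measurable_fun setT g -> measurable A -> 0 <= M -> 0 <= e ->
  (forall w, `|f w| <= M) -> (forall w, `|g w| <= M) ->
  (forall w, ~ A w -> `|f w - g w| <= e) ->
  `|\int[P]_w f w - \int[P]_w g w| <= e + 2 * M * fine (P A).
Proof.
move=> mg mA M0 e0 fM gM fg.
have ig := rintegrable_bounded P mg gM.
have iA : P.-integrable setT (fun w => (2 * M * \1_A w)%:E).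
  by apply: rintegrableZ; exact: integrable_indic.
have ic := rintegrable_cst P e.
have IA : \int[P]_w (2 * M * \1_A w) = 2 * M * fine (P A).
  rewrite RintegralZl//; last exact: integrable_indic.
  by rewrite {1}/Rintegral integral_indic// setIT.
have lo : (\int[P]_w (g w - (e + 2 * M * \1_A w))%:E <= \int[P]_w (f w)%:E)%E.
  apply: le_integral_total => w; rewrite lee_fin lerBlDr.
  have [wA|wA] := pselect (A w).
    rewrite indicE mem_set// mulr1; have := fM w; have := gM w.
    rewrite !ler_norml => /andP[_ h1] /andP[h2 _]; lra.
  rewrite indicE memNset// mulr0 addr0; have := fg _ wA.
  by rewrite ler_norml => /andP[h1 h2]; lra.
have hi : (\int[P]_w (f w)%:E <= \int[P]_w (g w + (e + 2 * M * \1_A w))%:E)%E.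
  apply: le_integral_total => w; rewrite lee_fin.
  have [wA|wA] := pselect (A w).
    rewrite indicE mem_set// mulr1; have := fM w; have := gM w.
    rewrite !ler_norml => /andP[h1 _] /andP[_ h2]; lra.
  rewrite indicE memNset// mulr0 addr0; have := fg _ wA.
  by rewrite ler_norml => /andP[h1 h2]; lra.
have iD := rintegrableD ic iA.
move: lo; rewrite -(EFin_Rintegral (rintegrableB ig iD)) => lo.
move: hi; rewrite -(EFin_Rintegral (rintegrableD ig iD)) => hi.
have ef : (\int[P]_w f w)%:E = (\int[P]_w (f w)%:E)%E.
  rewrite fineK// fin_numElt (lt_le_trans _ lo) ?ltNyr//=.
  by rewrite (le_lt_trans hi) ?ltry.
rewrite -ef !lee_fin in lo hi.
rewrite RintegralB// RintegralD// IA Rintegral_probability_cst in lo.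
rewrite RintegralD// RintegralD// IA Rintegral_probability_cst in hi.
rewrite ler_norml; apply/andP; split; lra.
Qed.

(** Slutsky's lemma. The second moments of the [W n] give tightness, so that only
    the uniform continuity of the test function on a segment matters. *)
Lemma cvg_in_distribution_perturb {d} {T : measurableType d} (P : probability T R)
    (X W : nat -> T -> R) (mu : probability (measurableTypeR R) R) (v : R) :
  (forall n, measurable_fun setT (W n)) ->
  (forall n, (\int[P]_w (W n w ^+ 2)%:E <= v%:E)%E) ->
  cvg_in_distribution P W mu ->
  (forall e : R, 0 < e -> \forall n \near \oo, exists A : set T,
     [/\ measurable A, (P A <= e%:E)%E &
      forall w, ~ A w -> `|X n w - W n w| <= e]) ->
  cvg_in_distribution P X mu.
Proof.
move=> mW Wv cvW XW g cg [M gM]; apply/cvgrPdist_le => eps eps0.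
have M0 : 0 <= M by exact: le_trans (gM 0).
have v0 : 0 <= v.
  by rewrite -lee_fin; apply: le_trans (Wv 0%N); apply: integral_ge0 => w _; rewrite lee_fin sqr_ge0.
have M10 : 0 < M + 1 by rewrite ltr_wpDl.
(* [e] bounds both the probability of the exceptional set and the mass of the
   [W n] outside the segment of radius [K] *)
pose e := eps / 16 / (M + 1); have e0 : 0 < e by rewrite !divr_gt0.
have eM : 2 * M * (e + e) <= eps / 4.
  rewrite [leLHS](_ : _ = (M / (M + 1)) * (eps / 4)); last by rewrite /e; field; rewrite gt_eqF.
  by rewrite ler_piMl ?divr_ge0 ?(ltW eps0)// ler_pdivrMr// mul1r lerDl.
pose K := 1 + v / e.
have K1 : 1 <= K by rewrite lerDl divr_ge0// ltW.
have K0 : 0 < K by rewrite (lt_le_trans _ K1).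
have vK : v / K ^+ 2 <= e.
  rewrite ler_pdivrMr ?exprn_gt0//; apply: (@le_trans _ _ (e * K)).
    by rewrite /K mulrDr mulr1 mulrC divfK ?gt_eqF// lerDr ltW.
  by rewrite ler_wpM2l ?(ltW e0)// expr2 ler_peMl ?(ltW K0).
have ep4 : 0 < eps / 4 by rewrite divr_gt0.
have [del del0 gdel] := segment_unif_continuous K cg ep4.
have em : 0 < Num.min e del by rewrite lt_min e0 del0.
have mg : measurable_fun [set: R] g by exact: continuous_measurable_fun.
have cvgW := cvW g cg (ex_intro _ M gM).
have h2 : 0 < eps / 2 by rewrite divr_gt0.
near=> n.
have [A [mA PA XWA]] : exists A : set T, [/\ measurable A, (P A <= (Num.min e del)%:E)%E &
      forall w, ~ A w -> `|X n w - W n w| <= Num.min e del].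
  by near: n; exact: XW.
have WA : `|\int[mu]_x g x - \int[P]_w g (W n w)| <= eps / 2.
  by near: n; move/cvgrPdist_le : cvgW; apply.
pose B := A `|` [set w | K < `|W n w|].
have mK : measurable [set w | K < `|W n w|] by exact: measurable_tail.
have mB : measurable B by exact: measurableU.
have PB : fine (P B) <= e + e.
  rewrite -lee_fin fineK ?fin_num_measure// EFinD (le_trans (measureU2 _ mA mK))//.
  apply: leeD; first by rewrite (le_trans PA)// lee_fin ge_min lexx.
  by apply: le_trans (second_moment_tail (mW n) K0 (Wv n)) _; rewrite lee_fin.
have XW2 : `|\int[P]_w g (X n w) - \int[P]_w g (W n w)| <= eps / 4 + 2 * M * fine (P B).
  apply: Rintegral_near => //; first exact: measurableT_comp.
    exact: ltW.
  move=> w wB; rewrite distrC; apply: gdel.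
    by rewrite leNgt; apply/negP => KW; apply: wB; right.
  rewrite distrC (le_trans (XWA w _)) ?ge_min ?lexx ?orbT// => Aw.
  by apply: wB; left.
rewrite -(subrKA (\int[P]_w g (W n w))).
apply: (le_trans (ler_normD _ _)); rewrite [X in _ + X]distrC.
have : 2 * M * fine (P B) <= 2 * M * (e + e) by rewrite ler_wpM2l// mulr_ge0.
lra.
Unshelve. all: by end_near. Qed.

Lemma Rintegral_real_gaussian (v : R) (g : R -> R) : 0 <= v -> continuous g ->
  (exists M, forall x, `|g x| <= M) ->
  \int[real_gaussian 0 v]_x g x = \int[normal_prob 0 1]_z g (Num.sqrt v * z).
Proof.
move=> v0 cg [M gM]; have mg : measurable_fun [set: R] g by exact: continuous_measurable_fun.
rewrite /real_gaussian; case: ifPn => [/eqP ->|vn0].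
  under [RHS]eq_Rintegral do rewrite sqrtr0 mul0r.
  rewrite Rintegral_probability_cst /Rintegral integral_dirac//.
    by rewrite diracT mul1e.
  exact/measurable_EFinP.
have s0 : 0 < Num.sqrt v by rewrite sqrtr_gt0 lt_neqAle eq_sym vn0.
set s := Num.sqrt v in s0 *.
have cphi : continuous (@normal_pdf R 0 s) by apply: continuous_normal_pdf; rewrite gt_eqF.
have u0 z : 0 <= g z + M.
  by rewrite -lerBlDr sub0r; have := gM z; rewrite ler_norml => /andP[].
have mscal : measurable_fun [set: R] (fun z => s * z) by exact: mulrl_measurable.
apply: (@Rintegral_eq_shift _ _ (measurableTypeR R) (measurableTypeR R) _
  (normal_prob 0 s) (normal_prob 0 1) g (fun z => g (s * z)) M).
- exact: mg.
- exact: (measurableT_comp mg mscal).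
- exact: gM.
- by move=> x; exact: gM.
rewrite (ge0_integral_normal_prob 0 s (f := fun x => (g x + M)%:E)); first last.
- by move=> x; rewrite lee_fin.
- by apply/measurable_EFinP; apply: measurable_funD.
rewrite (ge0_integral_normal_prob 0 1 (f := fun x => (g (s * x) + M)%:E)); first last.
- by move=> x; rewrite lee_fin.
- by apply/measurable_EFinP; apply: measurable_funD => //; exact: measurableT_comp.
under eq_integral do rewrite -EFinM.
rewrite (integral_affine 0 s0).
- apply: eq_integral => z _; rewrite addr0 -EFinM -mulrA; congr (_ * _)%:E.
  rewrite !normal_pdfE ?oner_neq0 ?gt_eqF//= /normal_peak /normal_fun !subr0.
  rewrite mulrAC; congr (_ * expR _); last by field; rewrite gt_eqF.
  rewrite -mulrnAr sqrtrM ?sqr_ge0// sqrtr_sqr ger0_norm ?(ltW s0)// expr1n mul1r.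
  rewrite invfM mulrAC mulVf ?mul1r// gt_eqF//.
- move=> x; apply: cvgM; last exact: cphi.
  by apply: cvgD; [exact: cg|exact: cvg_cst].
- by move=> x; rewrite mulr_ge0// normal_pdf_ge0.
Qed.

(** Truncating the test function costs the tail mass, which the second moment
    controls; smoothing the truncated function costs [e]. *)
Lemma smooth_test_function (g : R -> R) (M K e : R) : continuous g ->
  (forall x, `|g x| <= M) -> 0 < K -> 0 < e ->
  exists (u u1 u2 : R -> R), [/\ continuous u, bounded_meas u, taylor2 u u1 u2 &
    forall d (T : measurableType d) (P : probability T R) (X : T -> R) v,
      measurable_fun setT X -> (\int[P]_w (X w ^+ 2)%:E <= v%:E)%E ->
      `|\int[P]_w g (X w) - (\int[P]_w u (X w) + g (- K))| <= e + 2 * (e + (M + M + M)) * (v / K ^+ 2)].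
Proof.
move=> cg gM K0 e0; have M0 : 0 <= M by exact: le_trans (gM 0).
(* clamping to the segment makes the function uniformly continuous, and
   subtracting [g (- K)] makes it vanish to the left *)
pose cl (x : R) := Num.max (- K) (Num.min x K).
have clK x : `|cl x| <= K.
  by rewrite ler_norml /cl le_max lexx/= ge_max ge_min lexx orbT andbT; lra.
have cl_id x : `|x| <= K -> cl x = x.
  by rewrite ler_norml /cl => /andP[h1 h2]; rewrite min_l// max_r.
have cl_near x t : `|cl (x + t) - cl x| <= `|t|.
  have := ler_norm t; have := ler_norm (- t); rewrite normrN /cl => h1 h2.
  rewrite ler_norml !maxElt !minElt.
  by do !case: ifPn; rewrite -?leNgt => *; apply/andP; split; lra.
have cl_low x : x <= - K -> cl x = - K.
  by move=> xK; rewrite /cl max_l// ge_min xK.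
pose g1 x := g (cl x) - g (- K).
have g1M x : `|g1 x| <= M + M by rewrite (le_trans (ler_normB _ _))// lerD.
have g1u (eps : R) : 0 < eps -> exists2 del : R, 0 < del & forall x t, `|t| <= del ->
    `|g1 (x + t) - g1 x| <= eps.
  move=> eps0; have [del del0 h] := segment_unif_continuous K cg eps0.
  exists del => // x t td; rewrite /g1 opprB addrA subrK distrC; apply: h => //.
  by rewrite distrC (le_trans (cl_near _ _)).
have g10 x : x <= - K -> g1 x = 0 by move=> xK; rewrite /g1 cl_low// subrr.
have [u [cu ug] [u1 [u2 tu]]] := smoothing g1M g1u g10 e0.
have mg : measurable_fun [set: R] g by exact: continuous_measurable_fun.
have mu : measurable_fun [set: R] u by exact: continuous_measurable_fun.
have uM x : `|u x| <= e + (M + M).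
  rewrite -(subrK (g1 x) (u x)) (le_trans (ler_normD _ _))//; exact: lerD.
exists u, u1, u2; split => //; first by split=> //; exists (e + (M + M)).
move=> d T P X v mX Xv.
have iu : P.-integrable setT (fun w => (u (X w))%:E).
  by apply: (rintegrable_bounded _ (M := e + (M + M))) => //; exact: measurableT_comp.
have -> : \int[P]_w u (X w) + g (- K) = \int[P]_w (u (X w) + g (- K)).
  by apply: EFin_inj; rewrite -integral_addr_cst// EFin_Rintegral//;
    apply: rintegrableD => //; exact: rintegrable_cst.
have mA : measurable [set w | K < `|X w|] by exact: measurable_tail.
apply: (@le_trans _ _ (e + 2 * (e + (M + M + M)) * fine (P [set w | K < `|X w|]))).
  apply: Rintegral_near => //.
  - by apply: measurable_funD => //; exact: measurableT_comp.
  - by rewrite !addr_ge0// ltW.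
  - exact: ltW.
  - by move=> w; apply: (le_trans (gM _)); lra.
  - by move=> w; rewrite (le_trans (ler_normD _ _))// addrA lerD.
  - move=> w /negP; rewrite -leNgt => XK.
    have -> : g (X w) - (u (X w) + g (- K)) = - (u (X w) - g1 (X w)).
      by rewrite /g1 cl_id//; ring.
    by rewrite normrN.
have tail := second_moment_tail mX K0 Xv.
rewrite lerD2l ler_wpM2l//; first by rewrite mulr_ge0// !addr_ge0// ltW.
by rewrite -lee_fin fineK ?fin_num_measure.
Qed.

End convergence_in_distribution.

(** * Independence *)

Lemma bigcap_mem_cons {I : eqType} {T : Type} (F : I -> set T) i (s : seq I) :
  \bigcap_(j in [set` i :: s]) F j = F i `&` \bigcap_(j in [set` s]) F j.
Proof.
apply/seteqP; split => x.
  move=> h; split; first by apply: h; rewrite /= mem_head.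
  by move=> j /= js; apply: h; rewrite /= inE js orbT.
by move=> [xi xs] j; rewrite /= inE => /predU1P[->//|]; exact: xs.
Qed.

Lemma bigcap_mem_nil {I : eqType} {T : Type} (F : I -> set T) :
  \bigcap_(j in [set` [::]]) F j = setT.
Proof. by apply/seteqP; split. Qed.

Section independence.
Context {R : realType}.

(** Rectangles form a generating pi-system. *)
Lemma finite_measure_rect_unique {d1 d2} {E1 : measurableType d1}
    {E2 : measurableType d2} (m1 m2 : {measure set (E1 * E2) -> \bar R}) :
  (m1 setT < +oo)%E ->
  (forall A B, measurable A -> measurable B -> m1 (A `*` B) = m2 (A `*` B)) ->
  forall D, measurable D -> m1 D = m2 D.
Proof.
move=> fin m12 D mD.
pose C : set (set (E1 * E2)) := [set A `*` B | A in measurable & B in measurable].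
apply: (measure_unique C (fun=> setT)) => //.
- by rewrite measurable_prod_measurableType.
- move=> _ _ [A mA [B mB <-]] [A' mA' [B' mB' <-]]; rewrite -setXI.
  by exists (A `&` A'); [exact: measurableI|exists (B `&` B') => //; exact: measurableI].
- by move=> _; exists setT => //; exists setT => //; rewrite setXTT.
- by rewrite bigcup_const//; exists 0%N.
- by move=> _ [A mA [B mB <-]]; exact: m12.
Qed.

Lemma integral_distribution_meas {d d'} {T : measurableType d} {T' : measurableType d'}
    (P : probability T R) (X : {RV P >-> T'}) (f : T' -> \bar R) :
  measurable_fun setT f ->
  (\int[distribution P X]_y f y = \int[P]_w f (X w))%E.
Proof.
move=> mf; rewrite integralE [RHS]integralE.
rewrite (ge0_integral_distribution X (measurable_funepos mf) (fun _ => funepos_ge0 _ _)).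
rewrite (ge0_integral_distribution X (measurable_funeneg mf) (fun _ => funeneg_ge0 _ _)).
by congr (_ + - _)%E; apply: eq_integral => w _; rewrite /= ?funeposE ?funenegE.
Qed.

Section joint_law.
Context {d d1 d2 : measure_display} {T : measurableType d} {E1 : measurableType d1}
  {E2 : measurableType d2} (P : probability T R) (Q : probability E2 R)
  (U : T -> E1) (V : T -> E2).
Hypotheses (mU : measurable_fun setT U) (mV : measurable_fun setT V).
Hypothesis UV : forall A B, measurable A -> measurable B ->
  P (U @^-1` A `&` V @^-1` B) = (P (U @^-1` A) * Q B)%E.

Let W : {mfun T >-> (E1 * E2)%type} := HB.pack (fun w => (U w, V w))
  (isMeasurableFun.Build _ _ _ _ _ (measurable_fun_pair mU mV)).
Let U' : {mfun T >-> E1} := HB.pack U (isMeasurableFun.Build _ _ _ _ U mU).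

Let law D : measurable D -> distribution P W D = (distribution P U' \x Q)%E D.
Proof.
apply: finite_measure_rect_unique.
  by rewrite /= /distribution /pushforward/= preimage_setT probability_setT ltry.
by move=> A B mA mB; rewrite /= product_measure1E// /distribution /pushforward/= -UV.
Qed.

Lemma ge0_integral_indep (f : E1 * E2 -> \bar R) : measurable_fun setT f ->
  (forall z, 0 <= f z)%E ->
  (\int[P]_w f (U w, V w) = \int[P]_w \int[Q]_y f (U w, y))%E.
Proof.
move=> mf f0.
transitivity (\int[distribution P W]_z f z)%E.
  by rewrite ge0_integral_distribution.
rewrite (eq_measure_integral (distribution P U' \x Q)%E); last by move=> A mA _; exact: law.
rewrite fubini_tonelli1// ge0_integral_distribution//.
  exact: measurable_fun_fubini_tonelli_F.
by move=> x; apply: integral_ge0 => y _; exact: f0.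
Qed.

Lemma integral_indep (f : E1 * E2 -> R) : measurable_fun setT f ->
  (\int[P]_w \int[Q]_y `|f (U w, y)|%:E < +oo)%E ->
  P.-integrable setT (fun w => (f (U w, V w))%:E) /\
  (\int[P]_w (f (U w, V w))%:E = \int[P]_w \int[Q]_y (f (U w, y))%:E)%E.
Proof.
move=> mf fi; have mf' : measurable_fun setT (EFin \o f) by exact/measurable_EFinP.
have m_abs : measurable_fun setT (abse \o (EFin \o f)) by exact: measurableT_comp.
have iprod : (distribution P U' \x Q)%E.-integrable setT (EFin \o f).
  apply/integrable12ltyP => //.
  rewrite ge0_integral_distribution//.
    exact: (@measurable_fun_fubini_tonelli_F _ _ _ _ R Q _ m_abs (fun z => abse_ge0 _)).
  by move=> x; apply: integral_ge0.
have ipair : P.-integrable setT (fun w => (f (U w, V w))%:E).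
  apply/integrableP; split.
    apply/measurable_EFinP; apply: (measurableT_comp mf); exact: measurable_fun_pair.
  by rewrite (ge0_integral_indep m_abs (fun z => abse_ge0 _)).
split=> //.
transitivity (\int[distribution P W]_z (EFin \o f) z)%E.
  by rewrite integral_distribution_meas.
rewrite (eq_measure_integral (distribution P U' \x Q)%E); last by move=> A mA _; exact: law.
rewrite -integral12_prod_meas1// integral_distribution_meas//.
exact: (measurable_fubini_F iprod).
Qed.

Lemma Rintegral_indep (f : E1 * E2 -> R) (M : R) : measurable_fun setT f ->
  (forall z, `|f z| <= M) ->
  \int[P]_w f (U w, V w) = \int[P]_w \int[Q]_y f (U w, y).
Proof.
move=> mf fM.
have mf' : measurable_fun setT (EFin \o f) by exact/measurable_EFinP.
have m_abs : measurable_fun setT (abse \o (EFin \o f)) by exact: measurableT_comp.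
have iQ x : Q.-integrable setT (fun y => (f (x, y))%:E).
  by apply: (rintegrable_bounded _ (M := M)) => //; exact: measurable_fun_pair2.
have [|_ e] := integral_indep mf.
  apply: (@le_lt_trans _ _ (\int[P]_w (cst M%:E w))%E).
    apply: ge0_le_integral => //.
    - by move=> w _; apply: integral_ge0.
    - have := @measurable_fun_fubini_tonelli_F _ _ _ _ R Q _ m_abs (fun z => abse_ge0 _).
      by move=> h; exact: (measurableT_comp h mU).
    - move=> w _; rewrite -EFin_Rintegral; last exact: integrable_norm (iQ _).
      rewrite lee_fin; apply: le_trans (ler_norm _) _.
      apply: Rintegral_le_cst; first exact: integrable_norm (iQ _).
      by move=> y; rewrite normr_id.
  by rewrite integral_cst//= probability_setT mule1 ltry.
rewrite /Rintegral; congr fine; rewrite e; apply: eq_integral => w _.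
by rewrite EFin_Rintegral.
Qed.

End joint_law.

Section iid_sequence.
Context {d d' : measure_display} {T : measurableType d} {E : measurableType d'}.
Context (P : probability T R) (Y : nat -> T -> E) (Q : probability E R).
Hypothesis iidY : iid_with_law P Y Q.

Let mY i : measurable_fun setT (Y i). Proof. by case: iidY. Qed.
Let lawY i A : measurable A -> P (Y i @^-1` A) = Q A. Proof. by case: iidY => _ + _; exact. Qed.

Lemma ge0_integral_iid i (f : E -> \bar R) : measurable_fun setT f ->
  (forall y, 0 <= f y)%E -> (\int[P]_w f (Y i w) = \int[Q]_y f y)%E.
Proof.
move=> mf f0; rewrite (eq_measure_integral (pushforward P (Y i))); last first.
  by move=> A mA _; exact/esym/lawY.
by rewrite ge0_integral_pushforward.
Qed.

Lemma integral_iid i (f : E -> \bar R) : measurable_fun setT f ->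
  (\int[P]_w f (Y i w) = \int[Q]_y f y)%E.
Proof.
move=> mf; rewrite integralE [RHS]integralE.
rewrite -(ge0_integral_iid i (measurable_funepos mf) (fun _ => funepos_ge0 _ _)).
rewrite -(ge0_integral_iid i (measurable_funeneg mf) (fun _ => funeneg_ge0 _ _)).
by congr (_ + - _)%E; apply: eq_integral => w _; rewrite /= ?funeposE ?funenegE.
Qed.

Lemma integrable_iid i (f : E -> R) : Q.-integrable setT (fun y => (f y)%:E) ->
  P.-integrable setT (fun w => (f (Y i w))%:E).
Proof.
move=> /integrableP[mf fi]; apply/integrableP; split.
  exact: (measurableT_comp mf (mY i)).
by rewrite (ge0_integral_iid i (f := fun y => `|(f y)%:E|%E))//; exact: measurableT_comp.
Qed.

Lemma iid_bigcap (s : seq nat) (A : nat -> set E) : uniq s ->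
  (forall i, measurable (A i)) ->
  P (\bigcap_(i in [set` s]) (Y i @^-1` A i)) = (\prod_(i <- s) Q (A i))%E.
Proof.
move=> us mA; case: iidY => _ _ -> //.
by apply: eq_bigr => i _; rewrite lawY.
Qed.

Lemma iid_pair i j : i != j -> forall A B, measurable A -> measurable B ->
  P (Y i @^-1` A `&` Y j @^-1` B) = (P (Y i @^-1` A) * Q B)%E.
Proof.
move=> ij A B mA mB; pose C k := if k == i then A else B.
have := @iid_bigcap [:: i; j] C.
rewrite /= inE ij => /(_ isT) /(_ (fun k => _)) h.
have : \bigcap_(k in [set` [:: i; j]]) (Y k @^-1` C k) = Y i @^-1` A `&` Y j @^-1` B.
  by rewrite !bigcap_mem_cons bigcap_mem_nil setIT /C eqxx eq_sym (negbTE ij).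
move=> <-; rewrite h; last by move=> k; rewrite /C; case: ifP.
by rewrite lawY// big_cons big_seq1 /C eqxx eq_sym (negbTE ij).
Qed.

Variable phi : E -> R.
Hypothesis mphi : measurable_fun setT phi.

Let S n w := \sum_(i < n) phi (Y i w).

Lemma measurable_iid_sum n : measurable_fun setT (S n).
Proof. by apply: measurable_sum => i; exact: (measurableT_comp mphi). Qed.

(** A partial sum is independent of the later terms: the rectangle formula
    passes from [n] to [n.+1] because, for a fixed later event, the two sides
    are finite measures of the pair formed by the sum and the next term. *)
Lemma iid_sum_later n : forall (s : seq nat) (B : nat -> set E) (A : set (measurableTypeR R)),
  uniq s -> all (leq n) s -> (forall i, measurable (B i)) -> measurable A ->
  P (S n @^-1` A `&` \bigcap_(i in [set` s]) (Y i @^-1` B i)) =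
  (P (S n @^-1` A) * P (\bigcap_(i in [set` s]) (Y i @^-1` B i)))%E.
Proof.
elim: n => [|n IH] s B A us sn mB mA.
  have S0 w : S 0%N w = 0 by rewrite /S big_ord0.
  have [A0|A0] := pselect (A 0).
    rewrite (_ : S 0%N @^-1` A = setT) ?setTI ?probability_setT ?mul1e//.
    by apply/seteqP; split => // w _ /=; rewrite S0.
  rewrite (_ : S 0%N @^-1` A = set0) ?set0I ?measure0 ?mul0e//.
  by apply/seteqP; split => // w /=; rewrite S0.
set C := \bigcap_(i in _) _.
have mC : measurable C.
  by apply: fin_bigcap_measurable => // i _; rewrite -[X in measurable X]setTI; exact: mY.
have mSn : @measurable_fun _ _ T (measurableTypeR R) setT (S n).
  exact: measurable_iid_sum.
pose W : {mfun T >-> (measurableTypeR R * E)%type} := HB.pack (fun w => (S n w, Y n w))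
  (isMeasurableFun.Build _ _ _ _ _ (measurable_fun_pair mSn (mY n))).
have mW : measurable_fun setT W by exact: measurable_funPT.
pose m1 : {measure set (measurableTypeR R * E) -> \bar R} :=
  pushforward (mrestr P mC) W.
have pC0 : (0 <= fine (P C))%R by rewrite fine_ge0.
pose m2 : {measure set (measurableTypeR R * E) -> \bar R} :=
  mscale (NngNum pC0) (pushforward P W).
have key D : measurable D -> m1 mW D = m2 mW D.
  apply: finite_measure_rect_unique.
    rewrite /m1/= /pushforward/= /mrestr; rewrite preimage_setT setTI.
    by apply: (le_lt_trans (probability_le1 P mC)); exact: ltry.
  move=> A' B' mA' mB'; rewrite /m1 /m2/= /mscale/= /pushforward/= /mrestr.
  have sE : n \notin s by apply/negP => /(allP sn); rewrite ltnn.
  have IHn (t : seq nat) (B1 : nat -> set E) := IH t B1 A'.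
  pose B1 i := if i == n then B' else B i.
  have mB1 i : measurable (B1 i) by rewrite /B1; case: ifP.
  have CE : \bigcap_(i in [set` s]) (Y i @^-1` B1 i) = C.
    apply: eq_bigcapr => i /= si; rewrite /B1; case: eqP => // e.
    by rewrite -e si in sE.
  have nsE : \bigcap_(i in [set` n :: s]) (Y i @^-1` B1 i) = Y n @^-1` B' `&` C.
    by rewrite bigcap_mem_cons CE /B1 eqxx.
  have n1E : \bigcap_(i in [set` [:: n]]) (Y i @^-1` B1 i) = Y n @^-1` B'.
    by rewrite bigcap_mem_cons bigcap_mem_nil setIT /B1 eqxx.
  have us1 : uniq (n :: s) by rewrite /= sE us.
  have sn1 : all (leq n) (n :: s).
    by rewrite /= leqnn; apply: sub_all sn => i; exact: ltnW.
  have e1 := IHn (n :: s) B1 us1 sn1 mB1 mA'.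
  have := IHn [:: n] B1 isT; rewrite /= leqnn => /(_ isT mB1 mA'); rewrite n1E => e2.
  have e3 := iid_bigcap us1 mB1; have e4 := iid_bigcap us mB1.
  rewrite nsE in e1 e3; rewrite CE in e4.
  have -> : (fun w => (S n w, Y n w)) @^-1` (A' `*` B') = S n @^-1` A' `&` Y n @^-1` B'.
    by apply/seteqP; split.
  rewrite -setIA e1 e3 big_cons -e4 e2 fineK ?fin_num_measure//.
  by rewrite (lawY n mB') /B1 eqxx muleA muleC.
have -> : S n.+1 @^-1` A = W @^-1` [set z | A (z.1 + phi z.2)].
  by apply/seteqP; split => w /=; rewrite /S big_ord_recr.
have mD : measurable [set z : measurableTypeR R * E | A (z.1 + phi z.2)].
  have mf : measurable_fun setT (fun z : measurableTypeR R * E => z.1 + phi z.2).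
    by apply: measurable_funD => //; exact: (measurableT_comp mphi).
  by have := mf measurableT _ mA; rewrite setTI.
have := key _ mD; rewrite /m1 /m2/= /mscale/= /pushforward/= /mrestr => ->.
by rewrite fineK ?fin_num_measure// muleC.
Qed.

Lemma iid_sum_next n (A : set (measurableTypeR R)) (B : set E) :
  measurable A -> measurable B ->
  P (S n @^-1` A `&` Y n @^-1` B) = (P (S n @^-1` A) * Q B)%E.
Proof.
move=> mA mB; have := @iid_sum_later n [:: n] (fun=> B) A isT.
rewrite /= leqnn => /(_ isT (fun=> mB) mA).
by rewrite bigcap_mem_cons bigcap_mem_nil setIT (lawY n mB).
Qed.

(** Each further independent term applies the averaging operator once more. *)
Lemma iid_sum_shift_mean (c : R) (u : R -> R) n y : bounded_meas u ->
  \int[P]_w u (y + c * S n w) = iter n (shift_mean Q (fun e => c * phi e)) u y.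
Proof.
have mc : measurable_fun setT (fun e => c * phi e) by exact: measurable_funM.
elim: n u y => [|n IH] u y bu.
  under eq_Rintegral do rewrite /S big_ord0 mulr0 addr0.
  by rewrite Rintegral_probability_cst.
rewrite iterSr -IH; last exact: bounded_meas_shift_mean.
have [mu [M uM]] := bu.
pose f (z : measurableTypeR R * E) := u (y + c * z.1 + c * phi z.2).
have mf : measurable_fun setT f.
  apply: (measurableT_comp mu); apply: measurable_funD.
    by apply: measurable_funD => //; exact: measurable_funM.
  exact: (measurableT_comp mc).
have mSn : @measurable_fun _ _ T (measurableTypeR R) setT (S n).
  exact: measurable_iid_sum.
have <- := Rintegral_indep mSn (mY n) (iid_sum_next n) mf (fun _ => uM _).
by apply: eq_Rintegral => w _; rewrite /f /S big_ord_recr/=; congr (u _); ring.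
Qed.

End iid_sequence.
End independence.

(** * Second moments of sums of independent variables *)

Section iid_second_moment.
Context {R : realType} {d d' : measure_display} {T : measurableType d}.
Context {E : measurableType d'}.
Context (P : probability T R) (Y : nat -> T -> E) (Q : probability E R).
Hypothesis iidY : iid_with_law P Y Q.

(** For a kernel that integrates to zero against [Q \x Q], only the diagonal
    terms of the double sum contribute to its mean. *)
Lemma iid_kernel_sum (kap : E * E -> R) n : measurable_fun setT kap ->
  (\int[Q]_x \int[Q]_y `|kap (x, y)|%:E < +oo)%E ->
  (\int[Q]_x \int[Q]_y (kap (x, y))%:E = 0)%E ->
  Q.-integrable setT (fun x => (kap (x, x))%:E) ->
  P.-integrable setT
    (fun w => (\sum_(i < n) \sum_(j < n) kap (Y i w, Y j w))%:E) /\
  \int[P]_w (\sum_(i < n) \sum_(j < n) kap (Y i w, Y j w)) =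
  n%:R * \int[Q]_x kap (x, x).
Proof.
move=> mk k1 k0 kd; have mY : forall i, measurable_fun setT (Y i) by case: iidY.
have m_abs : measurable_fun setT (fun z : E * E => `|kap z|%:E).
  by apply/measurable_EFinP; exact: measurableT_comp.
have mkE : measurable_fun setT (fun z : E * E => (kap z)%:E) by exact/measurable_EFinP.
have off i j : i != j -> P.-integrable setT (fun w => (kap (Y i w, Y j w))%:E) /\
    \int[P]_w kap (Y i w, Y j w) = 0.
  move=> ij; have [|ik ke] := integral_indep (mY i) (mY j) (iid_pair iidY ij) mk.
    rewrite (ge0_integral_iid iidY i (f := fun x => \int[Q]_y `|kap (x, y)|%:E)%E)//.
      exact: (@measurable_fun_fubini_tonelli_F _ _ _ _ R Q _ m_abs).
    by move=> x; apply: integral_ge0.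
  split=> //; rewrite /Rintegral ke.
  have iprod : (Q \x Q)%E.-integrable setT (fun z => (kap z)%:E).
    exact/integrable12ltyP.
  have mF := measurable_fubini_F iprod.
  by rewrite (integral_iid iidY i mF) [X in fine X](_ : _ = 0%E).
have diag i : P.-integrable setT (fun w => (kap (Y i w, Y i w))%:E) /\
    \int[P]_w kap (Y i w, Y i w) = \int[Q]_x kap (x, x).
  split; first exact: (integrable_iid iidY i (f := fun x => kap (x, x))).
  rewrite /Rintegral (integral_iid iidY i (f := fun x => (kap (x, x))%:E))//.
  exact: measurable_int kd.
have all_int i j : P.-integrable setT (fun w => (kap (Y i w, Y j w))%:E).
  by have [->|/off[]//] := eqVneq i j; case: (diag j).
split; first by do 2 apply: rintegrable_sum => ?; exact: all_int.
rewrite Rintegral_sum; last by move=> i; apply: rintegrable_sum => j; exact: all_int.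
rewrite (eq_bigr (fun=> \int[Q]_x kap (x, x))).
  by rewrite sumr_const card_ord mulr_natl.
move=> i _; rewrite Rintegral_sum; last by move=> j; exact: all_int.
rewrite (bigD1 i)//= big1 ?addr0; first by case: (diag i).
by move=> j ji; case: (off i j) => //; rewrite eq_sym.
Qed.

Lemma iid_sum_second_moment (phi : E -> R) n : measurable_fun setT phi ->
  Q.-integrable setT (fun x => (phi x ^+ 2)%:E) -> \int[Q]_x phi x = 0 ->
  P.-integrable setT (fun w => ((\sum_(i < n) phi (Y i w)) ^+ 2)%:E) /\
  \int[P]_w ((\sum_(i < n) phi (Y i w)) ^+ 2) = n%:R * \int[Q]_x (phi x ^+ 2).
Proof.
move=> mphi iphi2 phi0; have iphi := rintegrable_sqr_id mphi iphi2.
pose kap (z : E * E) := phi z.1 * phi z.2.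
have mk : measurable_fun setT kap.
  by apply: measurable_funM; exact: (measurableT_comp mphi).
have sqE w : (\sum_(i < n) phi (Y i w)) ^+ 2 =
    \sum_(i < n) \sum_(j < n) kap (Y i w, Y j w).
  by rewrite expr2 mulr_suml; apply: eq_bigr => i _; rewrite mulr_sumr.
have iabs : Q.-integrable setT (fun y => `|phi y|%:E) by exact: integrable_norm iphi.
have [|||i1 e1] := @iid_kernel_sum kap n mk.
- rewrite (eq_integral (fun x => (\int[Q]_y `|phi y|)%:E * `|phi x|%:E)%E).
    by apply: integrable_lty => //; exact: (rintegrableZ _ iabs).
  move=> x _; rewrite -EFinM mulrC -RintegralZl// EFin_Rintegral; last exact: rintegrableZ.
  by apply: eq_integral => y _; rewrite /kap/= normrM.
- rewrite (eq_integral (fun=> 0%E)) ?integral0// => x _.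
  rewrite -EFin_Rintegral; last exact: (rintegrableZ (phi x) iphi).
  by rewrite /kap/= RintegralZl// phi0 mulr0.
- by apply: eq_integrable iphi2 => // x _; rewrite /kap expr2.
under eq_fun do rewrite sqE.
split=> //; under eq_Rintegral do rewrite sqE.
by rewrite e1; under eq_Rintegral do rewrite /kap/= -expr2.
Qed.

End iid_second_moment.

(** * The central limit theorem for real variables *)

Section clt.
Context {R : realType} {d d' : measure_display} {T : measurableType d}.
Context {E : measurableType d'}.
Context (P : probability T R) (Y : nat -> T -> E) (Q : probability E R).
Hypothesis iidY : iid_with_law P Y Q.
Variable phi : E -> R.
Hypothesis mphi : measurable_fun setT phi.
Hypothesis iphi2 : Q.-integrable setT (fun y => (phi y ^+ 2)%:E).
Hypothesis phi0 : \int[Q]_y phi y = 0.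

Let W n w := (Num.sqrt n%:R)^-1 * \sum_(i < n) phi (Y i w).

Lemma measurable_normalized_sum n : measurable_fun setT (W n).
Proof. by apply: measurable_funM => //; exact: (measurable_iid_sum iidY). Qed.

Lemma normalized_sum_second_moment n :
  (\int[P]_w (W n w ^+ 2)%:E <= (\int[Q]_y (phi y ^+ 2))%:E)%E.
Proof.
have v0 : 0 <= \int[Q]_y (phi y ^+ 2) by apply: Rintegral_ge0 => y _; exact: sqr_ge0.
have [i2 e2] := iid_sum_second_moment iidY n mphi iphi2 phi0.
rewrite /W; under eq_integral do rewrite exprMn.
rewrite -EFin_Rintegral; last exact: rintegrableZ.
rewrite RintegralZl// e2 lee_fin exprVn sqr_sqrtr ?ler0n//.
have [->|n0] := eqVneq n 0%N; first by rewrite mul0r mulr0.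
by rewrite mulKf// pnatr_eq0.
Qed.

Lemma central_limit_theorem :
  cvg_in_distribution P W (real_gaussian 0 (\int[Q]_y (phi y ^+ 2))).
Proof.
set v := \int[Q]_y _.
have v0 : 0 <= v by apply: Rintegral_ge0 => y _; exact: sqr_ge0.
move=> g cg [M gM]; have M0 : 0 <= M by exact: le_trans (gM 0).
rewrite Rintegral_real_gaussian//; last by exists M.
apply/cvgrPdist_le => eps eps0.
pose e := Num.min 1 (eps / 8).
have e0 : 0 < e by rewrite lt_min ltr01 divr_gt0.
have e1 : e <= 1 by rewrite ge_min lexx.
have e8 : e <= eps / 8 by rewrite ge_min lexx orbT.
pose C := 2 * (1 + (M + M + M)) * v.
have C0 : 0 <= C by rewrite !mulr_ge0// addr_ge0// !addr_ge0.
pose K := 1 + C / e.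
have K1 : 1 <= K by rewrite lerDl divr_ge0// ltW.
have K0 : 0 < K by rewrite (lt_le_trans _ K1).
have CK : 2 * (e + (M + M + M)) * (v / K ^+ 2) <= e.
  apply: (@le_trans _ _ (C / K ^+ 2)).
    rewrite mulrA ler_wpM2r ?invr_ge0 ?sqr_ge0// ler_wpM2r// ler_wpM2l// lerD2r//.
  rewrite ler_pdivrMr ?exprn_gt0//; apply: (@le_trans _ _ (e * K)).
    by rewrite /K mulrDr mulr1 mulrC divfK ?gt_eqF// lerDr ltW.
  by rewrite ler_wpM2l ?(ltW e0)// expr2 ler_peMl ?(ltW K0).
have [u [u1 [u2 [cu bu tu approx]]]] := smooth_test_function cg gM K0 e0.
pose Z (z : measurableTypeR R) := Num.sqrt v * z.
have mZ : measurable_fun setT Z by exact: mulrl_measurable.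
have Z2 : (\int[normal_prob 0 1]_z (Z z ^+ 2)%:E <= v%:E)%E.
  rewrite /Z; under eq_integral do rewrite exprMn EFinM.
  rewrite integralZl//; last exact: integrable_gaussian_sqr.
  by rewrite gaussian_second_moment mule1 sqr_sqrtr.
(* the same test function serves for the Gaussian and for the sums, since they
   share the bound [v] on the second moment *)
have gZ := approx _ _ (normal_prob 0 1) Z v mZ Z2.
have gW n := approx _ _ P (W n) v (measurable_normalized_sum n) (normalized_sum_second_moment n).
have cvgu := clt_iter mphi iphi2 phi0 cu bu tu.
have [N _ Nu] := (cvgrPdist_le _ _).1 cvgu e e0.
exists N.+1 => // -[//|n] Nn; have {Nu} := Nu n Nn.
rewrite -(iid_sum_shift_mean iidY mphi _ _ _ bu).
have -> : \int[P]_w u (0 + (Num.sqrt n.+1%:R)^-1 * (\sum_(i < n.+1) phi (Y i w))) =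
    \int[P]_w u (W n.+1 w) by apply: eq_Rintegral => w _; rewrite add0r.
have := gW n.+1; move: gZ; rewrite -/v /Z.
set a := \int[normal_prob 0 1]_z g _; set b := \int[normal_prob 0 1]_z u _.
set a' := \int[P]_w g _; set b' := \int[P]_w u _; set c := g _.
rewrite !ler_norml => /andP[h1 h2] /andP[h3 h4] /andP[h5 h6].
apply/andP; split; lra.
Qed.

End clt.

(** * Riesz representation *)

Section hilbert.
Context {R : realType} {K : hilbertType R}.
Implicit Types x y z : K.

Lemma dotBl x y z : dot (x - y) z = dot x z - dot y z.
Proof. by rewrite dotDl dotNl. Qed.

Lemma dotBr x y z : dot x (y - z) = dot x y - dot x z.
Proof. by rewrite dotDr dotNr. Qed.

Lemma normB_sqr x y : `|x - y| ^+ 2 = `|x| ^+ 2 - dot x y *+ 2 + `|y| ^+ 2.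
Proof. by rewrite normD_sqr dotNr normrN mulNrn. Qed.

Lemma dot_ext x y : (forall z, dot x z = dot y z) -> x = y.
Proof.
move=> xy; apply/eqP; rewrite -subr_eq0 -normr_eq0 -sqrf_eq0 -dot_norm.
by rewrite dotBl xy subrr.
Qed.

Lemma dot_cvg {T : Type} {F : set_system T} {FF : Filter F} (g : T -> K) (l x : K) :
  g t @[t --> F] --> l -> dot (g t) x @[t --> F] --> dot l x.
Proof.
move=> gl; apply/cvgrPdist_le => e e0; near=> t.
rewrite -dotBl (le_trans (dot_le _ _))//.
have x0 : 0 < `|x| + 1 by rewrite ltr_wpDl.
apply: (@le_trans _ _ (e / (`|x| + 1) * (`|x| + 1))); last by rewrite divfK// gt_eqF.
apply: ler_pM => //; last by rewrite lerDl.
by near: t; move/cvgrPdist_le : gl; apply; rewrite divr_gt0.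
Unshelve. all: by end_near. Qed.

Lemma dot_continuous x : continuous (fun y => dot y x).
Proof. by move=> y; exact: (@dot_cvg _ _ _ id). Qed.

(** Minimizing [x |-> |x|^2 - 2 phi x] over a subspace: by the parallelogram
    identity a minimizing sequence is Cauchy, and its limit represents [phi]
    on the subspace. *)
Lemma subspace_riesz (S : set K) (phi : K -> R) (M : R) : S 0 ->
  (forall a x y, S x -> S y -> S (a *: x + y)) ->
  (forall a x y, phi (a *: x + y) = a * phi x + phi y) ->
  (forall x, `|phi x| <= M * `|x|) ->
  exists v (s : nat -> K), [/\ forall n, S (s n), s n @[n --> \oo] --> v &
    forall z, S z -> dot v z = phi z].
Proof.
move=> S0 SD phiD phiM.
have phi0 : phi 0 = 0.
  by have := phiD 0 0 0; rewrite scale0r add0r mul0r add0r => e; have := phiM 0; rewrite normr0 mulr0 normr_le0 => /eqP.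
pose F x : R := `|x| ^+ 2 - 2 * phi x.
have F_ge x : - M ^+ 2 <= F x.
  have := phiM x; rewrite ler_norml /F => /andP[_ h]; have := sqr_ge0 (`|x| - M); nra.
pose A := [set F x | x in S].
have hA : has_inf A.
  split; first by exists (F 0), 0.
  by exists (- M ^+ 2) => _ [x _ <-].
pose m := inf A.
have mF x : S x -> m <= F x by move=> Sx; apply: ge_inf; [exact: hA.2|exists x].
have ex n : exists x, S x /\ F x < m + n.+1%:R^-1.
  have [_ [x Sx <-] h] := @inf_adherent _ A n.+1%:R^-1 (ltac:(by rewrite invr_gt0 ltr0Sn)) hA.
  by exists x.
pose s n := projT1 (cid (ex n)).
have sP n : S (s n) /\ F (s n) < m + n.+1%:R^-1 by exact: projT2 (cid (ex n)).
have Shalf x y : S x -> S y -> S (2^-1 *: (x + y)).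
  move=> Sx Sy; rewrite scalerDr; apply: (SD) => //.
  by rewrite -[_ *: y]addr0; apply: (SD).
have par x y : F (2^-1 *: (x + y)) = (F x + F y) / 2 - `|x - y| ^+ 2 / 4.
  rewrite /F (_ : phi (2^-1 *: (x + y)) = 2^-1 * (phi x + phi y)); last first.
    have := phiD 1 x y; rewrite scale1r mul1r => <-.
    by have := phiD 2^-1 (x + y) 0; rewrite addr0 phi0 addr0.
  rewrite normrZ ger0_norm ?invr_ge0// exprMn (normD_sqr x y) (normB_sqr x y).
  by field.
have near_s n k : `|s n - s k| ^+ 2 <= 2 * (n.+1%:R^-1 + k.+1%:R^-1).
  have [Sn Fn] := sP n; have [Sk Fk] := sP k.
  have := mF _ (Shalf _ _ Sn Sk); rewrite par; move: Fn Fk; move: (n.+1%:R^-1 : R) (k.+1%:R^-1 : R) => a b; lra.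
have cs : cvgn s.
  apply: cauchy_cvg; apply/cauchy_ballP => e e0.
  pose N := Num.bound (4 / e ^+ 2).
  have Ne n : (N <= n)%N -> 4 * n.+1%:R^-1 < e ^+ 2.
    move=> Nn; rewrite ltr_pdivrMr ?ltr0Sn// mulrC -ltr_pdivrMr ?exprn_gt0//.
    apply: (lt_le_trans (archi_boundP _)); first by rewrite divr_ge0 ?sqr_ge0.
    by rewrite ler_nat (leq_trans Nn).
  exists (s @` [set n | (N <= n)%N], s @` [set n | (N <= n)%N]).
    by split; exists N => // n Nn; exists n.
  move=> [_ _] [/= [a /Ne na <-] [b /Ne nb <-]]; rewrite -ball_normE /=.
  rewrite -(@ltr_pXn2r _ 2)// ?nnegrE ?(ltW e0)//.
  apply: (le_lt_trans (near_s a b)); move: na nb.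
  by move: (a.+1%:R^-1 : R) (b.+1%:R^-1 : R) => a' b'; lra.
exists (limn s), s; split => //; first by move=> n; case: (sP n).
have {cs}sv : s n @[n --> \oo] --> limn s by [].
set v := limn s in sv *.
move=> z Sz.
(* perturbing [s n] along [z] and letting [n] go to infinity *)
have key (t : R) : 0 <= t ^+ 2 * `|z| ^+ 2 + 2 * t * (dot v z - phi z).
  have hn n : 0 <= n.+1%:R^-1 + (t ^+ 2 * `|z| ^+ 2 + 2 * t * (dot (s n) z - phi z)).
    have [Sn Fn] := sP n; have := mF _ (SD t z (s n) Sz Sn).
    rewrite /F phiD normD_sqr normrZ exprMn real_normK ?num_real// dotZl (dotC z).
    move: Fn; rewrite /F; move: (n.+1%:R^-1 : R) => a; lra.
  have lim : (n.+1%:R^-1 + (t ^+ 2 * `|z| ^+ 2 + 2 * t * (dot (s n) z - phi z))) @[n --> \oo]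
      --> 0 + (t ^+ 2 * `|z| ^+ 2 + 2 * t * (dot v z - phi z)).
    apply: cvgD; first exact: cvg_harmonic.
    apply: cvgD; first exact: cvg_cst.
    apply: cvgM; first exact: cvg_cst.
    apply: cvgB; last exact: cvg_cst.
    exact: dot_cvg.
  rewrite add0r in lim; rewrite -(cvg_lim _ lim)//; apply: limr_ge.
    by apply/cvg_ex; eexists; exact: lim.
  exact: nearW.
(* at [t = - D / c] the right-hand side is at most [- (D ^+ 2 / c)] *)
pose D := dot v z - phi z.
apply/eqP; rewrite -subr_eq0 -/D; apply/eqP.
pose c := `|z| ^+ 2 + 1; have c0 : 0 < c by rewrite ltr_wpDl// sqr_ge0.
have := key (- D / c); rewrite -/D => h.
have : (- D / c) ^+ 2 * `|z| ^+ 2 + 2 * (- D / c) * D <= - (D ^+ 2 / c).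
  rewrite -subr_ge0 [X in 0 <= X](_ : _ = D ^+ 2 / c ^+ 2); last first.
    by rewrite /c; field; rewrite gt_eqF.
  by rewrite divr_ge0 ?sqr_ge0.
move=> /(le_trans h); rewrite oppr_ge0 => h2.
have : D ^+ 2 <= 0 by rewrite -[D ^+ 2](divfK (lt0r_neq0 c0)) mulr_le0_ge0// ltW.
by rewrite real_exprn_even_le0 ?num_real//= => /eqP.
Qed.

Lemma riesz (phi : K -> R) (M : R) :
  (forall a x y, phi (a *: x + y) = a * phi x + phi y) ->
  (forall x, `|phi x| <= M * `|x|) -> exists v, forall z, dot v z = phi z.
Proof.
move=> phiD phiM; have [|v [s [_ _ h]]] := @subspace_riesz setT phi M I _ phiD phiM.
  by [].
by exists v => z; exact: h.
Qed.

End hilbert.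

(** * Orthonormal expansions and Hilbert-Schmidt norms *)

Section orthonormal_basis.
Context {R : realType} {H : sepHilbertType R}.
Local Notation e := (onb H).

Let pr (x : H) n := \sum_(i < n) dot x (e i) *: e i.

Lemma dot_span (n : nat) (c : nat -> R) j : (j < n)%N ->
  dot (\sum_(i < n) c i *: e i) (e j) = c j * `|e j| ^+ 2.
Proof.
have [oe _ _] := onbP H; move=> jn.
rewrite dot_suml (bigD1 (Ordinal jn))//= big1 ?addr0 ?dotZl ?dot_norm//.
by move=> i ij; rewrite dotZl oe ?mulr0.
Qed.

Lemma dot_onb_norm (x : H) j : dot x (e j) * `|e j| ^+ 2 = dot x (e j).
Proof.
have [_ ue _] := onbP H; case: (ue j) => ->; first by rewrite dot0r mul0r.
by rewrite expr1n mulr1.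
Qed.

Lemma residual_ortho (x : H) n (c : nat -> R) :
  dot (x - pr x n) (\sum_(i < n) c i *: e i) = 0.
Proof.
rewrite dotC dot_suml big1// => i _; rewrite dotZl dotC dotBl.
by rewrite (dot_span (fun j => dot x (e j)))// dot_onb_norm subrr mulr0.
Qed.

Lemma pythagoras_onb (x : H) n :
  `|x| ^+ 2 = \sum_(i < n) (dot x (e i)) ^+ 2 + `|x - pr x n| ^+ 2.
Proof.
have := normD_sqr (x - pr x n) (pr x n).
rewrite subrK (residual_ortho x n (fun i => dot x (e i))) mul0rn addr0 addrC => ->.
congr (_ + _); rewrite -(dot_norm (pr x n)) {1}/pr dot_suml; apply: eq_bigr => i _.
rewrite dotZl [dot (e i) (pr _ _)]dotC -[pr x n]/(\sum_(i < n) (fun j => dot x (e j)) i *: e i).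
by rewrite dot_span// dot_onb_norm expr2.
Qed.

(** The partial sums of the expansion are the best approximations in the span of
    the first [n] vectors, and the spans are dense. *)
Lemma onb_approx (x : H) (eps : R) : 0 < eps ->
  exists N : nat, forall n, (N <= n)%N -> `|x - pr x n| < eps.
Proof.
move=> eps0; have [_ _ de] := onbP H.
have [||y [xy [N [c yE]]]] := de (ball x eps).
- by exists x; exact: ballxx.
- exact: ball_open.
exists N => n Nn.
rewrite -ball_normE /= in xy; apply: le_lt_trans xy.
pose c' i := if (i < N)%N then c i else 0.
have -> : y = \sum_(i < n) c' i *: e i.
  rewrite yE (big_ord_widen n (fun i => c i *: e i) Nn) big_mkcond/=.
  by apply: eq_bigr => i _; rewrite /c'; case: ifP => // _; rewrite scale0r.
rewrite -(@ler_pXn2r _ 2)// ?nnegrE//.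
set y' := \sum_(i < n) _.
have := normD_sqr (x - pr x n) (pr x n - y').
rewrite addrA subrK dotBr (residual_ortho x n (fun i => dot x (e i))) residual_ortho.
by rewrite subrr mul0rn addr0 => ->; rewrite lerDl sqr_ge0.
Qed.

Lemma parseval (x : H) : (\sum_(0 <= i <oo) ((dot x (e i)) ^+ 2)%:E = (`|x| ^+ 2)%:E)%E.
Proof.
apply/cvg_lim => //; apply: cvg_EFin; first by apply: nearW => n; rewrite sumEFin.
apply/cvgrPdist_le => eps eps0.
have [N hN] := onb_approx x (ltac:(by rewrite sqrtr_gt0) : 0 < Num.sqrt eps).
exists N => // n /= /hN xn; rewrite sumEFin/= big_mkord (pythagoras_onb x n) addrC addKr.
rewrite ger0_norm ?sqr_ge0// -[leRHS](sqr_sqrtr (ltW eps0)).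
by rewrite lerXn2r ?nnegrE ?sqrtr_ge0// ltW.
Qed.

Lemma hs_sqnormE (T : hs_op H) : (`|T| ^+ 2)%:E = hs_sqnorm T.
Proof.
rewrite -[`|T|]/(hs_norm T) /hs_norm sqr_sqrtr -?hs_sqnorm_fin//.
by rewrite fine_ge0// hs_sqnorm_ge0.
Qed.

Lemma hs_sqnorm_entries (T : hs_op H) :
  ((`|T| ^+ 2)%:E = \sum_(0 <= i <oo) \sum_(0 <= j <oo) ((dot (T (e i)) (e j)) ^+ 2)%:E)%E.
Proof.
by rewrite hs_sqnormE /hs_sqnorm; apply: eq_eseriesr => i _; rewrite parseval.
Qed.

(** At a basis vector [b] the difference of the two operators is
    [dot (x - y) b *: x + dot y b *: (x - y)]; Bessel's inequality bounds the sum
    over the basis of the squares of each term. *)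
Lemma tensor_sqB_norm (x y : H) :
  `|tensor_sq x - tensor_sq y| ^+ 2 <= 2 * `|x - y| ^+ 2 * (`|x| ^+ 2 + `|y| ^+ 2).
Proof.
rewrite -lee_fin hs_sqnormE /hs_sqnorm; apply: lime_le.
  by apply: is_cvg_nneseries => i _ _; rewrite lee_fin sqr_ge0.
apply: nearW => n; rewrite sumEFin lee_fin big_mkord.
apply: (@le_trans _ _ (\sum_(i < n) (2 * `|x| ^+ 2 * dot (x - y) (e i) ^+ 2 +
    2 * `|x - y| ^+ 2 * dot y (e i) ^+ 2))).
  apply: ler_sum => i _.
  have -> : (tensor_sq x - tensor_sq y : hs_op H) (e i) =
      dot (x - y) (e i) *: x + dot y (e i) *: (x - y).
    rewrite -[LHS]/(dot x (e i) *: x - dot y (e i) *: y) dotBl scalerBl scalerBr.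
    by rewrite addrA subrK.
  have -> : 2 * `|x| ^+ 2 * dot (x - y) (e i) ^+ 2 + 2 * `|x - y| ^+ 2 * dot y (e i) ^+ 2 =
      2 * (`|dot (x - y) (e i) *: x| ^+ 2 + `|dot y (e i) *: (x - y)| ^+ 2).
    by rewrite !normrZ !exprMn !real_normK ?num_real//; ring.
  set a := _ *: x; set b := _ *: (x - y).
  have := ler_normD a b; have := normr_ge0 a; have := normr_ge0 b.
  have := normr_ge0 (a + b) => h1 h2 h3 h4; have := sqr_ge0 (`|a| - `|b|); nra.
rewrite big_split/= -!mulr_sumr mulrDr lerD//.
  by rewrite mulrAC ler_wpM2r ?sqr_ge0// ler_wpM2l//; exact: bessel.
by rewrite ler_wpM2l ?mulr_ge0 ?sqr_ge0//; exact: bessel.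
Qed.

Lemma tensor_sq_norm (x : H) : `|tensor_sq x| <= `|x| ^+ 2.
Proof.
rewrite -(@ler_pXn2r _ 2)// ?nnegrE ?sqr_ge0// -lee_fin hs_sqnormE /hs_sqnorm.
apply: lime_le; first by apply: is_cvg_nneseries => i _ _; rewrite lee_fin sqr_ge0.
apply: nearW => n; rewrite sumEFin lee_fin big_mkord.
rewrite (eq_bigr (fun i : 'I_n => dot x (e i) ^+ 2 * `|x| ^+ 2)).
  by rewrite -mulr_suml expr2 ler_wpM2r ?sqr_ge0//; exact: bessel.
by move=> i _; rewrite -[tensor_sq x _]/(dot x (e i) *: x) normrZ exprMn real_normK ?num_real.
Qed.

Lemma tensor_sq_continuous : continuous (@tensor_sq R H).
Proof.
move=> x; apply/cvgrPdist_le => eps eps0.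
pose B := 2 * (`|x| ^+ 2 + (`|x| + 1) ^+ 2) + 1.
have B0 : 0 < B by rewrite ltr_wpDl// mulr_ge0// addr_ge0// sqr_ge0.
near=> t.
have xt1 : `|x - t| <= 1 by near: t; exact: (@cvgr_dist_le _ _ _ _ _ id x).
have xt2 : `|x - t| <= eps / B.
  by near: t; apply: (@cvgr_dist_le _ _ _ _ _ id x) => //; rewrite divr_gt0.
have tx : `|t| <= `|x| + 1.
  rewrite -(subrK x t) (le_trans (ler_normD _ _))// addrC lerD2l distrC//.
rewrite -(@ler_pXn2r _ 2)// ?nnegrE ?(ltW eps0)//.
apply: (le_trans (tensor_sqB_norm _ _)).
apply: (@le_trans _ _ ((eps / B) ^+ 2 * B ^+ 2)); last by rewrite -exprMn divfK// gt_eqF.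
rewrite mulrAC mulrC; apply: ler_pM; rewrite ?sqr_ge0 ?mulr_ge0 ?addr_ge0 ?sqr_ge0//.
  by rewrite lerXn2r ?nnegrE// ltW// divr_gt0.
have tx2 : `|t| ^+ 2 <= (`|x| + 1) ^+ 2 by rewrite lerXn2r ?nnegrE// addr_ge0.
have B1 : 1 <= B by rewrite /B lerDr mulr_ge0// addr_ge0// sqr_ge0.
apply: (@le_trans _ _ B); last by rewrite expr2 ler_peMr// ltW.
by rewrite /B; lra.
Unshelve. all: by end_near. Qed.

End orthonormal_basis.

(** * Measurability and weak moments *)

Section borel_measurability.
Context {R : realType}.

Lemma continuous_borel {U : normedModType R} (g : U -> R) :
  continuous g -> measurable_fun setT (g : borel U -> R).
Proof.
move=> cg; apply: (measurability _ (RGenOInfty.measurableE R)) => _ [_ [x ->] <-].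
rewrite setTI; apply: sub_sigma_algebra.
by move/continuousP: cg; apply; exact: interval_open.
Qed.

Lemma measurable_dot {K : hilbertType R} (u : K) :
  measurable_fun setT (fun x : borel K => dot (x : K) u).
Proof. by apply: continuous_borel; exact: dot_continuous. Qed.

(** The vectors [u] for which [dot (Phi x) u] is measurable in [x] form a subspace
    that is closed under limits and contains the kernel sections. Representing
    [dot u] on this subspace by one of its limits [v] gives a [v] that has the same
    products as [u] with all kernel sections, hence equals [u]. *)
Lemma rkhs_measurable {H : sepHilbertType R} {Hk : hilbertType R}
    (k : H -> H -> R) (ev : Hk -> H -> R) (Phi : H -> Hk) (u : Hk) :
  measurable_fun setT (fun z : borel H * borel H => k z.1 z.2) ->
  is_rkhs k ev Phi ->
  measurable_fun setT (fun x : borel H => dot (Phi x) u).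
Proof.
move=> mk [_ ev_inj evPhi repr].
pose S := [set u : Hk | measurable_fun setT (fun x : borel H => dot (Phi x) u)].
have [||||v [s [Ss sv vu]]] := @subspace_riesz R Hk S (fun z => dot u z) `|u|.
- by rewrite /S /=; under eq_fun do rewrite dot0r; exact: measurable_cst.
- move=> a x y Sx Sy; rewrite /S /=; under eq_fun do rewrite dotDr dotZr.
  by apply: measurable_funD => //; exact: measurable_funM.
- by move=> a x y; rewrite dotDr dotZr.
- by move=> x; exact: dot_le.
have SPhi y : S (Phi y).
  rewrite /S /=; under eq_fun do rewrite repr evPhi.
  exact: (measurableT_comp mk (pair1_measurable (y : borel H))).
have <- : v = u.
  apply: ev_inj; apply/funext => y; rewrite -!repr; exact: vu.
apply: (@measurable_fun_cvg _ (borel H) R setT (fun n x => dot (Phi x) (s n))) => //.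
by move=> x _; under eq_fun do rewrite dotC; rewrite (dotC (Phi x)); exact: dot_cvg.
Qed.

End borel_measurability.

Section weak_moments.
Context {R : realType} {d : measure_display} {T : measurableType d}.
Variable P : probability T R.
Context {K : hilbertType R}.
Implicit Types X : T -> K.

Lemma hilbert_meanE X m : is_hilbert_mean P X m -> hilbert_mean P X = m.
Proof.
move=> Xm; have : is_hilbert_mean P X (hilbert_mean P X) by apply: getPex; exists m.
by move=> Xm'; apply: dot_ext => z; rewrite (Xm' z).2 (Xm z).2.
Qed.

Lemma rintegrable_dot X (b : T -> R) (u : K) :
  measurable_fun setT (fun w => dot (X w) u) -> (forall w, `|X w| <= b w) ->
  P.-integrable setT (fun w => (b w)%:E) -> P.-integrable setT (fun w => (dot (X w) u)%:E).
Proof.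
move=> mX Xb ib; apply: (rintegrable_le (g := fun w => `|u| * b w)) => //.
  by move=> w; rewrite (le_trans (dot_le _ _))// mulrC ler_wpM2l.
exact: rintegrableZ.
Qed.

(** The weak integral is a bounded linear functional, hence a vector. *)
Lemma weak_mean_exists X (b : T -> R) :
  (forall u, measurable_fun setT (fun w => dot (X w) u)) -> (forall w, `|X w| <= b w) ->
  P.-integrable setT (fun w => (b w)%:E) -> is_hilbert_mean P X (hilbert_mean P X).
Proof.
move=> mX Xb ib; apply: getPex.
have iX u := rintegrable_dot (mX u) Xb ib.
have [||m mE] := @riesz R K (fun u => \int[P]_w dot (X w) u) (\int[P]_w b w).
- move=> a x y; under eq_Rintegral do rewrite dotDr dotZr.
  rewrite (RintegralD measurableT (rintegrableZ a (iX x)) (iX y)).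
  by rewrite (RintegralZl a measurableT (iX x)).
- move=> u; apply: (le_trans (le_normr_Rintegral measurableT (iX u))).
  rewrite mulrC -RintegralZl//; apply: le_Rintegral => //.
  + exact: (integrable_norm (iX u)).
  + exact: rintegrableZ.
  + by move=> w _; rewrite (le_trans (dot_le _ _))// mulrC ler_wpM2l.
by exists m => u; split.
Qed.

(** With one argument fixed, the covariance form is a bounded linear functional of
    the other, hence represented by a vector. *)
Lemma hilbert_cov_diag X (m h : K) (b : T -> R) :
  (forall u, measurable_fun setT (fun w => dot (X w) u)) ->
  is_hilbert_mean P X m -> (forall w, `|X w - m| <= b w) ->
  P.-integrable setT (fun w => (b w ^+ 2)%:E) ->
  dot (hilbert_cov P X h) h = \int[P]_w (dot (X w - m) h ^+ 2).
Proof.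
move=> mX Xm Xb ib; have mE := hilbert_meanE Xm.
suff /(_ h h)[_ ->] : is_hilbert_cov P X (hilbert_cov P X).
  by rewrite mE; under eq_Rintegral do rewrite -expr2.
apply: getPex; rewrite /is_hilbert_cov mE.
have mZ u : measurable_fun setT (fun w => dot (X w - m) u).
  by under eq_fun do rewrite dotBl; exact: measurable_funB.
have bnd u v w : `|dot (X w - m) u * dot (X w - m) v| <= `|u| * `|v| * b w ^+ 2.
  have b0 : 0 <= b w by exact: le_trans (Xb w).
  have Zb u' : `|dot (X w - m) u'| <= b w * `|u'|.
    by rewrite (le_trans (dot_le _ _))// ler_wpM2r.
  rewrite normrM (le_trans (ler_pM _ _ (Zb u) (Zb v)))//.
  by rewrite le_eqVlt; apply/orP; left; apply/eqP; ring.
have iZ u v : P.-integrable setT (fun w => (dot (X w - m) u * dot (X w - m) v)%:E).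
  apply: (rintegrable_le (g := fun w => `|u| * `|v| * b w ^+ 2)) => //.
    exact: measurable_funM.
  exact: rintegrableZ.
have ex u : exists v, forall z, dot v z = \int[P]_w (dot (X w - m) u * dot (X w - m) z).
  apply: (@riesz _ _ _ (`|u| * \int[P]_w (b w ^+ 2))).
  - move=> a x y; under eq_Rintegral do rewrite dotDr dotZr mulrDr mulrCA.
    rewrite (RintegralD measurableT (rintegrableZ a (iZ u x)) (iZ u y)).
    by rewrite (RintegralZl a measurableT (iZ u x)).
  - move=> v; apply: (le_trans (le_normr_Rintegral measurableT (iZ u v))).
    rewrite mulrAC -RintegralZl//; apply: le_Rintegral => //.
    + exact: (integrable_norm (iZ u v)).
    + exact: rintegrableZ.
exists (fun u => projT1 (cid (ex u))) => u v; split; first exact: iZ.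
exact: (projT2 (cid (ex u))).
Qed.

End weak_moments.

(** * Second moments of sums of vectors *)

Lemma measurable_sqrt {d} {T : measurableType d} {R : realType} (f : T -> R) :
  measurable_fun setT f -> measurable_fun setT (fun x => Num.sqrt (f x)).
Proof.
by apply: measurableT_comp; apply: continuous_measurable_fun; exact: sqrt_continuous.
Qed.

Section second_moments.
Context {R : realType} {d d' : measure_display}.
Context {T : measurableType d} {E : measurableType d'}.
Variables (P : probability T R) (Q : probability E R) (Y : nat -> T -> E).
Hypothesis iidY : iid_with_law P Y Q.

Lemma iid_measurable i : measurable_fun setT (Y i).
Proof. by case: iidY. Qed.

Let morph_sum {V : zmodType} (l : V -> R) (F : nat -> V) n : {morph l : u v / u + v} ->
  l (\sum_(i < n) F i) = \sum_(i < n) l (F i).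
Proof.
move=> lD; apply: big_morph => //.
by have := lD 0 0; rewrite addr0 => e; apply: (addrI (l 0)); rewrite -e addr0.
Qed.

(** The second moment of a sum is the sum of the second moments, for a general
    nonnegative functional [q] in the place of the squared norm: the property is
    elementary for the square of one coordinate and is stable under countable
    sums, hence reaches squared norms that are sums of squared coordinates. *)
Definition additive_second_moment {V : zmodType} (Z : E -> V) (q : V -> \bar R) :=
  [/\ forall v, (0 <= q v)%E,
      measurable_fun setT (fun y => q (Z y)),
      forall n, measurable_fun setT (fun w => q (\sum_(i < n) Z (Y i w))%R) &
      forall n, (\int[P]_w q (\sum_(i < n) Z (Y i w))%R = n%:R%:E * \int[Q]_y q (Z y))%E].

Lemma additive_second_moment_sqr {V : zmodType} (Z : E -> V) (l : V -> R) :
  {morph l : u v / u + v} -> measurable_fun setT (fun y => l (Z y)) ->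
  Q.-integrable setT (fun y => (l (Z y) ^+ 2)%:E) ->
  \int[Q]_y l (Z y) = 0 ->
  additive_second_moment Z (fun v => (l v ^+ 2)%:E).
Proof.
move=> lD ml il l0.
have sE n w : l (\sum_(i < n) Z (Y i w)) = \sum_(i < n) l (Z (Y i w)).
  exact: (morph_sum (fun i => Z (Y i w))).
have mS n : measurable_fun setT (fun w => (l (\sum_(i < n) Z (Y i w)) ^+ 2)%:E).
  apply/measurable_EFinP; apply: measurable_funX; under eq_fun do rewrite sE.
  by apply: measurable_sum => i; exact: (measurableT_comp ml (iid_measurable i)).
split => //.
- by move=> v; rewrite lee_fin sqr_ge0.
- by apply/measurable_EFinP; apply: measurable_funX.
move=> n; have [iS SE] := iid_sum_second_moment iidY n ml il l0.
under eq_integral do rewrite sE.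
by rewrite -EFin_Rintegral// SE EFinM EFin_Rintegral.
Qed.

Lemma additive_second_moment_series {V : zmodType} (Z : E -> V) (q : nat -> V -> \bar R) :
  (forall i, additive_second_moment Z (q i)) ->
  additive_second_moment Z (fun v => \sum_(0 <= i <oo) q i v)%E.
Proof.
move=> hq; have q0 i v : (0 <= q i v)%E by case: (hq i).
have mQ i : measurable_fun setT (fun y => q i (Z y)) by case: (hq i).
have mP i n : measurable_fun setT (fun w => q i (\sum_(i < n) Z (Y i w))%R) by case: (hq i).
split.
- by move=> v; apply: nneseries_ge0.
- by apply: ge0_emeasurable_sum => // i x _ _; exact: q0.
- by move=> n; apply: (ge0_emeasurable_sum (h := fun i w => q i (\sum_(i < n) Z (Y i w))%R)).
move=> n; rewrite integral_nneseries// integral_nneseries//.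
rewrite -nneseriesZl; last by move=> i _; apply: integral_ge0.
by apply: eq_eseriesr => i _; case: (hq i).
Qed.

Lemma additive_second_momentD {V : zmodType} (Z : E -> V) (q q' : V -> \bar R) :
  additive_second_moment Z q -> additive_second_moment Z q' ->
  additive_second_moment Z (fun v => q v + q' v)%E.
Proof.
move=> [q0 mQ mP qE] [q0' mQ' mP' qE']; split.
- by move=> v; rewrite adde_ge0.
- exact: emeasurable_funD.
- by move=> n; exact: emeasurable_funD.
move=> n; rewrite ge0_integralD// ge0_integralD// qE qE'.
have I0 : (0 <= \int[Q]_y q (Z y))%E by exact: integral_ge0.
have I0' : (0 <= \int[Q]_y q' (Z y))%E by exact: integral_ge0.
by rewrite (ge0_muleDr _ I0 I0').
Qed.

(** A variable whose sums have second moments growing linearly is centered: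
    a mean [a] would contribute [n ^+ 2 * a ^+ 2] to the second moment. *)
Lemma additive_second_moment_mean0 {V : zmodType} (Z : E -> V) (q : V -> \bar R)
    (l : V -> R) (C : R) :
  additive_second_moment Z q -> (\int[Q]_y q (Z y) < +oo)%E ->
  {morph l : u v / u + v} -> measurable_fun setT (fun y => l (Z y)) -> 0 <= C ->
  (forall v, (l v ^+ 2)%:E <= C%:E * q v)%E ->
  Q.-integrable setT (fun y => (l (Z y) ^+ 2)%:E) /\ \int[Q]_y l (Z y) = 0.
Proof.
move=> [q0 mQ mP qE] qfin lD ml C0 lq.
have il : Q.-integrable setT (fun y => (l (Z y) ^+ 2)%:E).
  apply: rintegrable_ge0; [exact: measurable_funX|by move=> y; exact: sqr_ge0|].
  apply: (@le_lt_trans _ _ (C%:E * \int[Q]_y q (Z y))%E).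
    rewrite -ge0_integralZl//; apply: ge0_le_integral => //.
    + by move=> y _; rewrite lee_fin sqr_ge0.
    + by apply/measurable_EFinP; exact: measurable_funX.
    + exact: measurable_funeM.
  by rewrite lte_mul_pinfty.
split => //; have il1 := rintegrable_sqr_id ml il.
set a := \int[Q]_y l (Z y); pose c := fine (\int[Q]_y q (Z y))%E.
have cE : (\int[Q]_y q (Z y))%E = c%:E.
  by rewrite fineK// ge0_fin_numE//; apply: integral_ge0.
have bound n : n%:R ^+ 2 * a ^+ 2 <= n%:R * (C * c).
  pose L w := l (\sum_(i < n) Z (Y i w)).
  have LE w : L w = \sum_(i < n) l (Z (Y i w)).
    exact: (morph_sum (fun i => Z (Y i w))).
  have iYi i : P.-integrable setT (fun w => (l (Z (Y i w)))%:E).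
    exact: (integrable_iid iidY i (f := fun y => l (Z y))).
  have iL : P.-integrable setT (fun w => (L w)%:E).
    by under eq_fun do rewrite LE; apply: rintegrable_sum => i; exact: iYi.
  have intL : \int[P]_w L w = n%:R * a.
    under eq_Rintegral do rewrite LE.
    rewrite Rintegral_sum; last by move=> i; exact: iYi.
    transitivity (\sum_(i < n) a); last by rewrite sumr_const card_ord mulr_natl.
    apply: eq_bigr => i _; congr fine.
    by rewrite (integral_iid iidY i (f := fun y => (l (Z y))%:E))//; exact/measurable_EFinP.
  have mL := rintegrable_meas iL.
  have L2 : (\int[P]_w (L w ^+ 2)%:E <= (n%:R * (C * c))%:E)%E.
    have -> : (n%:R * (C * c))%:E = (C%:E * \int[P]_w q (\sum_(i < n) Z (Y i w))%R)%E.
      by rewrite qE cE -!EFinM mulrCA.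
    rewrite -ge0_integralZl//; apply: ge0_le_integral => //.
    + by move=> y _; rewrite lee_fin sqr_ge0.
    + by apply/measurable_EFinP; exact: measurable_funX.
    + exact: measurable_funeM.
    + by move=> w _; exact: lq.
  have iL2 : P.-integrable setT (fun w => (L w ^+ 2)%:E).
    apply: rintegrable_ge0; [exact: measurable_funX|by move=> y; exact: sqr_ge0|].
    by apply: le_lt_trans L2 _; exact: ltry.
  have {}L2 : \int[P]_w (L w ^+ 2) <= n%:R * (C * c).
    by rewrite -lee_fin EFin_Rintegral.
  (* Jensen's inequality for the square: integrate [2 * t * L <= L ^+ 2 + t ^+ 2]
     with [t] the mean of [L] *)
  have : \int[P]_w (2 * (n%:R * a) * L w) <= \int[P]_w (L w ^+ 2 + (n%:R * a) ^+ 2).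
    apply: le_Rintegral => //.
    + exact: rintegrableZ.
    + by apply: rintegrableD => //; exact: rintegrable_cst.
    + by move=> w _; have := sqr_ge0 (L w - n%:R * a); move: (n%:R * a) (L w) => x y; nra.
  rewrite (RintegralZl _ measurableT iL) intL.
  rewrite (RintegralD measurableT iL2 (rintegrable_cst _ _)) Rintegral_probability_cst.
  by rewrite -exprMn; move: (n%:R * a) L2 => x; move: (\int[P]_w _) (_ * _) => *; nra.
apply/eqP/negPn/negP => a0.
have a2 : 0 < a ^+ 2 by rewrite exprn_even_gt0.
have c0 : 0 <= c by rewrite fine_ge0//; apply: integral_ge0.
pose n := Num.bound (C * c / a ^+ 2).
have Cc0 : 0 <= C * c / a ^+ 2 by apply: divr_ge0; [exact: mulr_ge0|exact: ltW].
have nb : C * c / a ^+ 2 < n%:R by exact: archi_boundP.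
have n0 : 0 < n%:R :> R by exact: le_lt_trans nb.
have := bound n; rewrite expr2 -mulrA ler_pM2l// leNgt -ltr_pdivrMr//.
by rewrite nb.
Qed.

(** Distinct terms are independent and centered, hence uncorrelated; working
    with the kernel [dot (F x) (F y)] spares any separability of [K]. *)
Lemma feature_sum_second_moment {K : hilbertType R} (F : E -> K) n :
  measurable_fun setT (fun z : E * E => dot (F z.1) (F z.2)) ->
  Q.-integrable setT (fun y => (`|F y| ^+ 2)%:E) ->
  (forall u, Q.-integrable setT (fun y => (dot (F y) u)%:E) /\ \int[Q]_y dot (F y) u = 0) ->
  P.-integrable setT (fun w => (`|\sum_(i < n) F (Y i w)| ^+ 2)%:E) /\
  \int[P]_w (`|\sum_(i < n) F (Y i w)| ^+ 2) = n%:R * \int[Q]_y (`|F y| ^+ 2).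
Proof.
move=> mF iF2 F0; pose kap (z : E * E) := dot (F z.1) (F z.2).
have mdiag : measurable_fun setT (fun y => (y, y) : E * E).
  exact: measurable_fun_pair.
have mnF : measurable_fun setT (fun y => `|F y|).
  rewrite (_ : (fun _ => _) = (fun y => Num.sqrt (kap (y, y)))).
    by apply: measurable_sqrt; exact: (measurableT_comp mF mdiag).
  by apply/funext => y; rewrite /kap /= dot_norm sqrtr_sqr normr_id.
have iF := rintegrable_sqr_id mnF iF2.
have [||||iS SE] := @iid_kernel_sum _ _ _ _ _ _ _ _ iidY kap n.
- exact: mF.
- apply: (@le_lt_trans _ _ (\int[Q]_x (\int[Q]_y `|F y| * `|F x|)%:E)%E).
    apply: le_integral_total => x.
    rewrite mulrC -RintegralZl// EFin_Rintegral; last exact: rintegrableZ.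
    by apply: le_integral_total => y; rewrite lee_fin dot_le.
  by apply: integrable_lty => //; exact: rintegrableZ.
- rewrite integral0_eq// => x _; have [ix x0] := F0 (F x).
  under eq_integral do rewrite /kap /= dotC.
  by rewrite -EFin_Rintegral// x0.
- by under eq_fun do rewrite /kap /= dot_norm.
have nE w : `|\sum_(i < n) F (Y i w)| ^+ 2 = \sum_(i < n) \sum_(j < n) kap (Y i w, Y j w).
  rewrite -dot_norm dot_suml; apply: eq_bigr => i _; rewrite dotC dot_suml.
  by apply: eq_bigr => j _; rewrite dotC.
split; first by under eq_fun do rewrite nE.
under eq_Rintegral do rewrite nE.
by rewrite SE; congr (_ * _); apply: eq_Rintegral => y _; rewrite /kap /= dot_norm.
Qed.

End second_moments.

(** * Empirical moments *)

Section direct_sum.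
Context {R : realType} {U V : normedModType R}.

Lemma hsum_sqnorm (v : hsum U V) : `|v| ^+ 2 = `|v.1| ^+ 2 + `|v.2| ^+ 2.
Proof. by rewrite -[`|v|]/(hsum_norm v) /hsum_norm sqr_sqrtr// addr_ge0 ?sqr_ge0. Qed.

Lemma hsum_norm_fst (v : hsum U V) : `|v.1| <= `|v|.
Proof. by rewrite -(@ler_pXn2r _ 2)// ?nnegrE// hsum_sqnorm lerDl sqr_ge0. Qed.

Lemma hsum_norm_snd (v : hsum U V) : `|v.2| <= `|v|.
Proof. by rewrite -(@ler_pXn2r _ 2)// ?nnegrE// hsum_sqnorm lerDr sqr_ge0. Qed.

Lemma hsum_norm_le (v : hsum U V) : `|v| <= `|v.1| + `|v.2|.
Proof.
rewrite -(@ler_pXn2r _ 2)// ?nnegrE ?addr_ge0// hsum_sqnorm sqrrD.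
by rewrite -addrA lerD2l lerDr mulrn_wge0// mulr_ge0.
Qed.

End direct_sum.

Section hs_operators.
Context {R : realType} {H : sepHilbertType R}.
Local Notation e := (onb H).
Implicit Types S T : hs_op H.

Lemma hs_addE S T (x : H) : (S + T : hs_op H) x = S x + T x.
Proof. by []. Qed.

Lemma hs_subE S T (x : H) : (S - T : hs_op H) x = S x - T x.
Proof. by []. Qed.

Lemma hs_scaleE (a : R) T (x : H) : (a *: T : hs_op H) x = a *: T x.
Proof. by []. Qed.

Lemma hs_sumE (F : nat -> hs_op H) n (x : H) : (\sum_(i < n) F i : hs_op H) x = \sum_(i < n) F i x.
Proof. exact: (big_morph (fun T : hs_op H => T x) (fun S T => hs_addE S T x) erefl). Qed.

Lemma tensor_sqE (z x : H) : tensor_sq z x = dot z x *: z.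
Proof. by []. Qed.

Lemma norm_onb_le1 i : `|e i| <= 1.
Proof. by have [_ /(_ i) [->|->] _] := onbP H; rewrite ?normr0. Qed.

Lemma hs_norm_onb T i : `|T (e i)| <= `|T|.
Proof.
rewrite -(@ler_pXn2r _ 2)// ?nnegrE// -lee_fin hs_sqnormE /hs_sqnorm.
pose f j := (`|T (e j)| ^+ 2)%:E.
have f0 k : xpredT k -> (0 <= f k)%E by rewrite lee_fin sqr_ge0.
rewrite (nneseriesD1 f0 (isT : xpredT i)) leeDl//.
by apply: nneseries_ge0 => k _ _; rewrite lee_fin sqr_ge0.
Qed.

End hs_operators.

Section centered_moments.
Context {R : realType} {H : sepHilbertType R}.
Local Notation e := (onb H).
Variables (m0 : H) (S0 : hs_op H).

(** The centered empirical moments are, up to a quadratic correction, sample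
    means of these vectors. *)
Definition moment_vector (x : H) : hsum H (hs_op H) := (x - m0, tensor_sq (x - m0) - S0).

Lemma moment_vector_continuous : continuous moment_vector.
Proof.
move=> x; apply/cvgrPdist_le => eps eps0; near=> t.
have -> : moment_vector x - moment_vector t =
    (x - t, tensor_sq (x - m0) - tensor_sq (t - m0)) :> hsum H (hs_op H).
  rewrite /moment_vector -[LHS]/((_, _) : hsum H (hs_op H)); congr pair.
    by rewrite -[LHS]/((x - m0) - (t - m0)) opprB addrA subrK.
  rewrite -[LHS]/((tensor_sq (x - m0) - S0) - (tensor_sq (t - m0) - S0)).
  by rewrite opprB addrA subrK.
apply: (le_trans (hsum_norm_le _)) => /=.
rewrite [leRHS](splitr eps) lerD//.
  near: t; apply: (@cvgr_dist_le _ _ _ _ _ id x) => //; exact: divr_gt0.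
near: t; apply: (@cvgr_dist_le _ _ _ _ _ (fun t => tensor_sq (t - m0)) (tensor_sq (x - m0))).
  apply: (@continuous_comp _ _ _ (fun t => t - m0) (@tensor_sq R H)).
    by apply: cvgB; [exact: cvg_id|exact: cvg_cst].
  exact: tensor_sq_continuous.
exact: divr_gt0.
Unshelve. all: by end_near. Qed.

Context (Q : probability (borel H) R).
Hypothesis Qmean : is_hilbert_mean Q (id : borel H -> H) m0.
Hypothesis Qcov : is_hilbert_cov Q (id : borel H -> H) S0.
Hypothesis Qmoment : (\int[Q]_x (`|moment_vector x| ^+ 2)%:E < +oo)%E.

Let covE h h' : Q.-integrable setT (fun x => (dot ((x : H) - m0) h * dot ((x : H) - m0) h')%:E) /\
  dot (S0 h) h' = \int[Q]_x (dot ((x : H) - m0) h * dot ((x : H) - m0) h').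
Proof. by have := Qcov h h'; rewrite (hilbert_meanE Qmean). Qed.

Lemma measurable_moment_vector (L : hsum H (hs_op H) -> R) : continuous L ->
  measurable_fun setT (fun x : borel H => L (moment_vector x)).
Proof.
move=> cL; apply: continuous_borel => x.
by apply: continuous_comp; [exact: moment_vector_continuous|exact: cL].
Qed.

(** The trace is the second moment of [x - m0], by Parseval's identity. *)
Lemma moment_covariance_operator : covariance_operator S0.
Proof.
split.
- move=> h h'; rewrite (covE h h').2 dotC (covE h' h).2.
  by apply: eq_Rintegral => x _; rewrite mulrC.
- move=> h; rewrite (covE h h).2; apply: Rintegral_ge0 => x _.
  by rewrite -expr2 sqr_ge0.
apply: le_lt_trans Qmoment.
have mdot i : measurable_fun setT (fun x : borel H => dot ((x : H) - m0) (e i)).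
  by under eq_fun do rewrite dotBl; apply: measurable_funB => //; exact: measurable_dot.
rewrite (eq_eseriesr (g := fun i => (\int[Q]_x (dot ((x : H) - m0) (e i) ^+ 2)%:E)%E)); last first.
  move=> i _; have [ii ->] := covE (e i) (e i).
  by rewrite EFin_Rintegral//; apply: eq_integral => x _; rewrite expr2.
rewrite -integral_nneseries//; last 2 first.
- by move=> i; apply/measurable_EFinP; exact: measurable_funX.
- by move=> i x _; rewrite lee_fin sqr_ge0.
apply: le_integral_total => x; rewrite parseval lee_fin.
by rewrite lerXn2r ?nnegrE//; exact: (hsum_norm_fst (moment_vector x)).
Qed.

Context {d : measure_display} {T : measurableType d} (P : probability T R) (Y : nat -> T -> borel H).
Hypothesis iidY : iid_with_law P Y Q.

Let sqr_coord (l : hsum H (hs_op H) -> R) : {morph l : u v / u + v} ->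
  (forall v, `|l v| <= `|v|) ->
  measurable_fun setT (fun x : borel H => l (moment_vector x)) ->
  \int[Q]_x l (moment_vector x) = 0 ->
  additive_second_moment P Q Y moment_vector (fun v => (l v ^+ 2)%:E).
Proof.
move=> lD l1 ml l0; apply: additive_second_moment_sqr => //.
apply: rintegrable_ge0; [exact: measurable_funX|by move=> x; exact: sqr_ge0|].
apply: le_lt_trans Qmoment; apply: le_integral_total => x; rewrite lee_fin.
by rewrite -(@real_normK _ (l _)) ?num_real// lerXn2r ?nnegrE.
Qed.

(** Both components of the norm are sums of squared coordinates, and each
    coordinate is centered. *)
Lemma moment_vector_second_moment :
  additive_second_moment P Q Y moment_vector (fun v => (`|v| ^+ 2)%:E).
Proof.
have -> : (fun v : hsum H (hs_op H) => (`|v| ^+ 2)%:E) = (fun v =>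
    \sum_(0 <= i <oo) ((dot v.1 (e i)) ^+ 2)%:E +
    \sum_(0 <= i <oo) \sum_(0 <= j <oo) ((dot (v.2 (e i)) (e j)) ^+ 2)%:E)%E.
  by apply/funext => v; rewrite hsum_sqnorm EFinD hs_sqnorm_entries parseval.
have mdot i : measurable_fun setT (fun x : borel H => dot ((x : H) - m0) (e i)).
  by under eq_fun do rewrite dotBl; apply: measurable_funB => //; exact: measurable_dot.
apply: additive_second_momentD.
  apply: additive_second_moment_series => i; apply: sqr_coord => //.
  - by move=> u v; rewrite -dotDl.
  - move=> v; rewrite (le_trans (dot_le _ _))// (le_trans _ (hsum_norm_fst v))//.
    by rewrite ler_piMr// norm_onb_le1.
  - have [ii iE] := Qmean (e i).
    under eq_Rintegral do rewrite /= dotBl.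
    rewrite (RintegralB measurableT ii (rintegrable_cst _ _)) -iE.
    by rewrite Rintegral_probability_cst subrr.
apply: additive_second_moment_series => i; apply: additive_second_moment_series => j.
have [ii iE] := covE (e i) (e j).
have lE x : dot ((moment_vector x).2 (e i)) (e j) =
    dot (x - m0) (e i) * dot (x - m0) (e j) - dot (S0 (e i)) (e j).
  rewrite -[LHS]/(dot ((tensor_sq (x - m0) - S0 : hs_op H) (e i)) (e j)).
  by rewrite hs_subE tensor_sqE dotBl dotZl.
apply: (sqr_coord (l := fun v => dot (v.2 (e i)) (e j))).
- by move=> u v; rewrite -dotDl.
- move=> v; rewrite (le_trans (dot_le _ _))// (le_trans _ (hsum_norm_snd v))//.
  by rewrite (le_trans _ (hs_norm_onb v.2 i))// ler_piMr// norm_onb_le1.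
- by under eq_fun do rewrite lE; apply: measurable_funB => //; exact: measurable_funM.
- under eq_Rintegral do rewrite lE.
  rewrite (RintegralB measurableT ii (rintegrable_cst _ _)) -iE.
  by rewrite Rintegral_probability_cst subrr.
Qed.

End centered_moments.

(** * The Frechet expansion at the true moments *)

Section frechet.
Context {R : realType} {U V : normedModType R}.

Lemma differentiable_bounded (F : U -> V) x : differentiable F x ->
  exists2 C : R, 0 <= C & forall v, `|'d F x v| <= C * `|v|.
Proof.
move=> dF; have cD : continuous ('d F x : U -> V) by exact: diff_continuous.
have /linear_boundedP [M [_ hM]] : bounded_near ('d F x) (nbhs (0 : U)).
  exact: continuous_linear_bounded.
by exists (`|M| + 1) => // v; apply: hM; rewrite ltr_pwDr// ler_norm.
Qed.

Lemma differentiable_remainder (F : U -> V) x (eps : R) : differentiable F x -> 0 < eps ->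
  exists2 rho : R, 0 < rho &
    forall v, `|v| <= rho -> `|F (x + v) - F x - 'd F x v| <= eps * `|v|.
Proof.
move=> dF eps0; have := diff_locally dF => /eqaddoP /(_ eps eps0).
move=> /nbhs_ballP [rho /= rho0 h]; exists (rho / 2); first by rewrite divr_gt0.
move=> v v_rho.
have /h : ball (0 : U) rho v.
  rewrite -ball_normE /= sub0r normrN; apply: (le_lt_trans v_rho).
  by rewrite ltr_pdivrMr// ltr_pMr// ltr1n.
by rewrite (addrC x v) -addrA -opprD.
Qed.

End frechet.

Lemma sumr_const_mean {R : realType} {V : lmodType R} (v : V) n : (0 < n)%N ->
  n%:R^-1 *: \sum_(i < n) v = v.
Proof.
move=> n0; rewrite sumr_const card_ord -(scaler_nat n v) scalerA mulVf ?scale1r//.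
by rewrite pnatr_eq0 -lt0n.
Qed.

Section sample_moments.
Context {R : realType} {H : sepHilbertType R}.
Local Notation e := (onb H).

Lemma sample_meanB n (y : nat -> H) (m0 : H) : (0 < n)%N ->
  sample_mean n y - m0 = n%:R^-1 *: \sum_(i < n) (y i - m0).
Proof.
by move=> n0; rewrite sumrB scalerBr sumr_const_mean.
Qed.

(** The sample covariance is the mean of the [tensor_sq (y i - m0)] minus
    [tensor_sq (sample_mean n y - m0)], the usual shift formula for variances. *)
Lemma sample_moments n (y : nat -> H) (m0 : H) (S0 : hs_op H) : (0 < n)%N ->
  (sample_mean n y, sample_cov n y) = ((m0, S0) : hsum H (hs_op H)) +
    (n%:R^-1 *: \sum_(i < n) moment_vector m0 S0 (y i) +
     (0, - tensor_sq (sample_mean n y - m0))) :> hsum H (hs_op H).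
Proof.
move=> n0; have n1 : n%:R^-1 != 0 :> R by rewrite invr_eq0 pnatr_eq0 -lt0n.
have sumE : \sum_(i < n) moment_vector m0 S0 (y i) =
    (\sum_(i < n) (y i - m0), \sum_(i < n) (tensor_sq (y i - m0) - S0)) :> hsum H (hs_op H).
  elim: (n) => [|k IH]; first by rewrite !big_ord0.
  by rewrite !big_ord_recr /= IH.
rewrite sumE; congr pair.
  rewrite -[RHS]/(m0 + (n%:R^-1 *: \sum_(i < n) (y i - m0) + 0)).
  by rewrite addr0 -sample_meanB// addrC subrK.
rewrite -[RHS]/(S0 + (n%:R^-1 *: \sum_(i < n) (tensor_sq (y i - m0) - S0)
  - tensor_sq (sample_mean n y - m0))).
rewrite sumrB scalerBr sumr_const_mean//.
rewrite addrA addrCA subrr addr0 /sample_cov.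
set m := sample_mean n y.
have centered : \sum_(i < n) (y i - m) = 0.
  apply: (scalerI (n1 : n%:R^-1 != 0)).
  by rewrite scaler0 sumrB scalerBr sumr_const_mean// subrr.
apply/val_inj/funext => x /=.
rewrite -[LHS]/((n%:R^-1 *: \sum_(i < n) tensor_sq (y i - m) : hs_op H) x).
rewrite -[RHS]/((n%:R^-1 *: \sum_(i < n) tensor_sq (y i - m0) - tensor_sq (m - m0) : hs_op H) x).
rewrite hs_subE !hs_scaleE (hs_sumE (fun i => tensor_sq (y i - m))).
rewrite (hs_sumE (fun i => tensor_sq (y i - m0))) tensor_sqE.
apply/eqP; rewrite eq_sym subr_eq; apply/eqP.
have step (i : 'I_n) : tensor_sq (y i - m0) x = tensor_sq (y i - m) x +
    (dot (m - m0) x *: (y i - m) + (dot (y i - m) x *: (m - m0) + dot (m - m0) x *: (m - m0))).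
  rewrite !tensor_sqE -[in LHS](subrK m (y i)) -[_ + m - m0]addrA dotDl scalerDl !scalerDr.
  by rewrite -addrA; congr (_ + _); rewrite addrCA.
rewrite (eq_bigr _ (fun i _ => step i)) !big_split/= -scaler_sumr centered scaler0 add0r.
rewrite -scaler_suml -dot_suml centered dot0l scale0r add0r.
by rewrite scalerDr sumr_const_mean.
Qed.

(** The trace is at most the mean of the squared norms of the centered
    observations, by Bessel's inequality. *)
Lemma sample_cov_covariance_operator n (y : nat -> H) : covariance_operator (sample_cov n y).
Proof.
have SE x : sample_cov n y x = n%:R^-1 *: \sum_(i < n) (dot (y i - sample_mean n y) x *:
    (y i - sample_mean n y)).
  rewrite /sample_cov hs_scaleE (hs_sumE (fun i => tensor_sq (y i - sample_mean n y))).
  by [].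
set z := fun i => y i - sample_mean n y in SE.
have dE x x' : dot (sample_cov n y x) x' = n%:R^-1 * \sum_(i < n) (dot (z i) x * dot (z i) x').
  by rewrite SE dotZl dot_suml; congr (_ * _); apply: eq_bigr => i _; rewrite dotZl.
split.
- move=> x x'; rewrite dE dotC dE; congr (_ * _); apply: eq_bigr => i _; exact: mulrC.
- move=> x; rewrite dE mulr_ge0 ?invr_ge0//; apply: sumr_ge0 => i _.
  by rewrite -expr2 sqr_ge0.
apply: (@le_lt_trans _ _ (n%:R^-1 * \sum_(i < n) `|z i| ^+ 2)%:E); last exact: ltry.
apply: lime_le.
  apply: is_cvg_nneseries => i _ _; rewrite lee_fin dE mulr_ge0 ?invr_ge0//.
  by apply: sumr_ge0 => j _; rewrite -expr2 sqr_ge0.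
apply: nearW => N; rewrite sumEFin lee_fin big_mkord.
rewrite (eq_bigr (fun j : 'I_N => n%:R^-1 * \sum_(i < n) dot (z i) (e j) ^+ 2)); last first.
  by move=> j _; rewrite dE; congr (_ * _); apply: eq_bigr => i _; rewrite expr2.
rewrite -mulr_sumr ler_wpM2l ?invr_ge0// exchange_big /=.
by apply: ler_sum => i _; exact: bessel.
Qed.

End sample_moments.

(** * Mean embeddings *)

Section mean_embedding.
Context {R : realType} {H : sepHilbertType R} {Hk : hilbertType R}.
Variables (k : H -> H -> R) (ev : Hk -> H -> R) (Phi : H -> Hk).
Hypothesis k_meas : measurable_fun setT (fun z : borel H * borel H => k z.1 z.2).
Hypothesis Hk_rkhs : is_rkhs k ev Phi.
Variable Q : probability (borel H) R.
Hypothesis k_int : (\int[Q]_x (k x x)%:E < +oo)%E.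

Let dot_feature x y : dot (Phi x) (Phi y) = k x y.
Proof. by case: Hk_rkhs => _ _ evPhi repr; rewrite dotC repr evPhi. Qed.

Lemma measurable_dot_feature u : measurable_fun setT (fun x : borel H => dot (Phi x) u).
Proof. exact: rkhs_measurable k_meas Hk_rkhs. Qed.

Lemma measurable_feature_norm : measurable_fun setT (fun x : borel H => `|Phi x|).
Proof.
rewrite (_ : (fun _ => _) = (fun x : borel H => Num.sqrt (k x x))).
  apply: measurable_sqrt.
  have mdiag : measurable_fun setT (fun y : borel H => (y, y)) by exact: measurable_fun_pair.
  exact: (measurableT_comp k_meas mdiag).
by apply/funext => x; rewrite -dot_feature dot_norm sqrtr_sqr normr_id.
Qed.

Lemma integrable_feature_norm2 : Q.-integrable setT (fun x : borel H => (`|Phi x| ^+ 2)%:E).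
Proof.
apply: rintegrable_ge0; [|by move=> x; exact: sqr_ge0|].
  by apply: measurable_funX; exact: measurable_feature_norm.
by under eq_integral do rewrite -dot_norm dot_feature.
Qed.

Lemma kme_mean : is_hilbert_mean Q (Phi : borel H -> Hk) (kme Phi Q).
Proof.
apply: (@weak_mean_exists _ _ _ Q _ (Phi : borel H -> Hk) (fun x => `|Phi x|)) => //.
  by move=> u; exact: measurable_dot_feature.
exact: rintegrable_sqr_id measurable_feature_norm integrable_feature_norm2.
Qed.

Lemma centered_feature_norm2 : measurable_fun setT (fun x : borel H => `|Phi x - kme Phi Q|) /\
  Q.-integrable setT (fun x : borel H => (`|Phi x - kme Phi Q| ^+ 2)%:E).
Proof.
set mu := kme Phi Q.
have E x : `|Phi x - mu| ^+ 2 = `|Phi x| ^+ 2 - 2 * dot (Phi x) mu + `|mu| ^+ 2.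
  by rewrite normB_sqr mulr_natl.
have i2 : Q.-integrable setT (fun x : borel H => (`|Phi x - mu| ^+ 2)%:E).
  under eq_fun do rewrite E; apply: rintegrableD; last exact: rintegrable_cst.
  apply: rintegrableB; first exact: integrable_feature_norm2.
  by apply: rintegrableZ; exact: (kme_mean mu).1.
split=> //; have m2 := rintegrable_meas i2.
rewrite (_ : (fun _ => _) = (fun x : borel H => Num.sqrt (`|Phi x - mu| ^+ 2))).
  exact: measurable_sqrt.
by apply/funext => x; rewrite sqrtr_sqr normr_id.
Qed.

Lemma centered_feature_mean u :
  Q.-integrable setT (fun x : borel H => (dot (Phi x - kme Phi Q) u)%:E) /\
  \int[Q]_x dot (Phi x - kme Phi Q) u = 0.
Proof.
have [iu uE] := kme_mean u; set mu := kme Phi Q in iu uE *.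
split; first by under eq_fun do rewrite dotBl; apply: rintegrableB => //; exact: rintegrable_cst.
under eq_Rintegral do rewrite dotBl.
by rewrite (RintegralB measurableT iu (rintegrable_cst _ _)) -uE Rintegral_probability_cst subrr.
Qed.

(** Expanding the product leaves the kernel and functions of one variable. *)
Lemma measurable_centered_kernel : measurable_fun setT (fun z : borel H * borel H =>
  dot (Phi z.1 - kme Phi Q) (Phi z.2 - kme Phi Q)).
Proof.
set mu := kme Phi Q.
rewrite (_ : (fun _ => _) = (fun z : borel H * borel H =>
    k z.1 z.2 - dot (Phi z.1) mu - (dot (Phi z.2) mu - dot mu mu))).
  apply: measurable_funB; last apply: measurable_funB => //.
    apply: measurable_funB => //.
    exact: (measurableT_comp (measurable_dot_feature mu) measurable_fst).
  exact: (measurableT_comp (measurable_dot_feature mu) measurable_snd).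
apply/funext => z; rewrite dotBl !dotBr dot_feature.
by rewrite (dotC mu (Phi z.2)).
Qed.

Context {d : measure_display} {T : measurableType d} (P : probability T R) (Y : nat -> T -> borel H).
Hypothesis iidY : iid_with_law P Y Q.

Lemma centered_feature_second_moment n :
  P.-integrable setT (fun w => (`|\sum_(i < n) (Phi (Y i w) - kme Phi Q)| ^+ 2)%:E) /\
  \int[P]_w (`|\sum_(i < n) (Phi (Y i w) - kme Phi Q)| ^+ 2) =
  n%:R * \int[Q]_x (`|Phi x - kme Phi Q| ^+ 2).
Proof.
apply: (feature_sum_second_moment iidY (F := fun x : borel H => Phi x - kme Phi Q)).
- exact: measurable_centered_kernel.
- by case: centered_feature_norm2.
- exact: centered_feature_mean.
Qed.

End mean_embedding.

(** * Linearization of the statistic *)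

Section linearization.
Context {R : realType} {H : sepHilbertType R} {Hk : hilbertType R}.
Variables (Phi : H -> Hk) (G : hsum H (hs_op H) -> Hk) (m0 : H) (S0 : hs_op H).
Local Notation a0 := ((m0, S0) : hsum H (hs_op H)).

(** The correction [tensor_sq (sample_mean n y - m0)] is quadratic in the sample
    mean of the moment vectors; together with the Frechet remainder it makes up
    the error [r]. *)
Lemma embedding_linearization (mu : Hk) (C eps rho s : R) n (y : nat -> H) :
  (0 < n)%N -> 0 <= C ->
  (forall v, `|'d G a0 v| <= C * `|v|) -> 0 <= eps ->
  (forall v, `|v| <= rho -> `|G (a0 + v) - G a0 - 'd G a0 v| <= eps * `|v|) ->
  s + s ^+ 2 <= rho ->
  `|n%:R^-1 *: \sum_(i < n) moment_vector m0 S0 (y i)| <= s ->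
  `|n%:R^-1 *: \sum_(i < n) (Phi (y i) - mu)| <= s ->
  let A := n%:R^-1 *: \sum_(i < n) (Phi (y i) - mu - 'd G a0 (moment_vector m0 S0 (y i))) in
  `|a0 - (sample_mean n y, sample_cov n y)| <= s + s ^+ 2 /\
  exists r, [/\
    n%:R^-1 *: \sum_(i < n) Phi (y i) - G (sample_mean n y, sample_cov n y) =
      (mu - G a0) + A + r,
    `|A| <= (1 + C) * s & `|r| <= C * s ^+ 2 + eps * (s + s ^+ 2)].
Proof.
move=> n0 C0 DC eps0 rem s_rho; set Zb := n%:R^-1 *: _; set Fb := n%:R^-1 *: _ => Zs Fs A.
have s0 : 0 <= s by exact: le_trans Zs.
set D := 'd G a0 in DC rem A *.
pose q : hsum H (hs_op H) := (0, - tensor_sq (sample_mean n y - m0)).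
have qs : `|q| <= s ^+ 2.
  apply: (le_trans (hsum_norm_le _)); rewrite /= normr0 add0r normrN.
  apply: (le_trans (tensor_sq_norm _)); rewrite lerXn2r ?nnegrE//.
  rewrite (sample_meanB y m0 n0); apply: le_trans Zs.
  suff -> : n%:R^-1 *: \sum_(i < n) (y i - m0) = Zb.1 by exact: hsum_norm_fst.
  rewrite /Zb -[RHS]/(n%:R^-1 *: (\sum_(i < n) moment_vector m0 S0 (y i)).1); congr (_ *: _).
  by rewrite (big_morph (fun v : hsum H (hs_op H) => v.1) (fun _ _ => erefl) erefl).
have mE : (sample_mean n y, sample_cov n y) = a0 + (Zb + q) by exact: sample_moments.
have dl : `|Zb + q| <= s + s ^+ 2 by rewrite (le_trans (ler_normD _ _))// lerD.
rewrite mE; split; first by rewrite opprD addrA subrr add0r normrN.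
have AE : A = Fb - D Zb.
  rewrite /A sumrB scalerBr; congr (_ - _).
  by rewrite /Zb linearZ_LR (linear_sum D).
pose r0 := G (a0 + (Zb + q)) - G a0 - D (Zb + q).
exists (- D q - r0); split.
- have -> : n%:R^-1 *: \sum_(i < n) Phi (y i) = mu + Fb.
    by rewrite /Fb sumrB scalerBr sumr_const_mean// addrC subrK.
  have -> : G (a0 + (Zb + q)) = G a0 + (D Zb + D q) + r0.
    have -> : r0 = G (a0 + (Zb + q)) - (G a0 + D (Zb + q)) by rewrite /r0 (opprD (G a0)) (addrA (G _)).
    by rewrite -linearD [RHS]addrC subrK.
  rewrite AE; move: (G a0) (D Zb) (D q) r0 Fb {Fs AE A} => g z dq r F.
  by rewrite !opprD -!addrA; congr (_ + _); rewrite [LHS]addrCA.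
- rewrite AE (le_trans (ler_normB _ _))// mulrDl mul1r lerD//.
  by rewrite (le_trans (DC _))// ler_wpM2l.
- rewrite (le_trans (ler_normB _ _))// normrN lerD//.
    by rewrite (le_trans (DC _))// ler_wpM2l.
  rewrite (le_trans (rem _ (le_trans dl s_rho)))// ler_wpM2l//.
Qed.

Lemma sqnorm_expansion_error (h A r : Hk) :
  `| `|h + A + r| ^+ 2 - `|h| ^+ 2 - 2 * dot A h| <= 2 * `|r| * `|h| + (`|A| + `|r|) ^+ 2.
Proof.
have -> : `|h + A + r| ^+ 2 - `|h| ^+ 2 - 2 * dot A h = 2 * dot r h + `|A + r| ^+ 2.
  by rewrite -(addrA h A r) (normD_sqr h (A + r)) dotDr (dotC h A) (dotC h r); ring.
rewrite (le_trans (ler_normD _ _))// lerD//.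
  by rewrite normrM ger0_norm// -mulrA ler_wpM2l// dot_le.
by rewrite normrX normr_id lerXn2r ?nnegrE ?addr_ge0// ler_normD.
Qed.

End linearization.

(** With [t = 1 / sqrt n]: every term of the error is [O (t ^+ 2)], except for
    the Frechet remainder [eps * K * t], whose [eps] can be made small. *)
Lemma remainder_rate {R : realType} (c C K e : R) : 0 <= c -> 0 <= C -> 0 < K -> 0 < e ->
  exists eps t0 : R, [/\ 0 < eps, 0 < t0, t0 <= 1 &
    forall t a r : R, 0 < t -> t <= t0 -> 0 <= a -> a <= (1 + C) * (K * t) ->
      0 <= r -> r <= C * (K * t) ^+ 2 + eps * (K * t + (K * t) ^+ 2) ->
      t^-1 * (2 * r * c + (a + r) ^+ 2) <= e].
Proof.
move=> c0 C0 K0 e0.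
have cK0 : 0 < 4 * (c * K) + 1 by rewrite ltr_wpDl// mulr_ge0// mulr_ge0// ltW.
pose eps := Num.min 1 (e / (4 * (c * K) + 1)).
have eps0 : 0 < eps by rewrite lt_min ltr01 divr_gt0.
have eps1 : eps <= 1 by rewrite ge_min lexx.
have epse : 2 * c * (eps * K) <= e / 2.
  have : eps * (4 * (c * K) + 1) <= e by rewrite -ler_pdivlMr// ge_min lexx orbT.
  rewrite (_ : 2 * c * (eps * K) = 2 * eps * (c * K)); last by ring.
  by have := ltW eps0; move: (c * K) (mulr_ge0 c0 (ltW K0)) => x x0 h1 h2; nra.
pose B1 := C * K ^+ 2 + K ^+ 2.
have B10 : 0 <= B1 by rewrite addr_ge0 ?sqr_ge0// mulr_ge0// sqr_ge0.
pose B2 := (1 + C) * K + (B1 + K).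
have B20 : 0 <= B2 by rewrite !addr_ge0 ?mulr_ge0 ?addr_ge0// ltW.
pose B := 2 * c * B1 + B2 ^+ 2.
have B0 : 0 <= B by rewrite addr_ge0 ?sqr_ge0 ?mulr_ge0.
have B1' : 0 < 2 * B + 1 by rewrite ltr_wpDl// mulr_ge0.
exists eps, (Num.min 1 (e / (2 * B + 1))); split => //.
- by rewrite lt_min ltr01 divr_gt0.
- by rewrite ge_min lexx.
move=> t a r t0; rewrite le_min ler_pdivlMr// => /andP[t1 tB] a0 ha r0 hr.
(* [eps <= 1] absorbs the quadratic part of [eps * (K * t + (K * t) ^+ 2)] *)
have hr1 : r <= t * (t * B1 + eps * K).
  apply: (le_trans hr); rewrite /B1 -subr_ge0.
  rewrite [X in 0 <= X](_ : _ = (1 - eps) * (K * t) ^+ 2); last by ring.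
  by rewrite mulr_ge0 ?sqr_ge0// subr_ge0.
have hr2 : r <= t * (B1 + K).
  apply: (le_trans hr1); rewrite ler_wpM2l ?(ltW t0)// lerD//.
    by rewrite ler_piMl.
  by rewrite ler_piMl// ltW.
have har : a + r <= t * B2.
  rewrite /B2 mulrDr; apply: lerD => //.
  by rewrite (le_trans ha)// le_eqVlt; apply/orP; left; apply/eqP; ring.
rewrite ler_pdivrMl//.
apply: (@le_trans _ _ (2 * (t * (t * B1 + eps * K)) * c + (t * B2) ^+ 2)).
  apply: lerD; last by rewrite lerXn2r ?nnegrE ?addr_ge0// (le_trans _ har)// addr_ge0.
  by rewrite ler_wpM2r// ler_wpM2l.
rewrite (_ : _ + _ = t * (2 * c * (eps * K) + t * B)); last by rewrite /B; ring.
rewrite ler_wpM2l ?(ltW t0)//.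
by have := ltW t0; move: (2 * c * _) epse => x; lra.
Qed.
(** * The influence function *)

Section linear_image.
Context {R : realType} {H : sepHilbertType R} {K : hilbertType R}.
Variables (m0 : H) (S0 : hs_op H) (Q : probability (borel H) R).
Hypothesis Qmean : is_hilbert_mean Q (id : borel H -> H) m0.
Hypothesis Qcov : is_hilbert_cov Q (id : borel H -> H) S0.
Hypothesis Qmoment : (\int[Q]_x (`|moment_vector m0 S0 x| ^+ 2)%:E < +oo)%E.
Context {d : measure_display} {T : measurableType d} (P : probability T R) (Y : nat -> T -> borel H).
Hypothesis iidY : iid_with_law P Y Q.

(** Bounded linear functionals of the moment vectors are centered although only
    the coordinates are known to be: they are dominated by the norm, whose
    second moment is additive. *)
Lemma linear_moment_centered (D : {linear hsum H (hs_op H) -> K}) (C : R) (u : K) :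
  continuous (D : hsum H (hs_op H) -> K) -> (forall v, `|D v| <= C * `|v|) -> [/\
    measurable_fun setT (fun x : borel H => dot (D (moment_vector m0 S0 x)) u),
    Q.-integrable setT (fun x : borel H => (dot (D (moment_vector m0 S0 x)) u ^+ 2)%:E) &
    \int[Q]_x dot (D (moment_vector m0 S0 x)) u = 0].
Proof.
move=> cD DC.
have ml : measurable_fun setT (fun x : borel H => dot (D (moment_vector m0 S0 x)) u).
  apply: (measurable_moment_vector m0 S0 (L := fun v => dot (D v) u)) => v.
  exact: (@dot_cvg _ _ _ (nbhs v) _ D (D v) u (cD v)).
have hq := moment_vector_second_moment Qmean Qcov Qmoment iidY.
have [|//|||i2 i0] := additive_second_moment_mean0 (l := fun v => dot (D v) u)
    (C := C ^+ 2 * `|u| ^+ 2) iidY hq Qmoment.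
- by move=> v w; rewrite linearD dotDl.
- by rewrite mulr_ge0 ?sqr_ge0.
- move=> v; rewrite -EFinM lee_fin (le_trans (dot_sqr_le _ _))//.
  rewrite [leRHS]mulrAC ler_wpM2r ?sqr_ge0// -exprMn lerXn2r ?nnegrE//.
  by rewrite (le_trans _ (DC v)).
by split.
Qed.

Lemma measurable_moment_norm : measurable_fun setT (fun x : borel H => `|moment_vector m0 S0 x|).
Proof.
have [_ /measurable_EFinP m2 _ _] := moment_vector_second_moment Qmean Qcov Qmoment iidY.
rewrite (_ : (fun _ => _) = (fun x : borel H => Num.sqrt (`|moment_vector m0 S0 x| ^+ 2))).
  exact: measurable_sqrt.
by apply/funext => x; rewrite sqrtr_sqr normr_id.
Qed.

Lemma moment_sum_norm n :
  measurable_fun setT (fun w => `|\sum_(i < n) moment_vector m0 S0 (Y i w)|) /\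
  (\int[P]_w (`|\sum_(i < n) moment_vector m0 S0 (Y i w)| ^+ 2)%:E =
   (n%:R * fine (\int[Q]_x (`|moment_vector m0 S0 x| ^+ 2)%:E))%:E)%E.
Proof.
have [_ _ mP qE] := moment_vector_second_moment Qmean Qcov Qmoment iidY.
split; last first.
  rewrite qE EFinM fineK// ge0_fin_numE//; apply: integral_ge0 => x _.
  by rewrite lee_fin sqr_ge0.
have /measurable_EFinP m2 := mP n.
rewrite (_ : (fun _ => _) = (fun w => Num.sqrt (`|\sum_(i < n) moment_vector m0 S0 (Y i w)| ^+ 2))).
  exact: measurable_sqrt.
by apply/funext => x; rewrite sqrtr_sqr normr_id.
Qed.

End linear_image.

Section influence_function.
Context {R : realType} {H : sepHilbertType R} {Hk : hilbertType R}.
Variables (k : H -> H -> R) (ev : Hk -> H -> R) (Phi : H -> Hk).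
Hypothesis k_meas : measurable_fun setT (fun z : borel H * borel H => k z.1 z.2).
Hypothesis Hk_rkhs : is_rkhs k ev Phi.
Variables (m0 : H) (S0 : hs_op H) (Q : probability (borel H) R).
Hypothesis Qmean : is_hilbert_mean Q (id : borel H -> H) m0.
Hypothesis Qcov : is_hilbert_cov Q (id : borel H -> H) S0.
Hypothesis Qmoment : (\int[Q]_x (`|moment_vector m0 S0 x| ^+ 2)%:E < +oo)%E.
Hypothesis Qkernel : (\int[Q]_x (k x x)%:E < +oo)%E.
Context {d : measure_display} {T : measurableType d} (P : probability T R) (Y : nat -> T -> borel H).
Hypothesis iidY : iid_with_law P Y Q.
Variables (D : {linear hsum H (hs_op H) -> Hk}) (C : R).
Hypothesis cD : continuous (D : hsum H (hs_op H) -> Hk).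
Hypothesis DC : forall v, `|D v| <= C * `|v|.

(** With [D] the derivative of [G], this is [f x - h] in the notation of the
    theorem. *)
Definition influence (x : borel H) : Hk := Phi x - kme Phi Q - D (moment_vector m0 S0 x).

Lemma influence_dot u : [/\
  measurable_fun setT (fun x => dot (influence x) u),
  Q.-integrable setT (fun x => (dot (influence x) u ^+ 2)%:E) &
  \int[Q]_x dot (influence x) u = 0].
Proof.
have [mD iD D0] := linear_moment_centered Qmean Qcov Qmoment iidY u cD DC.
have [mnF iF2] := centered_feature_norm2 k_meas Hk_rkhs Qkernel.
have [iF F0] := centered_feature_mean k_meas Hk_rkhs Qkernel u.
have mF := rintegrable_meas iF.
have E x : dot (influence x) u = dot (Phi x - kme Phi Q) u - dot (D (moment_vector m0 S0 x)) u.
  by rewrite /influence dotBl.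
have m : measurable_fun setT (fun x => dot (influence x) u).
  by under eq_fun do rewrite E; exact: measurable_funB.
split => //.
  apply: (rintegrable_le (g := fun x : borel H => 2 * (`|u| ^+ 2 * `|Phi x - kme Phi Q| ^+ 2) +
      2 * dot (D (moment_vector m0 S0 x)) u ^+ 2)).
  - exact: measurable_funX.
  - move=> x; rewrite ger0_norm ?sqr_ge0// E.
    have := dot_sqr_le (Phi x - kme Phi Q) u.
    rewrite (mulrC (`|Phi x - _| ^+ 2)).
    move: (dot (Phi x - _) u) (dot (D _) u) (`|u| ^+ 2 * _) => a b z az.
    by have := sqr_ge0 (a + b); nra.
  - by apply: rintegrableD; apply: rintegrableZ => //; exact: rintegrableZ.
under eq_Rintegral do rewrite E.
rewrite (RintegralB measurableT iF (rintegrable_sqr_id mD iD)) F0 D0 subrr//.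
Qed.

(** The vector [h] is the weak mean of [f], so the covariance of [f] is that of the
    influence function. *)
Lemma influence_cov (f : borel H -> Hk) (h : Hk) i : (forall x, f x = h + influence x) ->
  dot (hilbert_cov P (fun w => f (Y i w)) h) h = \int[Q]_x (dot (influence x) h ^+ 2).
Proof.
move=> fE.
have mf u : measurable_fun setT (fun x => dot (f x) u).
  under eq_fun do rewrite fE dotDl; apply: measurable_funD => //.
  by case: (influence_dot u).
have mY := iid_measurable iidY i.
have [mnF iF2] := centered_feature_norm2 k_meas Hk_rkhs Qkernel.
have mZ := measurable_moment_norm Qmean Qcov Qmoment iidY.
pose b x := `|Phi x - kme Phi Q| + C * `|moment_vector m0 S0 x|.
have ib : Q.-integrable setT (fun x : borel H => (b x ^+ 2)%:E).
  have mb : measurable_fun setT (b : borel H -> R).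
    by apply: measurable_funD => //; exact: measurable_funM.
  apply: (rintegrable_le (g := fun x : borel H => 2 * `|Phi x - kme Phi Q| ^+ 2 +
      2 * C ^+ 2 * `|moment_vector m0 S0 x| ^+ 2)).
  - exact: measurable_funX.
  - move=> x; rewrite ger0_norm ?sqr_ge0// /b.
    by move: `|Phi x - _| `|moment_vector _ _ _| => y z; have := sqr_ge0 (y - C * z); nra.
  - apply: rintegrableD; apply: rintegrableZ => //.
    apply: rintegrable_ge0 => //; first exact: measurable_funX.
rewrite (@hilbert_cov_diag _ _ _ P _ (fun w => f (Y i w)) h h (fun w => b (Y i w))).
- have [m _ _] := influence_dot h.
  congr fine; under eq_integral do rewrite fE addrC addKr.
  rewrite (integral_iid iidY i (f := fun x => (dot (influence x) h ^+ 2)%:E))//.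
  by apply/measurable_EFinP; exact: measurable_funX.
- by move=> u; exact: (measurableT_comp (mf u) mY).
- move=> u; have [mi i2 i0] := influence_dot u; have i1 := rintegrable_sqr_id mi i2.
  have if_ : Q.-integrable setT (fun x => (dot (f x) u)%:E).
    under eq_fun do rewrite fE dotDl; apply: rintegrableD => //; exact: rintegrable_cst.
  split; first exact: (integrable_iid iidY i (f := fun x => dot (f x) u)).
  rewrite [RHS](_ : _ = \int[Q]_x dot (f x) u); last first.
    congr fine; apply: (integral_iid iidY i (f := fun x => (dot (f x) u)%:E)).
    exact/measurable_EFinP.
  under eq_Rintegral do rewrite fE dotDl.
  rewrite (RintegralD measurableT (rintegrable_cst _ _) i1) i0 addr0.
  by rewrite Rintegral_probability_cst.
- move=> w; rewrite fE addrC addKr /influence (le_trans (ler_normB _ _))// lerD//.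
  exact: DC.
- exact: (integrable_iid iidY i (f := fun x : borel H => b x ^+ 2)).
Qed.

End influence_function.

(** * The limit distribution under the alternative *)

Theorem theorem1 (R : realType) (H : sepHilbertType R)
  (k : H -> H -> R) (Hk : hilbertType R) (ev : Hk -> H -> R) (Phi : H -> Hk)
  (k_pd : positive_definite_kernel k)
  (k_meas : measurable_fun setT (fun z : borel H * borel H => k z.1 z.2))
  (Hk_rkhs : is_rkhs k ev Phi)
  (k_char : characteristic k Phi)
  (* N(m, S) only exists when S is a covariance operator, which fails for some S
     in the ball; G is the smooth map on the ball that agrees with
     (m, S) |-> mu(N(m, S)) wherever the latter is defined. *)
  (m0 : H) (S0 : hs_op H) (eps : R) (G : hsum H (hs_op H) -> Hk)
  (eps_gt0 : 0 < eps)
  (G_kme : forall (m : H) (S : hs_op H),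
     `|((m0, S0) : hsum H (hs_op H)) - (m, S)| < eps ->
     covariance_operator S ->
     kme_integrable k (gaussian m S) /\ G (m, S) = kme Phi (gaussian m S))
  (G_C2 : twice_continuously_differentiable_on
     [set x : hsum H (hs_op H) | `|((m0, S0) : hsum H (hs_op H)) - x| < eps] G)
  (J : set nat) (lam : nat -> R) (Psi : nat -> borel H -> R)
  (eigen : is_eigensystem (gaussian m0 S0) (centered_feature Phi G m0 S0) J lam Psi)
  (Q : probability (borel H) R)
  (Q_alt : alternative k Phi (centered_feature Phi G m0 S0) m0 S0 J lam Psi Q)
  (Q_int : kme_integrable k Q)
  (d : measure_display) (Omega : measurableType d) (Pr : probability Omega R)
  (Y : nat -> Omega -> borel H)
  (Y_iid : iid_with_law Pr Y Q)
  (Y_int : forall (n : nat) (w : Omega), (0 < n)%N ->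
     kme_integrable k (gaussian (sample_mean n (Y ^~ w)) (sample_cov n (Y ^~ w)))) :
  let f := centered_feature Phi G m0 S0 in
  let Delta2 := mmd_sq Phi m0 S0 Q in
  let hatDelta2 (n : nat) (w : Omega) := sample_mmd_sq Phi n (Y ^~ w) in
  let h := kme Phi Q - kme Phi (gaussian m0 S0) in
  let v2 := 4 * dot (hilbert_cov Pr (fun w => f (Y 0%N w)) h) h in
  cvg_in_distribution Pr
    (fun n w => Num.sqrt n%:R * (hatDelta2 n w - Delta2))
    (real_gaussian 0 v2).
Proof.
move=> f Delta2 hatDelta2 h v2.
pose a0 := (m0, S0) : hsum H (hs_op H).
have [_ Qm Qc Qk Qz _] := Q_alt.
have S0_cov : covariance_operator S0 := moment_covariance_operator Qm Qc Qz.
have G0 : G a0 = kme Phi (gaussian m0 S0).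
  by apply: (G_kme _ _ _ S0_cov).2; rewrite subrr normr0.
have dG : differentiable G a0.
  by have [D2 /(_ a0)] := G_C2; rewrite /= subrr normr0 => /(_ eps_gt0)[].
pose D : {linear hsum H (hs_op H) -> Hk} := 'd G a0.
have [C C0 DC] := differentiable_bounded dG.
have cD : continuous (D : hsum H (hs_op H) -> Hk) by exact: diff_continuous.
pose psi := influence Phi m0 S0 Q D.
have fE x : f x = h + psi x.
  rewrite /f /centered_feature /psi /influence /h -/a0 -[X in 'd G a0 X]/(moment_vector m0 S0 x).
  rewrite -/D; move: (D _) (Phi x) (kme Phi Q) (kme Phi _) => w x1 x2 x3.
  by rewrite [RHS]addrC (addrAC x1 (- x2)) addrA subrK.
have [mpsi ipsi psi0] := influence_dot k_meas Hk_rkhs Qm Qc Qz Qk Y_iid cD DC h.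
pose phi (x : borel H) := 2 * dot (psi x) h.
have mphi : measurable_fun setT phi by exact: measurable_funM.
have phi2 x : phi x ^+ 2 = 4 * dot (psi x) h ^+ 2 by rewrite /phi; ring.
have iphi : Q.-integrable setT (fun x => (phi x ^+ 2)%:E).
  by under eq_fun do rewrite phi2; exact: rintegrableZ.
have phi0 : \int[Q]_x phi x = 0.
  by rewrite RintegralZl// ?psi0 ?mulr0//; exact: rintegrable_sqr_id.
have v2E : v2 = \int[Q]_x (phi x ^+ 2).
  rewrite /v2 (influence_cov k_meas Hk_rkhs Qm Qc Qz Qk Y_iid cD DC 0%N fE).
  by under [RHS]eq_Rintegral do rewrite phi2; rewrite RintegralZl.
rewrite v2E.
apply: (cvg_in_distribution_perturb _ _ (central_limit_theorem Y_iid mphi iphi phi0)).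
- by move=> n; exact: (measurable_normalized_sum Y_iid mphi).
- by move=> n; exact: (normalized_sum_second_moment Y_iid mphi iphi phi0).
move=> e e0.
have [mF2 iF2] := centered_feature_norm2 k_meas Hk_rkhs Qk.
set cF := \int[Q]_x (`|Phi x - kme Phi Q| ^+ 2).
set cZ := fine (\int[Q]_x (`|moment_vector m0 S0 x| ^+ 2)%:E)%E.
have cF0 : 0 <= cF by apply: Rintegral_ge0 => x _; exact: sqr_ge0.
have cZ0 : 0 <= cZ by rewrite fine_ge0//; apply: integral_ge0 => x _; rewrite lee_fin sqr_ge0.
(* with this [K] the exceptional events have total probability at most [e] *)
pose K := Num.sqrt ((cF + cZ + 1) / e).
have KE0 : 0 < (cF + cZ + 1) / e by rewrite divr_gt0// ltr_wpDl// addr_ge0.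
have K0 : 0 < K by rewrite sqrtr_gt0.
have K2 : (cZ + cF) / K ^+ 2 <= e.
  rewrite ler_pdivrMr ?exprn_gt0// sqr_sqrtr ?(ltW KE0)// mulrC divfK ?gt_eqF//.
  by rewrite (addrC cZ) lerDl.
have [eta [t0 [eta0 t00 t01 rate]]] := remainder_rate (normr_ge0 h) C0 K0 e0.
have [rho rho0 rem] := differentiable_remainder dG eta0.
have KK0 : 0 < K + K ^+ 2 by rewrite addr_gt0// exprn_gt0.
(* [t <= tau] keeps the sample moments inside the ball where [G] agrees with the
   mean embedding, and where the Frechet remainder is controlled *)
pose tau := Num.min t0 (Num.min rho (eps / 2) / (K + K ^+ 2)).
have tau0 : 0 < tau by rewrite lt_min t00 divr_gt0// lt_min rho0 divr_gt0.
have taut : tau <= t0 by rewrite ge_min lexx.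
have small (t : R) : 0 < t -> t <= tau -> K * t + (K * t) ^+ 2 <= Num.min rho (eps / 2).
  move=> tp tt; apply: (@le_trans _ _ (t * (K + K ^+ 2))).
    have t1 : t <= 1 by rewrite (le_trans tt)// (le_trans taut).
    rewrite mulrDr (mulrC K t) lerD2l exprMn ler_wpM2r ?sqr_ge0//.
    by rewrite expr2 ler_piMl// ltW.
  by rewrite -ler_pdivlMr// (le_trans tt)// ge_min lexx orbT.
exists (Num.bound (tau ^- 2)).+1 => // n /= n_large.
have n0 : (0 < n)%N by exact: leq_ltn_trans n_large.
have nR0 : 0 < n%:R :> R by rewrite ltr0n.
set rt := Num.sqrt n%:R; pose t := rt^-1.
have rt0 : 0 < rt by rewrite sqrtr_gt0.
have rt2 : rt ^+ 2 = n%:R by rewrite sqr_sqrtr// ltW.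
have tp : 0 < t by rewrite invr_gt0.
have t_tau : t <= tau.
  rewrite /t -[leRHS]invrK lef_pV2 ?posrE ?invr_gt0//.
  rewrite -(@ler_pXn2r _ 2)// ?nnegrE ?invr_ge0 ?(ltW tau0) ?(ltW rt0)// rt2 exprVn.
  apply: (@le_trans _ _ (Num.bound (tau ^- 2))%:R); last by rewrite ler_nat ltnW.
  by apply: ltW; apply: archi_boundP; rewrite invr_ge0 sqr_ge0.
have s_small := small t tp t_tau.
pose SZ w := `|\sum_(i < n) moment_vector m0 S0 (Y i w)|.
pose SF w := `|\sum_(i < n) (Phi (Y i w) - kme Phi Q)|.
have [mSZ SZE] : measurable_fun setT SZ /\ _ := moment_sum_norm Qm Qc Qz Y_iid n.
have [iSF SFE] := centered_feature_second_moment k_meas Hk_rkhs Qk Y_iid n.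
have mSF : measurable_fun setT SF.
  rewrite (_ : SF = fun w => Num.sqrt (SF w ^+ 2)).
    by apply: measurable_sqrt; exact: rintegrable_meas iSF.
  by apply/funext => w; rewrite sqrtr_sqr normr_id.
have Krt0 : 0 < K * rt by rewrite mulr_gt0.
have tailZ := second_moment_tail (P := Pr) (c := n%:R * cZ) mSZ Krt0.
have tailF := second_moment_tail (P := Pr) (c := n%:R * cF) mSF Krt0.
pose AZ := [set w | (K * rt < `|SZ w|)%R]; pose AF := [set w | (K * rt < `|SF w|)%R].
have mAZ : measurable AZ := measurable_tail _ mSZ.
have mAF : measurable AF := measurable_tail _ mSF.
exists (AZ `|` AF); split; first exact: measurableU.
  apply: (@le_trans _ _ (Pr AZ + Pr AF)%E); first exact: measureU2.
  apply: (@le_trans _ _ ((n%:R * cZ / (K * rt) ^+ 2)%:E + (n%:R * cF / (K * rt) ^+ 2)%:E)%E).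
    apply: leeD; first by apply: tailZ; rewrite SZE.
    by apply: tailF; rewrite -EFin_Rintegral// SFE.
  rewrite -EFinD lee_fin (le_trans _ K2)// exprMn rt2 -mulrDl -mulrDr.
  by rewrite le_eqVlt; apply/orP; left; apply/eqP; field; rewrite !gt_eqF.
move=> w /not_orP[/negP]; rewrite -leNgt normr_id => SZw /negP; rewrite -leNgt normr_id => SFw.
have mean_small (V : normedModType R) (x : V) : `|x| <= K * rt -> `|n%:R^-1 *: x| <= K * t.
  move=> hx; rewrite normrZ ger0_norm ?invr_ge0 ?ler0n//.
  rewrite ler_pdivrMl// (le_trans hx)// -rt2 /t.
  by rewrite le_eqVlt; apply/orP; left; apply/eqP; field; rewrite gt_eqF.
have [|||near_a0 [r [XE Ar rr]]] := @embedding_linearization R H Hk Phi G m0 S0 (kme Phi Q) C eta rho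
    (K * t) n (Y ^~ w) n0 C0 DC (ltW eta0) rem.
- by rewrite (le_trans s_small)// ge_min lexx.
- exact: mean_small.
- exact: mean_small.
have GE : G (sample_mean n (Y ^~ w), sample_cov n (Y ^~ w)) =
    kme Phi (gaussian (sample_mean n (Y ^~ w)) (sample_cov n (Y ^~ w))).
  apply: (G_kme _ _ _ (sample_cov_covariance_operator _ _)).2.
  apply: (le_lt_trans near_a0); apply: (le_lt_trans s_small).
  by rewrite gt_min ltr_pdivrMr// ltr_pMr// ltr1n orbT.
move: XE Ar; set A := n%:R^-1 *: \sum_(i < n) (_ - _ - _) => XE Ar.
have -> : hatDelta2 n w = `|h + A + r| ^+ 2.
  by rewrite /hatDelta2 /sample_mmd_sq -GE XE -/a0 G0.
have -> : rt^-1 * \sum_(i < n) phi (Y i w) = rt * (2 * dot A h).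
  rewrite /A dotZl dot_suml -mulr_sumr -rt2.
  by move: (\sum_(i < n) _) => S; field; rewrite gt_eqF.
rewrite -mulrBr normrM gtr0_norm//.
apply: (le_trans (ler_wpM2l (ltW rt0) (sqnorm_expansion_error h A r))).
by rewrite -[rt in leLHS]invrK; apply: rate => //; exact: le_trans taut.
Qed.
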